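(* Fix $a>0$ and let $b\to+\infty$ through real values. Let $\mathcal{A}=\{\xi=x+iy\in\mathbb{C}:\ x<1 \text{ or } x-1-\tfrac12\log(x^2+y^2)<0\}$ and $\mathcal{B}=\{\xi=x+iy\in\mathbb{C}:\ x>1 \text{ and } x-1-\tfrac12\log(x^2+y^2)>0\}$. (a) For $\xi\in\mathcal{A}$, writing $w=\xi/(1-\xi)$, $$ {}_1F_1(a;b;b\xi)=(1-\xi)^{-a}\Big\{1-\frac{a(a+1)}{2}w^2\,b^{-1}+\Big[\frac{a(a+1)(a+2)(a+3)}{8}w^4+\frac{2a(a+1)(a+2)}{3}w^3+\frac{a(a+1)}{2}w^2\Big]b^{-2}+O(b^{-3})\Big\}, $$ uniformly for $\xi$ in compact subsets of $\mathcal{A}$, where $(1-\xi)^{-a}$ is the principal branch (i.e. $\arg(1-\xi)=0$ for real $\xi<1$). (b) For $\xi\in\mathcal{B}$, $$ {}_1F_1(a;b;b\xi)=e^{b(\xi-1-\log\xi)}\,b^{a-\frac12}\,\frac{\sqrt{2\pi}}{\Gamma(a)}\,\xi(\xi-1)^{a-1}\Big[1+\frac{1}{12b}\Big(1+\frac{12a(a-1)}{\xi-1}+\frac{6(a-1)(a-2)}{(\xi-1)^2}\Big)+O(b^{-2})\Big], $$ uniformly for $\xi$ in compact subsets of $\mathcal{B}$, where $\log\xi$ and $(\xi-1)^{a-1}$ are principal branches (i.e. $\arg\xi=\arg(\xi-1)=0$ for real $\xi>1$).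
   Context: ${}_1F_1(a;b;z)=\sum_{k=0}^\infty \frac{(a)_k}{(b)_k}\frac{z^k}{k!}$ is Kummer's confluent hypergeometric function, with $(x)_k=\Gamma(x+k)/\Gamma(x)$. *)

(* Defs.v *)
From HB Require Import structures.
From mathcomp Require Import all_boot all_order all_algebra.
From mathcomp Require Import all_classical all_reals all_analysis.
From mathcomp Require Import complex.
Set Implicit Arguments. Unset Strict Implicit. Unset Printing Implicit Defensive.
Import Order.TTheory GRing.Theory Num.Theory numFieldNormedType.Exports.
Local Open Scope classical_set_scope.
Local Open Scope ring_scope.
Local Open Scope complex_scope.

(* The complex plane over a real type R, with its numClosedField structure
   (hence the usual Euclidean norm topology from MathComp-Analysis). *)
Definition Cplx (R : realType) : numClosedFieldType := R[i].

Section ComplexFunctions.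
Variable R : realType.
Local Notation C := (Cplx R).

Definition cre (z : C) : R := complex.Re (z : R[i]).
Definition cim (z : C) : R := complex.Im (z : R[i]).
Definition cmod (z : C) : R := Num.sqrt (cre z ^+ 2 + cim z ^+ 2).
Definition cofR (x : R) : C := (x%:C : R[i]).

Definition cexp (z : C) : C :=
  ((expR (cre z) * cos (cim z)) +i* (expR (cre z) * sin (cim z)) : R[i]).

(* principal argument, in (-pi, pi]; arg 0 := 0 (irrelevant convention) *)
Definition carg (z : C) : R :=
  if z == 0 then 0
  else if 0 <= cim z then acos (cre z / cmod z) else - acos (cre z / cmod z).

Definition clog (z : C) : C := ((ln (cmod z)) +i* (carg z) : R[i]).

Definition cpow (z c : C) : C := cexp (c * clog z).

End ComplexFunctions.

Definition poch (R : realType) (x : R) (k : nat) : R := \prod_(j < k) (x + j%:R).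

Definition Gamma (R : realType) (a : R) : R :=
  (\int[@lebesgue_measure R]_(t in `[0%R, +oo[) (t `^ (a - 1) * expR (- t)))%R.

Definition F11 (R : realType) (a b : R) (z : Cplx R) : Cplx R :=
  limn (fun n : nat => \sum_(k < n)
          (cofR (poch a k / (poch b k * (k`!)%:R)) * z ^+ k)).

Definition regA (R : realType) : set (Cplx R) :=
  [set xi | cre xi < 1 \/
            cre xi - 1 - 2^-1 * ln (cre xi ^+ 2 + cim xi ^+ 2) < 0].
Definition regB (R : realType) : set (Cplx R) :=
  [set xi | 1 < cre xi /\
            0 < cre xi - 1 - 2^-1 * ln (cre xi ^+ 2 + cim xi ^+ 2)].

(* Main.v *)
(**
With [f xi = 1F1(a; b; b xi)], Kummer's equation reads [xi f'' = b ((xi - 1) f' + a f)].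

(a) Set [T = 1 / (1 - xi)]. The error [g = f (1 - xi)^a - S] and a companion [h] of its derivative
satisfy a linear system in which [h] is damped at rate [b Re (gam' (1 / gam - 1))] along a path
[gam], with a source of order [b^-2]. The rate is of order [b] when [log |gam| - Re gam] increases,
which holds on the rays from [0] to points with [Re xi < 1] and, elsewhere in the region, on curves
[log |gam| = (1 + dc) Re gam + const] reached from such a ray. The initial errors vanish at [xi = 0].

(b) Set [psi = xi - 1 - log xi]. Now [f] is not dominated by its value at a finite point, so one
starts from infinity on the real axis. There [f'] has coefficients proportional to the quotients
[Gamma (a + 1 + k) / Gamma (b + 1 + k)], and Jensen's inequality for the Gamma density together
with a comparison with Poisson weights gives the limit of [exp(- b psi) (xi - 1)^(- a) f']; the
Riccati equation of [f / f'] carries the information down to [Re xi >= 1 + eta] with an error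
[O(b^-2)]. The values off the axis follow from the damped system for
[exp(- b psi) (xi - 1)^(- a) f'] and the deviation of [f / f'] from its expansion, along a segment
of slope [1] or [-1] and then a curve [log |gam| = (1 - dc) Re gam + const]. Stirling's formula
evaluates the constant.
*)

Require Import Defs.
From HB Require Import structures.
From mathcomp Require Import all_boot all_order all_algebra.
From mathcomp Require Import all_classical all_reals all_analysis.
From mathcomp Require Import complex measurable_realfun ring lra zify.
Set Implicit Arguments. Unset Strict Implicit. Unset Printing Implicit Defensive.
Import Order.TTheory GRing.Theory Num.Theory numFieldNormedType.Exports.
Local Open Scope classical_set_scope.
Local Open Scope ring_scope.

(** * Complex arithmetic and derivatives along paths *)

Section ComplexBasics.
Variable R : realType.
Local Notation C := (Cplx R).
Implicit Types (z w : C) (x y : R).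

Lemma cplxP z w : cre z = cre w -> cim z = cim w -> z = w.
Proof. by case: z w => [a b] [c d]; rewrite /cre /cim /= => -> ->. Qed.

Lemma creD z w : cre (z + w) = cre z + cre w. Proof. by case: z w => [a b] [c d]. Qed.
Lemma cimD z w : cim (z + w) = cim z + cim w. Proof. by case: z w => [a b] [c d]. Qed.
Lemma creN z : cre (- z) = - cre z. Proof. by case: z. Qed.
Lemma cimN z : cim (- z) = - cim z. Proof. by case: z. Qed.
Lemma creB z w : cre (z - w) = cre z - cre w. Proof. by rewrite creD creN. Qed.
Lemma cimB z w : cim (z - w) = cim z - cim w. Proof. by rewrite cimD cimN. Qed.
Lemma creM z w : cre (z * w) = cre z * cre w - cim z * cim w.
Proof. by case: z w => [a b] [c d]. Qed.
Lemma cimM z w : cim (z * w) = cre z * cim w + cim z * cre w.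
Proof. by case: z w => [a b] [c d]. Qed.
Lemma cre0 : cre (0 : C) = 0. Proof. by []. Qed.
Lemma cim0 : cim (0 : C) = 0. Proof. by []. Qed.
Lemma cre1 : cre (1 : C) = 1. Proof. by []. Qed.
Lemma cim1 : cim (1 : C) = 0. Proof. by []. Qed.
Lemma cre_ofR x : cre (cofR x) = x. Proof. by []. Qed.
Lemma cim_ofR x : cim (cofR x : C) = 0. Proof. by []. Qed.
Lemma creV z : cre z^-1 = cre z / (cre z ^+ 2 + cim z ^+ 2).
Proof. by case: z. Qed.
Lemma cimV z : cim z^-1 = - (cim z / (cre z ^+ 2 + cim z ^+ 2)).
Proof. by case: z. Qed.
Lemma creZ x z : cre (cofR x * z) = x * cre z.
Proof. by rewrite creM cre_ofR cim_ofR mul0r subr0. Qed.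
Lemma cimZ x z : cim (cofR x * z) = x * cim z.
Proof. by rewrite cimM cre_ofR cim_ofR mul0r addr0. Qed.

Definition cE := (creD, cimD, creN, cimN, creM, cimM, cre0, cim0, cre1, cim1, cre_ofR, cim_ofR).

Lemma cofRD x y : cofR (x + y) = cofR x + cofR y :> C.
Proof. by apply: cplxP; rewrite !cE ?addr0. Qed.
Lemma cofRN x : cofR (- x) = - cofR x :> C.
Proof. by apply: cplxP; rewrite !cE ?oppr0. Qed.
Lemma cofRB x y : cofR (x - y) = cofR x - cofR y :> C.
Proof. by rewrite cofRD cofRN. Qed.
Lemma cofRM x y : cofR (x * y) = cofR x * cofR y :> C.
Proof. by apply: cplxP; rewrite !cE; ring. Qed.
Lemma cofR0 : cofR 0 = 0 :> C. Proof. by []. Qed.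
Lemma cofR1 : cofR 1 = 1 :> C. Proof. by []. Qed.
Lemma cofRX x n : cofR (x ^+ n) = cofR x ^+ n :> C.
Proof. by elim: n => [|n IH]; rewrite ?expr0 // !exprS cofRM IH. Qed.
Lemma cofR_nat n : cofR n%:R = n%:R :> C.
Proof. by elim: n => [//|n IH]; rewrite -!natr1 cofRD IH. Qed.
Lemma cofRV x : cofR x^-1 = (cofR x)^-1 :> C.
Proof.
apply: cplxP; rewrite ?creV ?cimV !cE ?mul0r ?oppr0 //.
have [->|x0] := eqVneq x 0; first by rewrite invr0 mul0r.
by field.
Qed.
Lemma cofR_eq0 x : (cofR x == 0 :> C) = (x == 0).
Proof. by apply/eqP/eqP => [/(congr1 (@cre R))|->]. Qed.
Lemma cofR_inj : injective (@cofR R).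
Proof. by move=> x y /(congr1 (@cre R)). Qed.

Definition csq z : R := cre z ^+ 2 + cim z ^+ 2.

Lemma csq_ge0 z : 0 <= csq z.
Proof. by rewrite addr_ge0 ?sqr_ge0. Qed.

Lemma csq_eq0 z : (csq z == 0) = (z == 0).
Proof.
rewrite /csq paddr_eq0 ?sqr_ge0 // !sqrf_eq0; apply/andP/eqP => [[/eqP a /eqP b]|->].
  exact: cplxP.
by rewrite cre0 cim0 eqxx.
Qed.

Lemma csq_gt0 z : (0 < csq z) = (z != 0).
Proof. by rewrite lt_def csq_eq0 csq_ge0 andbT. Qed.

Lemma cmodE z : cmod z = Num.sqrt (csq z). Proof. by []. Qed.
Lemma cmod_ge0 z : 0 <= cmod z. Proof. exact: sqrtr_ge0. Qed.
Lemma cmod_sqr z : cmod z ^+ 2 = csq z. Proof. by rewrite sqr_sqrtr ?csq_ge0. Qed.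
Lemma cmod_eq0 z : (cmod z == 0) = (z == 0).
Proof. by rewrite -(@sqrf_eq0 _ (cmod z)) cmod_sqr csq_eq0. Qed.
Lemma cmod_gt0 z : (0 < cmod z) = (z != 0).
Proof. by rewrite lt_def cmod_eq0 cmod_ge0 andbT. Qed.
Lemma cmod0 : cmod (0 : C) = 0. Proof. by apply/eqP; rewrite cmod_eq0. Qed.

Lemma normE z : `|z| = cofR (cmod z).
Proof. by rewrite (normc_def (z : R[i])). Qed.

Lemma cofR_le x y : (cofR x <= cofR y :> C) = (x <= y).
Proof. exact: lecR. Qed.

Lemma cofR_lt x y : (cofR x < cofR y :> C) = (x < y).
Proof. exact: ltcR. Qed.

Lemma cmodM z w : cmod (z * w) = cmod z * cmod w.
Proof. by apply: cofR_inj; rewrite cofRM -!normE normrM. Qed.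
Lemma cmodD z w : cmod (z + w) <= cmod z + cmod w.
Proof. by rewrite -cofR_le cofRD -!normE ler_normD. Qed.
Lemma cmodN z : cmod (- z) = cmod z.
Proof. by apply: cofR_inj; rewrite -!normE normrN. Qed.
Lemma cmodB z w : cmod (z - w) <= cmod z + cmod w.
Proof. by rewrite (le_trans (cmodD _ _)) // cmodN. Qed.
Lemma cmodV z : cmod z^-1 = (cmod z)^-1.
Proof. by apply: cofR_inj; rewrite cofRV -!normE normfV. Qed.
Lemma cmod1 : cmod (1 : C) = 1.
Proof. by apply: cofR_inj; rewrite -normE normr1. Qed.
Lemma cmodX z n : cmod (z ^+ n) = cmod z ^+ n.
Proof. by elim: n => [|n IH]; rewrite ?expr0 ?cmod1 // !exprS cmodM IH. Qed.
Lemma cmod_ofR x : cmod (cofR x : C) = `|x|.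
Proof. by rewrite cmodE /csq cre_ofR cim_ofR expr0n addr0 sqrtr_sqr. Qed.
Lemma cmod_nat n : cmod (n%:R : C) = n%:R.
Proof. by rewrite -cofR_nat cmod_ofR normr_nat. Qed.

Lemma cre_le_cmod z : `|cre z| <= cmod z.
Proof.
rewrite -ler_sqr ?nnegrE ?cmod_ge0 // cmod_sqr real_normK ?num_real //.
by rewrite lerDl sqr_ge0.
Qed.
Lemma cim_le_cmod z : `|cim z| <= cmod z.
Proof.
rewrite -ler_sqr ?nnegrE ?cmod_ge0 // cmod_sqr real_normK ?num_real //.
by rewrite lerDr sqr_ge0.
Qed.
Lemma cmod_le_reim z : cmod z <= `|cre z| + `|cim z|.
Proof.
rewrite -ler_sqr ?nnegrE ?cmod_ge0 ?addr_ge0 // cmod_sqr sqrrD !real_normK ?num_real //.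
by rewrite /csq -addrA lerD2l lerDr mulrn_wge0 // mulr_ge0.
Qed.
Lemma cre_lower_neq0 z : 0 < cre z -> z != 0.
Proof. by move=> h; apply: contraTneq h => ->; rewrite cre0 ltxx. Qed.
Lemma cim_neq0 z : cim z != 0 -> z != 0.
Proof. by apply: contraNneq => ->; rewrite cim0. Qed.

(* twice this is the derivative of [csq] along [z' = w] *)
Definition cdot z w : R := cre z * cre w + cim z * cim w.
Lemma cdot_le z w : `|cdot z w| <= cmod z * cmod w.
Proof.
rewrite -ler_sqr ?nnegrE ?mulr_ge0 ?cmod_ge0 // exprMn !cmod_sqr real_normK ?num_real //.
rewrite -subr_ge0 (_ : _ - _ = (cre z * cim w - cim z * cre w) ^+ 2) ?sqr_ge0 //.
by rewrite /csq /cdot; ring.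
Qed.
Lemma cdotD z w w' : cdot z (w + w') = cdot z w + cdot z w'.
Proof. by rewrite /cdot !cE; ring. Qed.
Lemma cdotMl z w : cdot z (w * z) = cre w * csq z.
Proof. by rewrite /cdot /csq !cE; ring. Qed.

End ComplexBasics.

Section RealDerivatives.
Variable R : realType.
Implicit Types (f g : R -> R) (t a b c : R).

Lemma isd_eq f t a b : is_derive t 1 f a -> a = b -> is_derive t 1 f b.
Proof. by move=> h <-. Qed.
Lemma isd_cst c t : is_derive t 1 (fun _ : R => c) 0.
Proof. exact: is_derive_cst. Qed.
Lemma isd_id t : is_derive t 1 (fun x : R => x) 1.
Proof. exact: is_derive_id. Qed.
Lemma isdD f g t a b : is_derive t 1 f a -> is_derive t 1 g b ->
  is_derive t 1 (fun x => f x + g x) (a + b).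
Proof. by move=> hf hg; exact: is_deriveD. Qed.
Lemma isdN f t a : is_derive t 1 f a -> is_derive t 1 (fun x => - f x) (- a).
Proof. by move=> hf; exact: is_deriveN. Qed.
Lemma isdB f g t a b : is_derive t 1 f a -> is_derive t 1 g b ->
  is_derive t 1 (fun x => f x - g x) (a - b).
Proof. by move=> hf hg; apply: isdD => //; apply: isdN. Qed.
Lemma isdM f g t a b : is_derive t 1 f a -> is_derive t 1 g b ->
  is_derive t 1 (fun x => f x * g x) (a * g t + f t * b).
Proof.
move=> hf hg; have h := is_deriveM hf hg.
suff <- : f t *: b + g t *: a = a * g t + f t * b by exact: h.
by rewrite /GRing.scale /= addrC mulrC.
Qed.
Lemma isdZ c f t a : is_derive t 1 f a -> is_derive t 1 (fun x => c * f x) (c * a).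
Proof.
move=> hf; apply: (isd_eq (isdM (isd_cst c t) hf)).
by rewrite mul0r add0r.
Qed.
Lemma isdV f t a : f t != 0 -> is_derive t 1 f a ->
  is_derive t 1 (fun x => (f x)^-1) (- a / f t ^+ 2).
Proof.
move=> f0 hf; apply: (isd_eq (is_deriveV f0 hf)).
by rewrite /GRing.scale /= mulrC mulrN mulNr.
Qed.
Lemma isdX f t a n : is_derive t 1 f a ->
  is_derive t 1 (fun x => f x ^+ n) (n%:R * f t ^+ n.-1 * a).
Proof.
move=> hf; have h := is_deriveX n hf.
suff e : (fun x => f x ^+ n) = (f ^+ n) :> (R -> R) by rewrite e; apply: (isd_eq h).
by apply/funext => x; rewrite fctE.
Qed.
Lemma isd_comp (f g : R -> R) t a b : is_derive (g t) 1 f a -> is_derive t 1 g b ->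
  is_derive t 1 (fun x => f (g x)) (a * b).
Proof. by move=> hf hg; exact: is_derive1_comp. Qed.
Lemma isd_exp g t b : is_derive t 1 g b ->
  is_derive t 1 (fun x => expR (g x)) (expR (g t) * b).
Proof. by move=> hg; apply: isd_comp => //; exact: is_derive_expR. Qed.
Lemma isd_ln g t b : 0 < g t -> is_derive t 1 g b ->
  is_derive t 1 (fun x => ln (g x)) (b / g t).
Proof.
by move=> g0 hg; apply: (isd_eq (isd_comp (is_derive1_ln g0) hg)); rewrite mulrC.
Qed.
Lemma isd_sqrt g t b : 0 < g t -> is_derive t 1 g b ->
  is_derive t 1 (fun x => Num.sqrt (g x)) (b / (2 * Num.sqrt (g t))).
Proof.
by move=> g0 hg; apply: (isd_eq (isd_comp (is_derive1_sqrt g0) hg)); rewrite mulrC.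
Qed.

Lemma isd_continuous f t a : is_derive t 1 f a -> {for t, continuous f}.
Proof.
by move=> h; apply: differentiable_continuous; apply/derivable1_diffP; exact: ex_derive.
Qed.

Lemma nonincr_of_derive f (df : R -> R) a b : a <= b ->
  (forall t, a <= t <= b -> {for t, continuous f}) ->
  (forall t, a < t < b -> is_derive t 1 f (df t)) ->
  (forall t, a < t < b -> df t <= 0) -> f b <= f a.
Proof.
rewrite le_eqVlt => /orP[/eqP-> //|ab] cf hd hle.
apply: (@ler0_derive1_le_cc R f a b) => //.
- by move=> x; rewrite in_itv /= => /hd h; exact: ex_derive.
- move=> x; rewrite in_itv /= => xab; rewrite derive1E.
  by rewrite (@derive_val _ _ _ _ _ _ _ (hd _ xab)) hle.
- by apply: continuous_in_subspaceT => x; rewrite inE /= in_itv /= => /cf.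
- by rewrite in_itv /= lexx ltW.
- by rewrite in_itv /= lexx ltW.
- exact: ltW.
Qed.

Lemma nondecr_of_derive f (df : R -> R) a b : a <= b ->
  (forall t, a <= t <= b -> {for t, continuous f}) ->
  (forall t, a < t < b -> is_derive t 1 f (df t)) ->
  (forall t, a < t < b -> 0 <= df t) -> f a <= f b.
Proof.
move=> ab cf hd hle; rewrite -lerN2.
apply: (@nonincr_of_derive (fun x => - f x) (fun x => - df x)) => //.
- by move=> t tab; apply: continuousN; exact: cf.
- by move=> t tab; apply: isdN; exact: hd.
- by move=> t tab; rewrite oppr_le0 hle.
Qed.

End RealDerivatives.

Section PathDerivatives.
Variable R : realType.
Local Notation C := (Cplx R).
Implicit Types (F G : R -> C) (t : R) (z w d e : C).

Definition cder F t d : Prop :=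
  is_derive t 1 (fun x => cre (F x)) (cre d) /\
  is_derive t 1 (fun x => cim (F x)) (cim d).

Lemma cder_eq F t d e : cder F t d -> d = e -> cder F t e.
Proof. by move=> h <-. Qed.

Lemma cder_ext F G t d : F =1 G -> cder F t d -> cder G t d.
Proof. by move=> /funext ->. Qed.

Lemma cder_cst z t : cder (fun _ => z) t 0.
Proof. by split; exact: isd_cst. Qed.

Lemma cder_ofR (f : R -> R) t a : is_derive t 1 f a -> cder (fun x => cofR (f x)) t (cofR a).
Proof. by move=> h; split => //=; exact: isd_cst. Qed.

Lemma cderD F G t d e : cder F t d -> cder G t e -> cder (fun x => F x + G x) t (d + e).
Proof.
move=> [h1 h2] [k1 k2]; split; rewrite cE.
  by under eq_fun do rewrite creD; exact: isdD.
by under eq_fun do rewrite cimD; exact: isdD.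
Qed.

Lemma cderN F t d : cder F t d -> cder (fun x => - F x) t (- d).
Proof.
move=> [h1 h2]; split; rewrite cE.
  by under eq_fun do rewrite creN; exact: isdN.
by under eq_fun do rewrite cimN; exact: isdN.
Qed.

Lemma cderB F G t d e : cder F t d -> cder G t e -> cder (fun x => F x - G x) t (d - e).
Proof. by move=> h k; apply: cderD => //; exact: cderN. Qed.

Lemma cderM F G t d e : cder F t d -> cder G t e ->
  cder (fun x => F x * G x) t (d * G t + F t * e).
Proof.
move=> [h1 h2] [k1 k2]; split.
  under eq_fun do rewrite creM.
  by apply: (isd_eq (isdB (isdM h1 k1) (isdM h2 k2))); rewrite !cE; ring.
under eq_fun do rewrite cimM.
by apply: (isd_eq (isdD (isdM h1 k2) (isdM h2 k1))); rewrite !cE; ring.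
Qed.

Lemma cderZ z F t d : cder F t d -> cder (fun x => z * F x) t (z * d).
Proof. by move=> h; apply: (cder_eq (cderM (cder_cst z t) h)); ring. Qed.

Lemma cderX F t d n : cder F t d -> cder (fun x => F x ^+ n) t (n%:R * F t ^+ n.-1 * d).
Proof.
move=> h; elim: n => [|n IH].
  by apply: (cder_eq (cder_cst 1 t)); rewrite !mul0r.
apply: cder_ext (cder_eq (cderM h IH) _); first by move=> x /=; rewrite exprS.
case: n {IH} => [|n] /=; first by rewrite expr0; ring.
by rewrite -(natr1 n.+1) (exprS _ n); ring.
Qed.

Lemma cder_csq F t d : cder F t d ->
  is_derive t 1 (fun x => csq (F x)) (2 * cdot (F t) d).
Proof.
move=> [h1 h2]; rewrite /csq.
by apply: (isd_eq (isdD (isdX 2 h1) (isdX 2 h2))); rewrite /cdot /=; ring.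
Qed.

Lemma cderV F t d : F t != 0 -> cder F t d -> cder (fun x => (F x)^-1) t (- d / F t ^+ 2).
Proof.
move=> F0 h; have [h1 h2] := h; have h3 := cder_csq h.
have c0 : csq (F t) != 0 by rewrite csq_eq0.
have c0' : cre (F t) ^+ 2 + cim (F t) ^+ 2 != 0 by [].
have c0'' : (cre (F t) * cre (F t) - cim (F t) * cim (F t)) ^+ 2 +
            (cre (F t) * cim (F t) + cim (F t) * cre (F t)) ^+ 2 != 0.
  rewrite (_ : _ + _ = csq (F t) ^+ 2) ?sqrf_eq0 //; rewrite /csq; ring.
have hV := isdV (f := fun x => csq (F x)) c0 h3.
split.
  under eq_fun do rewrite creV -/(csq _).
  apply: (isd_eq (isdM h1 hV)).
  by rewrite expr2 !cE creV cimV !cE /cdot /csq; field; rewrite c0' c0''.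
under eq_fun do rewrite cimV -/(csq _).
apply: (isd_eq (isdN (isdM h2 hV))).
by rewrite expr2 !cE creV cimV !cE /cdot /csq; field; rewrite c0' c0''.
Qed.

(** * Exponential, logarithm and powers *)

Lemma cre_cexp z : cre (cexp z) = expR (cre z) * cos (cim z). Proof. by []. Qed.
Lemma cim_cexp z : cim (cexp z) = expR (cre z) * sin (cim z). Proof. by []. Qed.

Lemma cexpD z w : cexp (z + w) = cexp z * cexp w.
Proof.
by apply: cplxP; rewrite !cE ?cre_cexp ?cim_cexp !cE expRD ?cosD ?sinD; ring.
Qed.

Lemma cexp0 : cexp (0 : C) = 1.
Proof. by apply: cplxP; rewrite ?cre_cexp ?cim_cexp !cE expR0 ?cos0 ?sin0; ring. Qed.

Lemma cexp_ofR (x : R) : cexp (cofR x) = cofR (expR x).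
Proof. by apply: cplxP; rewrite ?cre_cexp ?cim_cexp !cE ?cos0 ?sin0; ring. Qed.

Lemma csq_cexp z : csq (cexp z) = expR (cre z) ^+ 2.
Proof.
rewrite /csq cre_cexp cim_cexp !exprMn -mulrDr cos2Dsin2; ring.
Qed.

Lemma cmod_cexp z : cmod (cexp z) = expR (cre z).
Proof. by rewrite cmodE csq_cexp sqrtr_sqr ger0_norm ?expR_ge0. Qed.

Lemma cexp_neq0 z : cexp z != 0.
Proof. by rewrite -cmod_gt0 cmod_cexp expR_gt0. Qed.

Lemma cexpN z : cexp (- z) = (cexp z)^-1.
Proof.
by apply: (mulIf (cexp_neq0 z)); rewrite -cexpD addNr cexp0 mulVf ?cexp_neq0.
Qed.

Lemma cder_cexp F t d : cder F t d -> cder (fun x => cexp (F x)) t (cexp (F t) * d).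
Proof.
move=> [h1 h2]; split.
  under eq_fun do rewrite cre_cexp.
  have hc := isd_comp (is_derive_cos (cim (F t))) h2.
  by apply: (isd_eq (isdM (isd_exp h1) hc)); rewrite cE cre_cexp cim_cexp; ring.
under eq_fun do rewrite cim_cexp.
have hc := isd_comp (is_derive_sin (cim (F t))) h2.
by apply: (isd_eq (isdM (isd_exp h1) hc)); rewrite cE cre_cexp cim_cexp; ring.
Qed.

Lemma cre_clog z : cre (clog z) = ln (cmod z). Proof. by []. Qed.
Lemma cim_clog z : cim (clog z) = carg z. Proof. by []. Qed.

Lemma cexp_clog z : z != 0 -> cexp (clog z) = z.
Proof.
move=> z0; have r0 : 0 < cmod z by rewrite cmod_gt0.
have u1 : -1 <= cre z / cmod z <= 1.
  by rewrite -ler_norml normrM normfV (ger0_norm (ltW r0)) ler_pdivrMr // mul1r cre_le_cmod.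
have sE : Num.sqrt (1 - (cre z / cmod z) ^+ 2) = `|cim z| / cmod z.
  have -> : `|cim z| / cmod z = `|cim z / cmod z|.
    by rewrite normrM normfV (ger0_norm (ltW r0)).
  rewrite -sqrtr_sqr; congr (Num.sqrt _).
  rewrite !exprMn !exprVn cmod_sqr.
  have : csq z != 0 by rewrite csq_eq0.
  rewrite /csq => h; by field.
apply: cplxP; rewrite ?cre_cexp ?cim_cexp cre_clog cim_clog lnK ?posrE //.
  rewrite /carg (negbTE z0); case: ifP => _; rewrite ?cosN acosK ?in_itv //=.
    by field; rewrite gt_eqF.
  by field; rewrite gt_eqF.
rewrite /carg (negbTE z0); case: ifPn => h; rewrite ?sinN sin_acos // sE.
  by rewrite ger0_norm //; field; rewrite gt_eqF.
by rewrite ltr0_norm ?ltNge //; field; rewrite gt_eqF.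
Qed.

Definition slit z := 0 < cre z \/ cim z != 0.

Lemma slit_neq0 z : slit z -> z != 0.
Proof. by case=> [/cre_lower_neq0|/cim_neq0]. Qed.

Lemma slit_gt0 z : slit z -> 0 < cre z + cmod z.
Proof.
case=> h; first by rewrite ltr_pwDl ?cmod_ge0.
rewrite -ltrBlDl sub0r (le_lt_trans (ler_norm _)) // normrN.
rewrite -ltr_sqr ?nnegrE ?cmod_ge0 // cmod_sqr real_normK ?num_real // /csq.
by rewrite ltrDl exprn_even_gt0.
Qed.

(* the half-angle formula, smooth across the positive real axis *)
Lemma cargE z : 0 < cre z + cmod z -> carg z = 2 * atan (cim z / (cre z + cmod z)).
Proof.
move=> h0.
have z0 : z != 0 by apply: contraTneq h0 => ->; rewrite cre0 cmod0 addr0 ltxx.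
have r0 : 0 < cmod z by rewrite cmod_gt0.
set u := _ / _.
have cE2 : cos (2 * atan u) = cre z / cmod z.
  have -> : 2 * atan u = atan u *+ 2 by rewrite mulr_natl.
  rewrite cos_mulr2n cos_atan exprVn sqr_sqrtr ?addr_ge0 ?sqr_ge0 //.
  have : csq z = cmod z ^+ 2 by rewrite cmod_sqr.
  rewrite /csq => hc.
  have e1 : cim z ^+ 2 = cmod z ^+ 2 - cre z ^+ 2 by rewrite -hc; ring.
  have -> : 1 + u ^+ 2 = 2 * cmod z / (cre z + cmod z).
    by rewrite /u exprMn exprVn e1; field; rewrite gt_eqF.
  by field; rewrite !gt_eqF.
rewrite /carg (negbTE z0) -cE2; case: ifPn => hy.
  have u0 : 0 <= u by rewrite mulr_ge0 // invr_ge0 ltW.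
  apply: cosK; rewrite in_itv /= mulr_ge0 //=; last by rewrite -[X in X <= _]atan0 le_atan.
  by rewrite mulrC -ler_pdivlMr // ltW ?atan_ltpi2.
have u0 : u <= 0 by rewrite pmulr_lle0 ?invr_gt0 // ltW // ltNge.
rewrite cosKN ?opprK //; apply/andP; split.
  by rewrite mulrC lerNl -mulNr -ler_pdivlMr // lerNl ltW ?atan_gtNpi2.
by rewrite pmulr_rle0 // -[X in _ <= X]atan0 le_atan.
Qed.

Lemma cder_cmod F t d : F t != 0 -> cder F t d ->
  is_derive t 1 (fun x => cmod (F x)) (cdot (F t) d / cmod (F t)).
Proof.
move=> F0 h; have c0 : 0 < csq (F t) by rewrite csq_gt0.
apply: (isd_eq (isd_sqrt (g := fun x => csq (F x)) c0 (cder_csq h))); rewrite -cmodE; field.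
by rewrite cmod_eq0.
Qed.

Lemma cder_clog F t d : slit (F t) -> cder F t d -> cder (fun x => clog (F x)) t (d / F t).
Proof.
move=> hs h; have F0 := slit_neq0 hs; have p0 := slit_gt0 hs.
have hm := cder_cmod F0 h; have [h1 h2] := h.
have r0 : 0 < cmod (F t) by rewrite cmod_gt0.
have q0 : cre (F t) ^+ 2 + cim (F t) ^+ 2 != 0 by rewrite (csq_eq0 (F t)).
have hc : cim (F t) ^+ 2 = cmod (F t) ^+ 2 - cre (F t) ^+ 2 by rewrite cmod_sqr /csq; ring.
split.
  apply: (isd_eq (isd_ln (g := fun x => cmod (F x)) r0 hm)); rewrite cE creV cimV /cdot.
  have -> : cre (F t) ^+ 2 + cim (F t) ^+ 2 = cmod (F t) ^+ 2 by rewrite cmod_sqr.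
  by field; rewrite gt_eqF.
have hp := isdD h1 hm.
have hV := isdV (f := fun x => cre (F x) + cmod (F x)) (lt0r_neq0 p0) hp.
have hq := isdM h2 hV.
have ha := isdZ 2 (isd_comp (g := fun x => cim (F x) / (cre (F x) + cmod (F x)))
  (is_derive1_atan _) hq).
apply: (isd_eq (near_eq_is_derive _ ha)).
  near=> x; rewrite cim_clog cargE //; near: x.
  by have /cvgr_gt := isd_continuous hp; exact.
rewrite cimM creV cimV /cdot.
have -> : cre (F t) ^+ 2 + cim (F t) ^+ 2 = cmod (F t) ^+ 2 by rewrite cmod_sqr.
set r := cmod (F t) in r0 p0 hc *; set x := cre (F t) in p0 hc *; set y := cim (F t) in hc *.
have e1 : 1 + (y / (x + r)) ^+ 2 = 2 * r / (x + r).
  by rewrite exprMn exprVn hc; field; rewrite gt_eqF.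
rewrite e1.
set rhs := RHS; set lhs := LHS.
have : lhs = rhs - cim d / (r ^+ 2 * (x + r)) * (y ^+ 2 - (r ^+ 2 - x ^+ 2)).
  by rewrite /lhs /rhs; field; rewrite !gt_eqF.
by rewrite -hc subrr mulr0 subr0.
Unshelve. all: by end_near. Qed.

Lemma cpowE z c : cpow z c = cexp (c * clog z). Proof. by []. Qed.

Lemma cpow_neq0 z c : cpow z c != 0. Proof. exact: cexp_neq0. Qed.

Lemma cpowD z c e : cpow z (c + e) = cpow z c * cpow z e.
Proof. by rewrite !cpowE mulrDl cexpD. Qed.

Lemma cpowN z c : cpow z (- c) = (cpow z c)^-1.
Proof. by rewrite !cpowE mulNr cexpN. Qed.

Lemma cpow1 z : z != 0 -> cpow z 1 = z.
Proof. by move=> z0; rewrite cpowE mul1r cexp_clog. Qed.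

Lemma cder_cpow F t d c : slit (F t) -> cder F t d ->
  cder (fun x => cpow (F x) c) t (c * d / F t * cpow (F t) c).
Proof.
move=> hs h; apply: (cder_eq (cder_cexp (cderZ c (cder_clog hs h)))).
by rewrite cpowE; ring.
Qed.

End PathDerivatives.

(** * A damped linear system *)

Section DampedSystems.
Variable R : realType.
Local Notation C := (Cplx R).

Lemma young_delta (d A x y : R) : 0 < d -> A * x * y <= d * x ^+ 2 + A ^+ 2 / (4 * d) * y ^+ 2.
Proof.
move=> d0; have : 0 <= d * (x - A / (2 * d) * y) ^+ 2 by rewrite mulr_ge0 ?sqr_ge0 // ltW.
have -> : d * (x - A / (2 * d) * y) ^+ 2 = d * x ^+ 2 + A ^+ 2 / (4 * d) * y ^+ 2 - A * x * y.
  by field; rewrite gt_eqF.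
by rewrite subr_ge0.
Qed.

Lemma gronwall (E dE : R -> R) (k rho t0 t1 : R) : t0 <= t1 ->
  (forall t, t0 <= t <= t1 -> {for t, continuous E}) ->
  (forall t, t0 < t < t1 -> is_derive t 1 E (dE t)) ->
  (forall t, t0 < t < t1 -> dE t <= k * (E t + rho)) ->
  E t1 + rho <= (E t0 + rho) * expR (k * (t1 - t0)).
Proof.
move=> t01 cE dEt hE.
have := @nonincr_of_derive R (fun t => (E t + rho) * expR (- k * t))
  (fun t => (dE t - k * (E t + rho)) * expR (- k * t)) t0 t1 t01.
have hl (t : R) : is_derive t 1 (fun t => - k * t) (- k).
  by apply: (isd_eq (isdZ (- k) (isd_id t))); rewrite mulr1.
move=> H; have {H} : (E t1 + rho) * expR (- k * t1) <= (E t0 + rho) * expR (- k * t0).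
  apply: H.
  - move=> t tt; apply: continuousM; first by apply: continuousD; [exact: cE|exact: cst_continuous].
    exact: isd_continuous (isd_exp (hl t)).
  - move=> t tt.
    apply: (isd_eq (isdM (isdD (dEt t tt) (isd_cst rho t)) (isd_exp (hl t)))).
    by ring.
  - by move=> t tt; rewrite pmulr_lle0 ?expR_gt0 // subr_le0 hE.
rewrite -ler_pdivlMr ?expR_gt0 // -expRN -mulrA -expRD.
by congr (_ <= _ * expR _); ring.
Qed.

(* The energy [|g|^2 + k |h|^2 / b], with a suitable constant [k], absorbs the coupling terms into
   the damping of [h] and grows at a rate independent of [b]. *)
Lemma damped_system (c d L : R) : 0 < c -> 0 < d -> 0 <= L ->
  exists2 K : R, 0 < K & forall (b r s t0 t1 : R) (g h p q zeta : R -> C),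
  1 <= b -> 0 <= r -> 0 <= s -> t0 <= t1 <= t0 + L ->
  (forall t, t0 <= t <= t1 -> {for t, continuous (fun x => csq (g x))}) ->
  (forall t, t0 <= t <= t1 -> {for t, continuous (fun x => csq (h x))}) ->
  (forall t, t0 < t < t1 -> cder g t (p t)) ->
  (forall t, t0 < t < t1 -> cder h t (- zeta t * h t + q t)) ->
  (forall t, t0 < t < t1 -> b * d <= cre (zeta t)) ->
  (forall t, t0 < t < t1 -> cmod (p t) <= c * (cmod (g t) + cmod (h t) + r)) ->
  (forall t, t0 < t < t1 -> cmod (q t) <= c * (cmod (g t) + s)) ->
  csq (g t1) <= K * (csq (g t0) + csq (h t0) / b + r ^+ 2 + (s / b) ^+ 2) /\
  csq (h t1) <= csq (h t0) + K / b ^+ 2 * (csq (g t0) + csq (h t0) / b + r ^+ 2 + s ^+ 2).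
Proof.
move=> c0 d0 L0.
pose k0 := 3 * c + 5 * (c ^+ 2 / d).
pose K1 := expR (k0 * L).
have k00 : 0 < k0.
  by rewrite addr_gt0 // mulr_gt0 // divr_gt0 // exprn_gt0.
have K11 : 1 <= K1 by rewrite -expR0 ler_expR mulr_ge0 // ltW.
have K10 : 0 < K1 by rewrite expR_gt0.
pose K := K1 + 2 * c ^+ 2 / d ^+ 2 * (K1 + 1).
have c2 : 0 < 2 * c ^+ 2 / d ^+ 2 by rewrite divr_gt0 ?mulr_gt0 ?exprn_gt0.
have KK1 : K1 <= K by rewrite lerDl mulr_ge0 ?ltW // addr_gt0.
exists K; first exact: (lt_le_trans K10).
move=> b r s t0 t1 g h p q zeta b1 r0 s0 /andP[t01 t1L] cg ch dg dh hz hp hq.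
have b0 : 0 < b by exact: lt_le_trans b1.
have bV1 : b^-1 <= 1 by rewrite invf_le1.
have bV0 : 0 < b^-1 by rewrite invr_gt0.
pose rho := r ^+ 2 + (s / b) ^+ 2.
have rho0 : 0 <= rho by rewrite addr_ge0 ?sqr_ge0.
pose E t := csq (g t) + csq (h t) / b.
have E0 t : 0 <= E t by rewrite addr_ge0 ?csq_ge0 // mulr_ge0 ?csq_ge0 ?ltW.
have key u : t0 <= u <= t1 -> E u + rho <= (E t0 + rho) * K1.
  move=> /andP[u0 u1].
  have sub t : t0 < t < u -> t0 < t < t1.
    by move=> /andP[-> /lt_le_trans ->].
  have subc t : t0 <= t <= u -> t0 <= t <= t1.
    by move=> /andP[-> /le_trans ->].
  have := @gronwall E (fun t => 2 * cdot (g t) (p t) +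
     (2 * cdot (h t) (- zeta t * h t + q t)) / b) k0 rho t0 u u0.
  move=> H; apply: le_trans (H _ _ _) _.
  - move=> t /subc tt; apply: continuousD; first exact: cg.
    by apply: continuousM; [exact: ch|exact: cst_continuous].
  - move=> t /sub tt; apply: isdD; first exact: cder_csq (dg t tt).
    apply: (isd_eq (isdM (cder_csq (dh t tt)) (isd_cst b^-1 t))); ring.
  - move=> t /sub tt.
    have := hz t tt; have := hp t tt; have := hq t tt.
    set G := cmod (g t); set H' := cmod (h t) => hq' hp' hz'.
    have G0 : 0 <= G by exact: cmod_ge0.
    have H0 : 0 <= H' by exact: cmod_ge0.
    have e1 : cdot (g t) (p t) <= G * (c * (G + H' + r)).
      apply: le_trans (ler_norm _) _; apply: le_trans (cdot_le _ _) _.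
      by rewrite ler_wpM2l.
    have e2 : cdot (h t) (- zeta t * h t + q t) <= - (b * d) * H' ^+ 2 + H' * (c * (G + s)).
      rewrite cdotD cdotMl creN lerD //.
        by rewrite /H' cmod_sqr ler_wpM2r ?csq_ge0 // lerN2.
      apply: le_trans (ler_norm _) _; apply: le_trans (cdot_le _ _) _.
      by rewrite ler_wpM2l.
    have e2' : 2 * cdot (h t) (- zeta t * h t + q t) / b <=
       - (2 * d * H' ^+ 2) + 2 * c * H' * G + 2 * c * H' * (s / b).
      apply: (@le_trans _ _ (2 * (- (b * d) * H' ^+ 2 + H' * (c * (G + s))) / b)).
        by rewrite ler_wpM2r ?(ltW bV0) // ler_wpM2l.
      have -> : 2 * (- (b * d) * H' ^+ 2 + H' * (c * (G + s))) / b =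
         - (2 * d * H' ^+ 2) + 2 * c * H' * G * b^-1 + 2 * c * H' * (s / b).
        by field; rewrite gt_eqF.
      by rewrite lerD2r lerD2l ler_piMr // !mulr_ge0 // ltW.
    have d2 : 0 < d / 2 by rewrite divr_gt0.
    have y1 := @young_delta (d / 2) (2 * c) H' G d2.
    have y2 := @young_delta d (2 * c) H' (s / b) d0.
    have y3 := @young_delta c (2 * c) G r c0.
    have f1 : (2 * c) ^+ 2 / (4 * (d / 2)) = 2 * (c ^+ 2 / d).
      by field; rewrite gt_eqF.
    have f2 : (2 * c) ^+ 2 / (4 * d) = c ^+ 2 / d.
      by field; rewrite gt_eqF.
    have f3 : (2 * c) ^+ 2 / (4 * c) = c.
      by field; rewrite gt_eqF.
    rewrite f1 in y1; rewrite f2 in y2; rewrite f3 in y3.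
    have EG : E t = G ^+ 2 + H' ^+ 2 / b by rewrite /E /G /H' !cmod_sqr.
    rewrite EG /rho.
    apply: le_trans (lerD (_ : _ <= 2 * (G * (c * (G + H' + r)))) e2') _.
      by rewrite ler_wpM2l.
    have m0 : 0 < c ^+ 2 / d by rewrite divr_gt0 ?exprn_gt0.
    have hb : 0 <= H' ^+ 2 / b by rewrite mulr_ge0 ?sqr_ge0 ?ltW.
    have k1 : 0 <= k0 * (H' ^+ 2 / b) by rewrite mulr_ge0 // ltW.
    have k2 : 0 <= (2 * c + 5 * (c ^+ 2 / d)) * r ^+ 2.
      by rewrite mulr_ge0 ?sqr_ge0 // addr_ge0 // mulr_ge0 // ltW.
    have k3 : 0 <= (3 * c + 4 * (c ^+ 2 / d)) * (s / b) ^+ 2.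
      by rewrite mulr_ge0 ?sqr_ge0 // addr_ge0 // mulr_ge0 // ltW.
    have k4 : 0 <= (c ^+ 2 / d) * G ^+ 2 by rewrite mulr_ge0 ?sqr_ge0 // ltW.
    rewrite /k0; move: k1 k2 k3 k4; rewrite /k0.
    lra.
  apply: ler_wpM2l; first by rewrite addr_ge0.
  rewrite ler_expR ler_wpM2l ?(ltW k00) //.
  by rewrite lerBlDl (le_trans u1).
have S0 : 0 <= csq (g t0) + csq (h t0) / b by exact: E0.
split.
  have := key t1; rewrite lexx t01 => /(_ isT) hk.
  apply: (@le_trans _ _ (E t1 + rho)).
    by rewrite /E -addrA lerDl addr_ge0 // mulr_ge0 ?csq_ge0 ?ltW.
  apply: le_trans hk _; rewrite mulrC /E /rho addrA.
  by rewrite ler_wpM2r // !addr_ge0 ?sqr_ge0 // ?csq_ge0 // mulr_ge0 ?csq_ge0 // ltW.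
pose X := c ^+ 2 / (d ^+ 2 * b ^+ 2) * (2 * ((E t0 + rho) * K1 + s ^+ 2)).
have X0 : 0 <= X.
  apply: mulr_ge0; first by apply: divr_ge0; [exact: sqr_ge0|apply: mulr_ge0; exact: sqr_ge0].
  by rewrite mulr_ge0 // addr_ge0 ?sqr_ge0 // mulr_ge0 ?(ltW K10) // addr_ge0.
have := @gronwall (fun t => csq (h t)) (fun t => 2 * cdot (h t) (- zeta t * h t + q t))
  (- (b * d)) (- X) t0 t1 t01 ch.
move=> H; have {H} hX := H _ _.
apply: (@le_trans _ _ (csq (h t0) + X)).
  rewrite -lerBlDr; apply: le_trans (hX _ _) _.
  - by move=> t tt; exact: cder_csq (dh t tt).
  - move=> t tt; have hq' := hq t tt; have hz' := hz t tt.
    set H' := cmod (h t).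
    have H0 : 0 <= H' by exact: cmod_ge0.
    have e2 : cdot (h t) (- zeta t * h t + q t) <= - (b * d) * H' ^+ 2 + H' * (c * (cmod (g t) + s)).
      rewrite cdotD cdotMl creN lerD //.
        by rewrite /H' cmod_sqr ler_wpM2r ?csq_ge0 // lerN2.
      apply: le_trans (ler_norm _) _; apply: le_trans (cdot_le _ _) _.
      by rewrite ler_wpM2l.
    have bd0 : 0 < b * d by rewrite mulr_gt0.
    have y := @young_delta (b * d) (2 * c) H' (cmod (g t) + s) bd0.
    have gs : (cmod (g t) + s) ^+ 2 <= 2 * ((E t0 + rho) * K1 + s ^+ 2).
      have tt' : t0 <= t <= t1 by case/andP: tt => /ltW -> /ltW ->.
      have h1 := key t tt'.
      have h2 : cmod (g t) ^+ 2 <= (E t0 + rho) * K1.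
        rewrite cmod_sqr; apply: le_trans h1.
        by rewrite /E -addrA lerDl addr_ge0 // mulr_ge0 ?csq_ge0 ?ltW.
      have h3 := sqr_ge0 (cmod (g t) - s).
      have -> : (cmod (g t) + s) ^+ 2 = 2 * (cmod (g t) ^+ 2 + s ^+ 2) - (cmod (g t) - s) ^+ 2 by ring.
      rewrite lerBlDr; apply: (@le_trans _ _ (2 * ((E t0 + rho) * K1 + s ^+ 2))).
        by rewrite ler_wpM2l // lerD2r.
      by rewrite lerDl.
    have y' : 2 * c * H' * (cmod (g t) + s) <= b * d * H' ^+ 2 + b * d * X.
      apply: le_trans y _; rewrite lerD2l.
      have -> : b * d * X = (2 * c) ^+ 2 / (4 * (b * d)) * (2 * ((E t0 + rho) * K1 + s ^+ 2)).
        by rewrite /X; field; rewrite !gt_eqF.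
      by rewrite ler_wpM2l // divr_ge0 ?sqr_ge0 // mulr_ge0 ?ltW.
    have -> : csq (h t) = H' ^+ 2 by rewrite cmod_sqr.
    lra.
  have [hh|hh] := leP 0 (csq (h t0) - X).
    apply: (@le_trans _ _ (csq (h t0) - X)); last by rewrite lerBlDr lerDl.
    rewrite ler_piMr // expR_le1 mulr_le0_ge0 ?subr_ge0 // oppr_le0.
    by rewrite mulr_ge0 // ltW.
  apply: (@le_trans _ _ 0); last exact: csq_ge0.
  by rewrite mulr_le0_ge0 ?expR_ge0 // ltW.
rewrite lerD2l.
set T := csq (g t0) + _ + _ + _.
have T0 : 0 <= T by rewrite !addr_ge0 ?sqr_ge0 // ?csq_ge0 // mulr_ge0 ?csq_ge0 ?ltW.
have b2 : 0 < b ^+ 2 by rewrite exprn_gt0.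
have sb : (s / b) ^+ 2 <= s ^+ 2.
  by rewrite ler_sqr ?nnegrE ?mulr_ge0 // ?(ltW bV0) // ler_piMr.
have -> : X = (2 * c ^+ 2 / d ^+ 2) / b ^+ 2 * ((E t0 + rho) * K1 + s ^+ 2).
  by rewrite /X; field; rewrite !gt_eqF.
rewrite [X in _ <= X]mulrAC [X in X <= _]mulrAC ler_wpM2r ?invr_ge0 ?(ltW b2) //.
apply: (@le_trans _ _ (2 * c ^+ 2 / d ^+ 2 * ((K1 + 1) * T))).
  rewrite ler_wpM2l ?(ltW c2) //.
  have hT : E t0 + rho <= T by rewrite /rho addrA /T /E lerD2l.
  have hs : s ^+ 2 <= T.
    by rewrite /T lerDr addr_ge0 ?sqr_ge0.
  by rewrite [X in _ <= X]mulrDl mul1r lerD // mulrC ler_wpM2l // ltW.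
by rewrite mulrA ler_wpM2r // /K lerDr ltW.
Qed.

End DampedSystems.

(** * Entire series and the Kummer equation *)

Section ComplexLimits.
Variable R : realType.
Local Notation C := (Cplx R).

Lemma cvg_cplxP (u : nat -> C) (l : C) :
  u @ \oo --> l <-> (fun n => cmod (u n - l)) @ \oo --> (0 : R).
Proof.
split=> [/cvgrPdist_lt h|/cvgrPdist_lt h].
  apply/cvgrPdist_lt => e e0.
  have e0' : 0 < (cofR e : C) by rewrite -cofR0 cofR_lt.
  have := h _ e0'; apply: filterS => n.
  by rewrite normE cofR_lt sub0r normrN ger0_norm ?cmod_ge0 // -opprB cmodN.
apply/cvgrPdist_lt => e e0.
have er : e = cofR (cre e) by rewrite -[LHS](RRe_real (gtr0_real e0)).
have e0' : 0 < cre e by rewrite -(cofR_lt 0) -er.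
have := h _ e0'; apply: filterS => n.
by rewrite sub0r normrN ger0_norm ?cmod_ge0 // er normE cofR_lt -opprB cmodN.
Qed.

Lemma cvg_cre (u : nat -> C) (l : C) : u @ \oo --> l -> (fun n => cre (u n)) @ \oo --> cre l.
Proof.
move=> /cvg_cplxP /cvgrPdist_lt h; apply/cvgrPdist_lt => e e0.
have := h _ e0; apply: filterS => n; rewrite sub0r normrN ger0_norm ?cmod_ge0 //.
by apply: le_lt_trans; rewrite -normrN opprB -creB cre_le_cmod.
Qed.

Lemma cvg_cmod (u : nat -> C) (l : C) : u @ \oo --> l -> (fun n => cmod (u n)) @ \oo --> cmod l.
Proof.
move=> /cvg_cplxP /cvgrPdist_lt h; apply/cvgrPdist_lt => e e0.
have := h _ e0; apply: filterS => n; rewrite sub0r normrN ger0_norm ?cmod_ge0 //.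
apply: le_lt_trans; rewrite ler_norml; apply/andP; split.
  by rewrite lerNl opprB lerBlDr (le_trans _ (cmodD _ _)) // subrK.
by rewrite lerBlDr -(cmodN (u n - l)) opprB (le_trans _ (cmodD _ _)) // subrK.
Qed.

Lemma cvg_cplx_re_im (u : nat -> C) (l : C) :
  (fun n => cre (u n)) @ \oo --> cre l -> (fun n => cim (u n)) @ \oo --> cim l -> u @ \oo --> l.
Proof.
move=> /cvgrPdist_lt h1 /cvgrPdist_lt h2; apply/cvg_cplxP/cvgrPdist_lt => e e0.
have e2 : 0 < e / 2 by rewrite divr_gt0.
near=> n; rewrite sub0r normrN ger0_norm ?cmod_ge0 //.
apply: (le_lt_trans (cmod_le_reim _)); rewrite creB cimB (splitr e) ltrD // distrC; near: n.
  exact: (h1 _ e2).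
exact: (h2 _ e2).
Unshelve. all: by end_near. Qed.

End ComplexLimits.

Section EntireSeries.
Variable R : realType.
Local Notation C := (Cplx R).
Implicit Types (c : nat -> R) (z w : C) (A B : R).

Definition psum c n z : C := \sum_(k < n) (cofR (c k) * z ^+ k).
Definition entire c z : C := limn (fun n => psum c n z).
Definition expbound A B c := forall k, `|c k| <= A * (B ^+ k / (k`!)%:R).

Lemma exp_psum_le (x : R) n : 0 <= x -> \sum_(k < n) x ^+ k / (k`!)%:R <= expR x.
Proof.
move=> x0; have h := is_cvg_series_exp_coeff x.
have := @nondecreasing_cvgn_le R (series (exp_coeff x)) _ h n.
rewrite /series /= big_mkord; apply.
by apply/nondecreasing_series => k _ _; rewrite exp_coeff_ge0.
Qed.

Lemma psum_cvg A B c z : 0 <= A -> 0 <= B -> expbound A B c -> cvgn (fun n => psum c n z).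
Proof.
move=> A0 B0 cb.
have key (pr : C -> R) : (forall x, `|pr x| <= cmod x) ->
    cvgn (series (fun k => c k * pr (z ^+ k))).
  move=> hp; apply: normed_cvg.
  apply: (@series_le_cvg R _ (fun k => A * exp_coeff (B * cmod z) k)).
  - move=> k; exact: normr_ge0.
  - by move=> k; rewrite mulr_ge0 // exp_coeff_ge0 // mulr_ge0 ?cmod_ge0.
  - move=> k /=; rewrite normrM.
    apply: (@le_trans _ _ (A * (B ^+ k / (k`!)%:R) * cmod z ^+ k)).
      by rewrite ler_pM // -cmodX.
    rewrite le_eqVlt; apply/orP; left; apply/eqP; rewrite /exp_coeff /= exprMn; ring.
  - have := @is_cvg_seriesZ R^o (exp_coeff (B * cmod z)) A.
    by apply; exact: is_cvg_series_exp_coeff.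
have h1 := key _ (@cre_le_cmod R); have h2 := key _ (@cim_le_cmod R).
apply/cvg_ex; exists ((limn (series (fun k => c k * cre (z ^+ k))) +i*
  limn (series (fun k => c k * cim (z ^+ k))))%C : R[i]).
apply: cvg_cplx_re_im => /=.
  have -> : (fun n => cre (psum c n z)) = series (fun k => c k * cre (z ^+ k)); last exact: h1.
  apply/funext => n; rewrite /series /= big_mkord /psum.
  by elim/big_rec2: _ => // i y1 y2 _ <-; rewrite creD creZ.
have -> : (fun n => cim (psum c n z)) = series (fun k => c k * cim (z ^+ k)); last exact: h2.
apply/funext => n; rewrite /series /= big_mkord /psum.
by elim/big_rec2: _ => // i y1 y2 _ <-; rewrite cimD cimZ.
Qed.

Lemma entire_cvg A B c z : 0 <= A -> 0 <= B -> expbound A B c ->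
  (fun n => psum c n z) @ \oo --> entire c z.
Proof. by move=> A0 B0 /(psum_cvg A0 B0) h; exact: h. Qed.

Lemma entire_cvgS A B c z : 0 <= A -> 0 <= B -> expbound A B c ->
  (fun n => psum c n.+1 z) @ \oo --> entire c z.
Proof.
move=> A0 B0 /(entire_cvg (z := z) A0 B0) h.
by have := h; rewrite -cvg_shiftS.
Qed.

Definition dcoef c : nat -> R := fun k => k.+1%:R * c k.+1.

Lemma expbound_dcoef A B c : 0 <= A -> 0 <= B -> expbound A B c -> expbound (A * B) B (dcoef c).
Proof.
move=> A0 B0 cb k; rewrite /dcoef normrM normr_nat.
apply: (@le_trans _ _ (k.+1%:R * (A * (B ^+ k.+1 / (k.+1`!)%:R)))); first by rewrite ler_wpM2l.
rewrite le_eqVlt; apply/orP; left; apply/eqP; rewrite factS natrM exprS; field.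
by rewrite pnatr_eq0 -lt0n fact_gt0 /= nat1r pnatr_eq0.
Qed.

Lemma taylor_pow z w (rho : R) k : 1 <= rho -> cmod z + cmod w <= rho ->
  cmod ((z + w) ^+ k - z ^+ k - k%:R * w * z ^+ k.-1) <= cmod w ^+ 2 * (4 * rho) ^+ k.
Proof.
move=> rho1 hz.
have rho0 : 0 <= rho by apply: le_trans rho1.
have zr : cmod z <= rho by apply: le_trans hz; rewrite lerDl cmod_ge0.
suff H : cmod ((z + w) ^+ k - z ^+ k - k%:R * w * z ^+ k.-1) <= cmod w ^+ 2 * ((k ^ 2)%:R * rho ^+ k).
  apply: le_trans H _; rewrite ler_wpM2l ?sqr_ge0 // exprMn ler_wpM2r ?exprn_ge0 //.
  rewrite -natrX ler_nat -(expnM 2 2) mulnC expnM leq_sqr.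
  by rewrite ltnW // ltn_expl.
elim: k => [|k IH].
  by rewrite !expr0 mul0r mul0r subrr subr0 cmod0 mul0r mulr0.
have -> : (z + w) ^+ k.+1 - z ^+ k.+1 - k.+1%:R * w * z ^+ k.+1.-1 =
    (z + w) * ((z + w) ^+ k - z ^+ k - k%:R * w * z ^+ k.-1) + k%:R * w ^+ 2 * z ^+ k.-1.
  case: k {IH} => [|k] /=; first by rewrite !expr0 !expr1; ring.
  by rewrite -(natr1 k.+1) !exprS; ring.
apply: (le_trans (cmodD _ _)); rewrite !cmodM.
have rk : cmod z ^+ k.-1 <= rho ^+ k.+1.
  apply: (@le_trans _ _ (rho ^+ k.-1)); first by rewrite lerXn2r ?nnegrE ?cmod_ge0.
  by rewrite ler_weXn2l // (leq_trans (leq_pred _)).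
apply: (@le_trans _ _ (rho * (cmod w ^+ 2 * ((k ^ 2)%:R * rho ^+ k)) + k%:R * cmod w ^+ 2 * rho ^+ k.+1)).
  apply: lerD.
    by rewrite ler_pM ?cmod_ge0 // (le_trans (cmodD _ _)).
  by rewrite cmod_nat ler_pM ?mulr_ge0 ?exprn_ge0 ?cmod_ge0 // cmodX.
have -> : rho * (cmod w ^+ 2 * ((k ^ 2)%:R * rho ^+ k)) + k%:R * cmod w ^+ 2 * rho ^+ k.+1 =
   cmod w ^+ 2 * ((k ^ 2 + k)%:R * rho ^+ k.+1).
  by rewrite natrD (exprS rho); ring.
rewrite ler_wpM2l ?sqr_ge0 // ler_wpM2r ?exprn_ge0 // ler_nat.
by rewrite -!mulnn; lia.
Qed.

Lemma taylor_entire A B c z w (rho : R) : 0 <= A -> 0 <= B -> expbound A B c ->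
  1 <= rho -> cmod z + cmod w <= rho ->
  cmod (entire c (z + w) - entire c z - w * entire (dcoef c) z) <=
  A * expR (4 * B * rho) * cmod w ^+ 2.
Proof.
move=> A0 B0 cb rho1 hz.
have rho0 : 0 <= rho by apply: le_trans rho1.
have h1 := entire_cvgS (z := z + w) A0 B0 cb.
have h2 := entire_cvgS (z := z) A0 B0 cb.
have h3 := entire_cvg (z := z) (mulr_ge0 A0 B0) B0 (expbound_dcoef A0 B0 cb).
have h : (fun n => psum c n.+1 (z + w) - psum c n.+1 z - w * psum (dcoef c) n z) @ \oo -->
    entire c (z + w) - entire c z - w * entire (dcoef c) z.
  apply: cvgB; first by apply: cvgB; [exact: h1|exact: h2].
  by apply: cvgM; [exact: cvg_cst|exact: h3].
have hc := cvg_cmod h.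
apply: (cvgr_to_le hc); apply: nearW => n /=.
have -> : psum c n.+1 (z + w) - psum c n.+1 z - w * psum (dcoef c) n z =
   \sum_(k < n.+1) (cofR (c k) * ((z + w) ^+ k - z ^+ k - k%:R * w * z ^+ k.-1)).
  have -> : w * psum (dcoef c) n z = \sum_(k < n.+1) (cofR (c k) * (k%:R * w * z ^+ k.-1)).
    rewrite big_ord_recl /= mul0r mul0r mulr0 add0r /psum mulr_sumr.
    apply: eq_bigr => i _; rewrite /dcoef cofRM cofR_nat /bump /= add1n; ring.
  by rewrite -!sumrB; apply: eq_bigr => i _; ring.
have ih : \sum_(k < n.+1) A * (B ^+ k / k`!%:R) * (cmod w ^+ 2 * (4 * rho) ^+ k) <= A * expR (4 * B * rho) * cmod w ^+ 2.
  have := @exp_psum_le (4 * B * rho) n.+1; rewrite !mulr_ge0 // => /(_ isT) hh.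
  rewrite (eq_bigr (fun k : 'I_n.+1 => (A * cmod w ^+ 2) * ((4 * B * rho) ^+ k / k`!%:R))); last first.
    by move=> i _; rewrite !exprMn; ring.
  by rewrite -mulr_sumr mulrAC ler_wpM2r ?sqr_ge0 // ler_wpM2l.
apply: le_trans ih; elim/big_ind2: _ => [|x1 x2 y1 y2 k1 k2|i _].
- by rewrite cmod0.
- by apply: (le_trans (cmodD _ _)); rewrite lerD.
- by rewrite cmodM cmod_ofR ler_pM ?cmod_ge0 // taylor_pow.
Qed.

Lemma derive_small (r q : R -> R) (t K : R) : r t = 0 -> q t = 0 -> is_derive t 1 q 0 ->
  (\forall x \near t, `|r x| <= K * q x) -> is_derive t 1 r 0.
Proof.
move=> rt qt [dq qE] hb.
suff H : (fun h => h^-1 *: (r (h *: 1 + t) - r t)) @ 0^' --> (0 : R).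
  split; first by apply/cvg_ex; exists 0.
  exact/cvg_lim.
have hq : (fun h => h^-1 *: (q (h *: 1 + t) - q t)) @ 0^' --> (0 : R).
  by have : (fun h => h^-1 *: (q (h *: 1 + t) - q t)) @ 0^' --> 'D_1 q t; [exact: dq|rewrite qE].
have hK : (fun h => `|K| * `|h^-1 *: (q (h *: 1 + t) - q t)|) @ 0^' --> (0 : R).
  have := cvgM (cvg_cst `|K|) (cvg_norm hq).
  by rewrite normr0 mulr0; exact.
apply/norm_cvg0P.
have ht : (fun h : R => h *: 1 + t) @ 0 --> t.
  have -> : (fun h : R => h *: 1 + t) = (fun h => h + t).
    by apply/funext => x; rewrite /GRing.scale /= mulr1.
  rewrite -[X in _ --> X]add0r; apply: cvgD; [exact: cvg_id|exact: cvg_cst].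
have hb0 : \forall h \near (0 : R), `|r (h *: 1 + t)| <= K * q (h *: 1 + t) := ht _ hb.
have hb' : \forall h \near (0 : R)^', `|r (h *: 1 + t)| <= K * q (h *: 1 + t).
  by rewrite /dnbhs /within /=; apply: filterS hb0 => h hh _.
apply: (squeeze_cvgr _ (cvg_cst 0) hK).
near=> h.
rewrite normr_ge0 /= rt qt !subr0 !normrZ mulrCA ler_wpM2l //.
apply: (@le_trans _ _ (K * q (h *: 1 + t))); first by near: h.
by rewrite -normrM ler_norm.
Unshelve. all: by end_near. Qed.

Lemma cder_entire A B c (F : R -> C) t d : 0 <= A -> 0 <= B -> expbound A B c ->
  cder F t d -> cder (fun x => entire c (F x)) t (d * entire (dcoef c) (F t)).
Proof.
move=> A0 B0 cb hF.
pose lin x := entire c (F t) + (F x - F t) * entire (dcoef c) (F t).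
have hlin : cder lin t (d * entire (dcoef c) (F t)).
  have := cderD (cder_cst (entire c (F t)) t) (cderM (cderB hF (cder_cst (F t) t)) (cder_cst (entire (dcoef c) (F t)) t)).
  by move=> /cder_eq; apply; ring.
pose rem x := entire c (F x) - lin x.
have hq : is_derive t 1 (fun x => csq (F x - F t)) 0.
  apply: (isd_eq (cder_csq (cderB hF (cder_cst (F t) t)))).
  by rewrite subrr /cdot cre0 cim0; ring.
pose rho := cmod (F t) + 1.
have rho1 : 1 <= rho by rewrite lerDr cmod_ge0.
pose K := A * expR (4 * B * rho).
have hnear : \forall x \near t, cmod (rem x) <= K * csq (F x - F t).
  have := isd_continuous hq => /cvgr_lt; rewrite subrr {1}/csq cre0 cim0 => /(_ 1) H.
  near=> x.
  have hx : csq (F x - F t) < 1.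
    by near: x; apply: H; rewrite expr0n /= addr0 ltr01.
  have hx' : cmod (F x - F t) <= 1.
    by rewrite -(@ler_pXn2r _ 2) ?nnegrE ?cmod_ge0 ?ler01 // cmod_sqr expr1n ltW.
  have := @taylor_entire A B c (F t) (F x - F t) rho A0 B0 cb rho1.
  rewrite lerD2l => /(_ hx'); rewrite [F t + _]addrC subrK cmod_sqr.
  by rewrite /rem /lin opprD addrA.
have rem0 : rem t = 0 by rewrite /rem /lin; ring.
have q0 : csq (F t - F t) = 0 by rewrite subrr; apply/eqP; rewrite csq_eq0.
have r1 : is_derive t 1 (fun x => cre (rem x)) 0.
  apply: (@derive_small (fun x => cre (rem x)) (fun x => csq (F x - F t)) t K _ q0 hq).
    by rewrite rem0.
  by apply: filterS hnear => x; apply: le_trans; exact: cre_le_cmod.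
have r2 : is_derive t 1 (fun x => cim (rem x)) 0.
  apply: (@derive_small (fun x => cim (rem x)) (fun x => csq (F x - F t)) t K _ q0 hq).
    by rewrite rem0.
  by apply: filterS hnear => x; apply: le_trans; exact: cim_le_cmod.
have hrem : cder rem t 0 by split.
have := cderD hlin hrem; rewrite addr0; apply: cder_ext => x.
by rewrite /rem addrC subrK.
Unshelve. all: by end_near. Qed.

End EntireSeries.

Section Kummer.
Variable R : realType.
Local Notation C := (Cplx R).
Variables (a b : R).
Hypotheses (a0 : 0 < a) (ab : a <= b).

Definition kcoef : nat -> R := fun k => poch a k / (poch b k * (k`!)%:R).

Lemma F11E z : F11 a b z = entire kcoef z. Proof. by []. Qed.

Lemma poch_gt0 (x : R) k : 0 < x -> 0 < poch x k.
Proof. by move=> x0; apply: prodr_gt0 => i _; rewrite ltr_pwDl. Qed.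

Lemma pochS (x : R) k : poch x k.+1 = poch x k * (x + k%:R).
Proof. by rewrite /poch big_ord_recr. Qed.

Lemma poch0 (x : R) : poch x 0 = 1.
Proof. by rewrite /poch big_ord0. Qed.

Let b0 : 0 < b. Proof. exact: lt_le_trans ab. Qed.

Lemma kcoef_ge0 k : 0 <= kcoef k.
Proof. by rewrite divr_ge0 ?mulr_ge0 // ltW // poch_gt0. Qed.

Lemma kcoef0 : kcoef 0 = 1.
Proof. by rewrite /kcoef !poch0 fact0 !mul1r invr1. Qed.

Lemma kcoef_rec k : (b + k%:R) * dcoef kcoef k = (a + k%:R) * kcoef k.
Proof.
rewrite /dcoef /kcoef !pochS factS natrM; field.
rewrite pnatr_eq0 -lt0n fact_gt0 /= !gt_eqF ?ltr_pwDl ?poch_gt0 //=.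
Qed.

Lemma dkcoef_ge k : a * kcoef k <= b * dcoef kcoef k.
Proof.
have bk : 0 < b + k%:R by rewrite ltr_pwDl.
rewrite -(ler_pM2l bk) [X in _ <= X]mulrCA kcoef_rec mulrA [X in _ <= X]mulrA.
rewrite ler_wpM2r ?kcoef_ge0 // mulrDl mulrDr lerD2l mulrC.
by rewrite ler_wpM2r.
Qed.

Lemma kcoef_expbound : expbound 1 1 kcoef.
Proof.
move=> k; rewrite ger0_norm ?kcoef_ge0 // expr1n !mul1r /kcoef invfM mulrA.
rewrite ler_piMl ?invr_ge0 // ler_pdivrMr ?poch_gt0 // mul1r.
by apply: ler_prod => i _; rewrite lerD2r ab andbT addr_ge0 // ltW.
Qed.

Definition kum0 (z : C) := entire kcoef z.
Definition kum1 (z : C) := entire (dcoef kcoef) z.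
Definition kum2 (z : C) := entire (dcoef (dcoef kcoef)) z.

Let e0 := kcoef_expbound.
Let e1 : expbound 1 1 (dcoef kcoef).
Proof. by have := expbound_dcoef ler01 ler01 e0; rewrite mulr1. Qed.
Let e2 : expbound 1 1 (dcoef (dcoef kcoef)).
Proof. by have := expbound_dcoef ler01 ler01 e1; rewrite mulr1. Qed.

Lemma cder_kum0 (F : R -> C) t d : cder F t d ->
  cder (fun x => kum0 (F x)) t (d * kum1 (F t)).
Proof. exact: cder_entire ler01 ler01 e0. Qed.

Lemma cder_kum1 (F : R -> C) t d : cder F t d ->
  cder (fun x => kum1 (F x)) t (d * kum2 (F t)).
Proof. exact: cder_entire ler01 ler01 e1. Qed.

Lemma kummer_ode z : z * kum2 z + (cofR b - z) * kum1 z = cofR a * kum0 z.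
Proof.
have h2 := entire_cvg (z := z) ler01 ler01 e2.
have h1 := entire_cvg (z := z) ler01 ler01 e1.
have h1' := entire_cvgS (z := z) ler01 ler01 e1.
have h0' := entire_cvgS (z := z) ler01 ler01 e0.
have h : (fun n => z * psum (dcoef (dcoef kcoef)) n z +
     (cofR b * psum (dcoef kcoef) n.+1 z - z * psum (dcoef kcoef) n z) -
     cofR a * psum kcoef n.+1 z) @ \oo -->
     z * kum2 z + (cofR b * kum1 z - z * kum1 z) - cofR a * kum0 z.
  apply: cvgB; last by apply: cvgM; [exact: cvg_cst|exact: h0'].
  apply: cvgD; first by apply: cvgM; [exact: cvg_cst|exact: h2].
  apply: cvgB; first by apply: cvgM; [exact: cvg_cst|exact: h1'].
  by apply: cvgM; [exact: cvg_cst|exact: h1].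
have hz : (fun n => z * psum (dcoef (dcoef kcoef)) n z +
     (cofR b * psum (dcoef kcoef) n.+1 z - z * psum (dcoef kcoef) n z) -
     cofR a * psum kcoef n.+1 z) = (fun=> 0).
  apply/funext => n.
  have -> : z * psum (dcoef (dcoef kcoef)) n z =
      \sum_(k < n.+1) cofR (k%:R * dcoef kcoef k) * z ^+ k.
    rewrite big_ord_recl /= mul0r cofR0 mul0r add0r /psum mulr_sumr.
    by apply: eq_bigr => i _; rewrite {1}/dcoef /bump /= add1n exprS; ring.
  have -> : z * psum (dcoef kcoef) n z = \sum_(k < n.+1) cofR (k%:R * kcoef k) * z ^+ k.
    rewrite big_ord_recl /= mul0r cofR0 mul0r add0r /psum mulr_sumr.
    by apply: eq_bigr => i _; rewrite {1}/dcoef /bump /= add1n exprS; ring.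
  rewrite /psum !mulr_sumr -!sumrB -big_split -sumrB /= big1 // => i _.
  have := kcoef_rec i; move: (dcoef kcoef i) (kcoef i) => d c hr.
  have hr' : (cofR b + i%:R) * cofR d = (cofR a + i%:R) * cofR c :> C.
    by rewrite -!cofR_nat -!cofRD -!cofRM hr.
  rewrite !cofRM !cofR_nat; move: hr'.
  set u := cofR d; set v := cofR c => hr'.
  have -> : i%:R * u * z ^+ i + (cofR b * (u * z ^+ i) - i%:R * v * z ^+ i) - cofR a * (v * z ^+ i) =
    ((cofR b + i%:R) * u - (cofR a + i%:R) * v) * z ^+ i by ring.
  by rewrite hr' subrr mul0r.
have : z * kum2 z + (cofR b * kum1 z - z * kum1 z) - cofR a * kum0 z = 0.
  apply: (@cvg_unique _ (@norm_hausdorff _ C) _ _ _ _ h).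
  by rewrite hz; exact: cvg_cst.
by move/eqP; rewrite subr_eq0 => /eqP <-; ring.
Qed.

Lemma cre_psum_real c n (x : R) : cre (psum c n (cofR x) : C) = \sum_(k < n) c k * x ^+ k.
Proof.
by rewrite /psum; elim/big_rec2: _ => // i y1 y2 _ <-; rewrite creD creZ -cofRX cre_ofR.
Qed.

Lemma cim_psum_real c n (x : R) : cim (psum c n (cofR x) : C) = 0.
Proof.
by rewrite /psum; elim/big_rec: _ => // i y _ h; rewrite cimD cimZ -cofRX cim_ofR mulr0 h addr0.
Qed.

Lemma entire_real c (x : R) : cvgn (fun n => psum c n (cofR x)) ->
  entire c (cofR x) = cofR (cre (entire c (cofR x))) :> C.
Proof.
move=> h; apply: (@cvg_unique _ (@norm_hausdorff _ C) _ _ _ _ h).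
have h' := cvg_cre h; apply: cvg_cplx_re_im; first by rewrite cre_ofR; exact: h'.
rewrite cim_ofR (_ : (fun n => _) = fun=> 0); first exact: cvg_cst.
by apply/funext => n; rewrite cim_psum_real.
Qed.

Definition rkum0 (x : R) : R := cre (kum0 (cofR x)).
Definition rkum1 (x : R) : R := cre (kum1 (cofR x)).

Lemma kum0_real x : kum0 (cofR x) = cofR (rkum0 x).
Proof. by apply: entire_real; exact: psum_cvg ler01 ler01 e0. Qed.
Lemma kum1_real x : kum1 (cofR x) = cofR (rkum1 x).
Proof. by apply: entire_real; exact: psum_cvg ler01 ler01 e1. Qed.

Let c0 x : (fun n => \sum_(k < n) kcoef k * x ^+ k) @ \oo --> rkum0 x.
Proof.
have := cvg_cre (entire_cvg (z := cofR x) ler01 ler01 e0).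
by under eq_fun do rewrite cre_psum_real.
Qed.

Lemma rkum1_cvg x : (fun n => \sum_(k < n) dcoef kcoef k * x ^+ k) @ \oo --> rkum1 x.
Proof.
have := cvg_cre (entire_cvg (z := cofR x) ler01 ler01 e1).
by under eq_fun do rewrite cre_psum_real.
Qed.

Lemma rkum1_ge x : 0 <= x -> a * rkum0 x <= b * rkum1 x.
Proof.
move=> x0.
have h1 : (fun n => a * \sum_(k < n) kcoef k * x ^+ k) @ \oo --> a * rkum0 x.
  by apply: cvgM; [exact: cvg_cst|exact: c0].
have h2 : (fun n => b * \sum_(k < n) dcoef kcoef k * x ^+ k) @ \oo --> b * rkum1 x.
  by apply: cvgM; [exact: cvg_cst|exact: rkum1_cvg].
apply: (ler_cvg_to h1 h2); apply: nearW => n; rewrite !mulr_sumr.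
by apply: ler_sum => i _; rewrite [X in X <= _]mulrA [X in _ <= X]mulrA; apply: ler_wpM2r (dkcoef_ge i); exact: exprn_ge0.
Qed.

Lemma rkum0_gt0 x : 0 <= x -> 0 < rkum0 x.
Proof.
move=> x0; apply: (@lt_le_trans _ _ 1) => //.
apply: (cvgr_to_ge (c0 (x := x))); near=> n.
have n0 : (0 < n)%N by near: n; exact: nbhs_infty_gt.
rewrite -(prednK n0) big_ord_recl /= kcoef0 expr0 mulr1 lerDl.
by apply: sumr_ge0 => i _; rewrite mulr_ge0 ?kcoef_ge0 // exprn_ge0.
Unshelve. all: by end_near. Qed.

End Kummer.

Section ScaledKummer.
Variable R : realType.
Local Notation C := (Cplx R).
Variables (a b : R).
Hypotheses (a0 : 0 < a) (ab : a <= b).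

Definition sk0 (xi : C) : C := kum0 a b (cofR b * xi).
Definition sk1 (xi : C) : C := cofR b * kum1 a b (cofR b * xi).
Definition sk2 (xi : C) : C := cofR b ^+ 2 * kum2 a b (cofR b * xi).

Lemma cder_sk0 (F : R -> C) t d : cder F t d -> cder (fun x => sk0 (F x)) t (d * sk1 (F t)).
Proof.
move=> h; have := cder_kum0 a0 ab (cderZ (cofR b) h).
by move=> /cder_eq; apply; rewrite /sk1; ring.
Qed.

Lemma cder_sk1 (F : R -> C) t d : cder F t d -> cder (fun x => sk1 (F x)) t (d * sk2 (F t)).
Proof.
move=> h; have := cderZ (cofR b) (cder_kum1 a0 ab (cderZ (cofR b) h)).
by move=> /cder_eq; apply; rewrite /sk2; ring.
Qed.

Lemma sk_ode xi : xi * sk2 xi = cofR b * ((xi - 1) * sk1 xi + cofR a * sk0 xi).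
Proof.
have := kummer_ode a0 ab (cofR b * xi).
rewrite /sk0 /sk1 /sk2 => <-; ring.
Qed.

Lemma entire_at0 c : expbound 1 1 c -> entire c (0 : C) = cofR (c 0%N).
Proof.
move=> h; apply: (@cvg_unique _ (@norm_hausdorff _ C) _ _ _ _ (entire_cvgS (z := 0) ler01 ler01 h)).
rewrite (_ : (fun n => _) = fun=> cofR (c 0%N)); first exact: cvg_cst.
apply/funext => n; rewrite /psum big_ord_recl /= expr0 mulr1 big1 ?addr0 // => i _.
by rewrite exprS mul0r mulr0.
Qed.

Lemma sk0_at0 : sk0 0 = 1.
Proof. by rewrite /sk0 mulr0 /kum0 (entire_at0 (kcoef_expbound a0 ab)) kcoef0. Qed.

Lemma sk1_at0 : sk1 0 = cofR a.
Proof.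
have b0 : 0 < b by exact: lt_le_trans ab.
have e1 : expbound 1 1 (dcoef (kcoef a b)).
  by have := expbound_dcoef ler01 ler01 (kcoef_expbound a0 ab); rewrite mulr1.
rewrite /sk1 mulr0 /kum1 (entire_at0 e1) -cofRM; congr cofR.
by have := kcoef_rec a0 ab 0; rewrite !addr0 kcoef0 mulr1.
Qed.

End ScaledKummer.

Section PolynomialBounds.
Variable R : realType.
Local Notation C := (Cplx R).

Definition lbdd (P : C -> C) := forall tau : R, exists M : R, forall T, cmod T <= tau -> cmod (P T) <= M.

Lemma lbdd_id : lbdd (fun T => T). Proof. by move=> tau; exists tau. Qed.
Lemma lbdd_cst z : lbdd (fun _ => z). Proof. by move=> tau; exists (cmod z). Qed.
Lemma lbddD P Q : lbdd P -> lbdd Q -> lbdd (fun T => P T + Q T).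
Proof.
move=> hP hQ tau; have [M hM] := hP tau; have [N hN] := hQ tau; exists (M + N) => T hT.
by rewrite (le_trans (cmodD _ _)) // lerD ?hM ?hN.
Qed.
Lemma lbddN P : lbdd P -> lbdd (fun T => - P T).
Proof. by move=> hP tau; have [M hM] := hP tau; exists M => T hT; rewrite cmodN hM. Qed.
Lemma lbddM P Q : lbdd P -> lbdd Q -> lbdd (fun T => P T * Q T).
Proof.
move=> hP hQ tau; have [M hM] := hP tau; have [N hN] := hQ tau; exists (M * N) => T hT.
by rewrite cmodM ler_pM ?cmod_ge0 ?hM ?hN.
Qed.
Lemma lbddX P n : lbdd P -> lbdd (fun T => P T ^+ n).
Proof.
move=> hP; elim: n => [|n IH]; first exact: (lbdd_cst 1).
by have := lbddM hP IH; congr lbdd; apply/funext => T; rewrite exprS.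
Qed.

End PolynomialBounds.

Ltac lbdd_auto := repeat lazymatch goal with
  | |- lbdd (fun T => T) => exact (@lbdd_id _)
  | |- lbdd (fun _ => ?z) => exact (lbdd_cst z)
  | |- lbdd (fun T => GRing.add (@?P T) (@?Q T)) => apply (@lbddD _ P Q)
  | |- lbdd (fun T => GRing.mul (@?P T) (@?Q T)) => apply (@lbddM _ P Q)
  | |- lbdd (fun T => GRing.opp (@?P T)) => apply (@lbddN _ P)
  | |- lbdd (fun T => GRing.exp (@?P T) ?n) => apply (@lbddX _ P n)
  end.

(** * Part (a) *)

Section PartA.
Variable R : realType.
Local Notation C := (Cplx R).
Variables (a : R).
Hypotheses (a0 : 0 < a).

Let A1 : C := cofR (a * (a + 1) / 2).
Let A4 : C := cofR (a * (a + 1) * (a + 2) * (a + 3) / 8).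
Let A3 : C := cofR (2 * a * (a + 1) * (a + 2) / 3).
Let ca : C := cofR a.

Let S1 (T : C) : C := - A1 * (T - 1) ^+ 2.
Let dS1 (T : C) : C := - (2 * A1) * T ^+ 2 * (T - 1).
Let S2 (T : C) : C := A4 * (T - 1) ^+ 4 + A3 * (T - 1) ^+ 3 + A1 * (T - 1) ^+ 2.
Let dS2 (T : C) : C := T ^+ 2 * (4 * A4 * (T - 1) ^+ 3 + 3 * A3 * (T - 1) ^+ 2 + 2 * A1 * (T - 1)).
Let ddS1 (T : C) : C := - (2 * A1) * T ^+ 2 * (2 * T * (T - 1) + T ^+ 2).
Let ddS2 (T : C) : C := T ^+ 2 * (2 * T * (4 * A4 * (T - 1) ^+ 3 + 3 * A3 * (T - 1) ^+ 2 + 2 * A1 * (T - 1))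
   + T ^+ 2 * (12 * A4 * (T - 1) ^+ 2 + 6 * A3 * (T - 1) + 2 * A1)).
Definition rho1 (T : C) : C := ddS2 T + 2 * ca * T * dS2 T + ca * (ca + 1) * T ^+ 2 * S2 T.

Let SA (b : R) (T : C) : C := 1 + cofR b^-1 * S1 T + cofR b^-1 ^+ 2 * S2 T.
Let dSA (b : R) (T : C) : C := cofR b^-1 * dS1 T + cofR b^-1 ^+ 2 * dS2 T.

Definition errA (b : R) (xi : C) : C := sk0 a b xi * cpow (1 - xi) ca - SA b (1 - xi)^-1.
Definition derrA (b : R) (xi : C) : C :=
  cpow (1 - xi) ca * (sk1 a b xi - ca * (1 - xi)^-1 * sk0 a b xi) - dSA b (1 - xi)^-1.

Lemma lbdd_rho1 : lbdd rho1.
Proof.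
rewrite /rho1 /ddS2 /dS2 /S2.
lbdd_auto.
Qed.

(* the truncated series solves the equation for [f (1 - xi)^a] up to the term [rho1] *)
Let partA_series_ode (e T : C) :
  - (e * ddS1 T + e ^+ 2 * ddS2 T) =
  - (2 * A1) * T ^+ 2 + e * (T ^+ 2 * (4 * A4 * (T - 1) ^+ 2 + 3 * A3 * (T - 1) + 2 * A1))
  + 2 * ca * T * (e * dS1 T + e ^+ 2 * dS2 T)
  + ca * (ca + 1) * T ^+ 2 * (1 + e * S1 T + e ^+ 2 * S2 T) - e ^+ 2 * rho1 T.
Proof.
have hA1 : A1 = ca * (ca + 1) / 2.
  by rewrite /A1 /ca !cofRM cofRD cofRV cofR1 (cofR_nat _ 2).
have hA3 : A3 = 2 * ca * (ca + 1) * (ca + 2) / 3.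
  by rewrite /A3 /ca !cofRM !cofRD cofRV cofR1 !cofR_nat.
have hA4 : A4 = ca * (ca + 1) * (ca + 2) * (ca + 3) / 8.
  by rewrite /A4 /ca !cofRM !cofRD cofRV cofR1 !cofR_nat.
rewrite /rho1 /ddS1 /ddS2 /dS1 /dS2 /S1 /S2.
move: hA1 hA3 hA4; move: A1 A3 A4 ca => B1 B3 B4 c -> -> ->.
by field.
Qed.

Section Path.
Variables (b : R) (gam : R -> C) (t : R) (d : C).
Hypotheses (ab : a <= b) (sl : slit (1 - gam t)) (hg : cder gam t d).

Let b0 : 0 < b. Proof. exact: lt_le_trans ab. Qed.
Let n0 : 1 - gam t != 0. Proof. exact: slit_neq0. Qed.
Let hg1 : cder (fun x => 1 - gam x) t (- d).
Proof. by apply: (cder_eq (cderB (cder_cst 1 t) hg)); rewrite sub0r. Qed.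
Let hT : cder (fun x => (1 - gam x)^-1) t (d * (1 - gam t)^-1 ^+ 2).
Proof. by apply: (cder_eq (cderV (F := fun x => 1 - gam x) n0 hg1)); field. Qed.
Let hP : cder (fun x => cpow (1 - gam x) ca) t (- ca * d * (1 - gam t)^-1 * cpow (1 - gam t) ca).
Proof. by apply: (cder_eq (cder_cpow (F := fun x => 1 - gam x) ca sl hg1)); field. Qed.

Let cder_TX (k : nat) z : cder (fun x => z * ((1 - gam x)^-1 - 1) ^+ k) t
  (z * (k%:R * ((1 - gam t)^-1 - 1) ^+ k.-1 * (d * (1 - gam t)^-1 ^+ 2))).
Proof. by apply: cderZ; apply: cderX; apply: (cder_eq (cderB hT (cder_cst 1 t))); rewrite subr0. Qed.

Lemma cder_errA : cder (fun x => errA b (gam x)) t (d * derrA b (gam t)).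
Proof.
have h1 := cderM (cder_sk0 a0 ab hg) hP.
have hS := cderD (cderD (cder_cst 1 t) (cderZ (cofR b^-1) (cder_TX 2 (- A1))))
  (cderZ (cofR b^-1 ^+ 2) (cderD (cderD (cder_TX 4 A4) (cder_TX 3 A3)) (cder_TX 2 A1))).
apply: (cder_eq (cderB h1 hS)); rewrite /derrA /dSA /dS1 /dS2 /=.
ring.
Qed.

Lemma cder_derrA : gam t != 0 -> cder (fun x => derrA b (gam x)) t
  (- (d * (cofR b * ((gam t)^-1 - 1) + 2 * ca * (1 - gam t)^-1)) * derrA b (gam t)
   - d * (ca * (ca + 1) * (1 - gam t)^-1 ^+ 2 * errA b (gam t) + cofR b^-1 ^+ 2 * rho1 (1 - gam t)^-1)).
Proof.
move=> g0.
have h1 := cderM hP (cderB (cder_sk1 a0 ab hg) (cderM (cderZ ca hT) (cder_sk0 a0 ab hg))).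
have hT2 := cderM hT hT.
have hS1 := cderM (cderZ (- (2 * A1)) hT2) (cder_TX 1 1).
have hS2 := cderM hT2 (cderD (cderD (cder_TX 3 (4 * A4)) (cder_TX 2 (3 * A3))) (cder_TX 1 (2 * A1))).
have hS := cderD (cderZ (cofR b^-1) hS1) (cderZ (cofR b^-1 ^+ 2) hS2).
have h := cderB h1 hS.
apply: (cder_ext _ (cder_eq h _)).
  by move=> x; rewrite /derrA /dSA /dS1 /dS2; ring.
have E : sk2 a b (gam t) = cofR b * ((1 - (gam t)^-1) * sk1 a b (gam t) + ca * (gam t)^-1 * sk0 a b (gam t)).
  apply: (mulfI g0); rewrite (sk_ode a0 ab); field.
  exact: g0.
rewrite E {h h1 hT2 hS1 hS2 hS E}.
set T := (1 - gam t)^-1; set X := (gam t)^-1.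
have hX : T * (X - 1) = X.
  by rewrite /T /X; field; rewrite g0 n0.
have hw : (X - 1) * (T - 1) = 1.
  by rewrite /T /X; field; rewrite g0 n0.
have hB : cofR b * cofR b^-1 = 1 :> C by rewrite -cofRM mulfV ?gt_eqF.
have hdS : (cofR b * (X - 1)) * dSA b T = - (2 * A1) * T ^+ 2 +
    cofR b^-1 * (T ^+ 2 * (4 * A4 * (T - 1) ^+ 2 + 3 * A3 * (T - 1) + 2 * A1)).
  transitivity ((cofR b * cofR b^-1) * (((X - 1) * (T - 1)) * (- (2 * A1) * T ^+ 2 +
    cofR b^-1 * (T ^+ 2 * (4 * A4 * (T - 1) ^+ 2 + 3 * A3 * (T - 1) + 2 * A1))))).
    by rewrite /dSA /dS1 /dS2; ring.
  by rewrite hB hw !mul1r.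
have hS := partA_series_ode (cofR b^-1) T.
set f0 := sk0 a b _; set f1 := sk1 a b _; set P := cpow _ _.
rewrite /derrA /errA -/T -/P -/f0 -/f1.
transitivity (P * d * ((- (2 * ca * T) - cofR b * (X - 1)) * f1 + (ca ^+ 2 * T ^+ 2 - ca * T ^+ 2 + cofR b * ca * X) * f0)
  - d * (cofR b^-1 * ddS1 T + cofR b^-1 ^+ 2 * ddS2 T)).
  by rewrite /ddS1 /ddS2 /=; ring.
rewrite -[in cofR b * ca * X]hX.
transitivity (P * d * ((- (2 * ca * T) - cofR b * (X - 1)) * f1 + (ca ^+ 2 * T ^+ 2 - ca * T ^+ 2 + cofR b * ca * (T * (X - 1))) * f0)
  + d * (cofR b * (X - 1) * dSA b T + 2 * ca * T * dSA b T + ca * (ca + 1) * T ^+ 2 * SA b T - cofR b^-1 ^+ 2 * rho1 T)).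
  rewrite hdS; congr (_ + _); rewrite -[LHS]mulrN; congr (_ * _); exact: hS.
by ring.
Qed.

Lemma derivable_derrA : exists e, cder (fun x => derrA b (gam x)) t e.
Proof.
have h1 := cderM hP (cderB (cder_sk1 a0 ab hg) (cderM (cderZ ca hT) (cder_sk0 a0 ab hg))).
have hT2 := cderM hT hT.
have hS1 := cderM (cderZ (- (2 * A1)) hT2) (cder_TX 1 1).
have hS2 := cderM hT2 (cderD (cderD (cder_TX 3 (4 * A4)) (cder_TX 2 (3 * A3))) (cder_TX 1 (2 * A1))).
have hS := cderD (cderZ (cofR b^-1) hS1) (cderZ (cofR b^-1 ^+ 2) hS2).
by eexists; apply: (cder_ext _ (cderB h1 hS)) => x; rewrite /derrA /dSA /dS1 /dS2; ring.
Qed.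

End Path.

Lemma clog1 : clog (1 : C) = 0.
Proof.
apply: cplxP; rewrite ?cre_clog ?cim_clog ?cmod1 ?ln1 //.
by rewrite /carg oner_eq0 cim1 lexx cre1 cmod1 divr1 acos1.
Qed.

Lemma errA_at0 b : a <= b -> errA b 0 = 0.
Proof.
move=> ab; rewrite /errA /SA /S1 /S2 (sk0_at0 a0 ab) subr0 invr1 cpowE clog1 mulr0 cexp0 subrr.
by rewrite !expr0n /=; ring.
Qed.

Lemma derrA_at0 b : a <= b -> derrA b 0 = 0.
Proof.
move=> ab; rewrite /derrA /dSA /dS1 /dS2 (sk0_at0 a0 ab) (sk1_at0 a0 ab) subr0 invr1 subrr.
by rewrite !expr0n /=; ring.
Qed.

Lemma errAE b xi : 1 - xi != 0 -> let w := xi / (1 - xi) in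
  F11 a b (cofR b * xi) - cpow (1 - xi) (cofR (- a)) *
    (1 - cofR (a * (a + 1) / 2) * w ^+ 2 * cofR (b^-1)
              + (cofR (a * (a + 1) * (a + 2) * (a + 3) / 8) * w ^+ 4
                 + cofR (2 * a * (a + 1) * (a + 2) / 3) * w ^+ 3
                 + cofR (a * (a + 1) / 2) * w ^+ 2) * cofR (b ^- 2)) =
  cpow (1 - xi) (cofR (- a)) * errA b xi.
Proof.
move=> n0 w; have -> : w = (1 - xi)^-1 - 1 by rewrite /w; field.
rewrite /errA /SA /S1 /S2 cofRN cpowN -exprVn cofRX F11E -/(kum0 a b (cofR b * xi)) -/(sk0 a b xi).
rewrite -/A1 -/A3 -/A4 -/ca [RHS]mulrBr [X in _ = X - _]mulrCA mulVf ?cpow_neq0 // mulr1; ring.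
Qed.
End PartA.

Section PartAPath.
Variable R : realType.
Local Notation C := (Cplx R).
Variables (a : R).
Hypotheses (a0 : 0 < a).

Definition energyA (b : R) (xi : C) : R := csq (errA a b xi) + csq (derrA a b xi) / b.

Lemma partA_path (L tau d Len : R) : 0 <= L -> 0 <= tau -> 0 < d -> 0 <= Len ->
  exists K b1 : R, [/\ 0 < K, a <= b1, 1 <= b1 & forall (b : R) (gam dgam : R -> C) (t0 t1 : R),
  b1 <= b -> t0 <= t1 <= t0 + Len ->
  (forall t, t0 <= t <= t1 -> cder gam t (dgam t) /\ slit (1 - gam t)) ->
  (forall t, t0 < t < t1 -> [/\ gam t != 0, cmod (1 - gam t)^-1 <= tau, cmod (dgam t) <= L &
     d <= cre (dgam t * ((gam t)^-1 - 1))]) ->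
  energyA b (gam t1) <= K * (energyA b (gam t0) + b ^- 6)].
Proof.
move=> L0 tau0 d0 Len0.
have [M hM] := @lbdd_rho1 R a tau.
have M0 : 0 <= M by apply: le_trans (cmod_ge0 _) (hM 0 _); rewrite cmod0.
pose c := L + L * (a * (a + 1) * tau ^+ 2) + L * M + 1.
have aa0 : 0 <= a * (a + 1) by rewrite mulr_ge0 ?addr_ge0 // ltW.
have u0 : 0 <= L * (a * (a + 1) * tau ^+ 2) by rewrite mulr_ge0 // mulr_ge0 // sqr_ge0.
have u1 : 0 <= L * M by rewrite mulr_ge0.
have c0 : 0 < c by rewrite ltr_wpDl // !addr_ge0.
have d2 : 0 < d / 2 by rewrite divr_gt0.
have [K K0 HK] := @damped_system R c (d / 2) Len c0 d2 Len0.
have [w wE] : exists w, w = 4 * a * tau * L / d by eexists.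
have w0 : 0 <= w by rewrite wE divr_ge0 ?mulr_ge0 // ltW.
pose b1 := 1 + a + w.
have b1a : a <= b1 by rewrite /b1 addrAC lerDr addr_ge0.
have b11 : 1 <= b1 by rewrite /b1 -addrA lerDl addr_ge0 // ltW.
have b1w : w <= b1 by rewrite /b1 lerDr addr_ge0 // ltW.
exists (3 * K + 2), b1; split.
- by rewrite ltr_wpDl // mulr_ge0 // ltW.
- by [].
- by [].
move=> b gam dgam t0 t1 bb1 tt hcl hop.
have b1' : 1 <= b by apply: le_trans bb1.
have ab : a <= b by apply: le_trans bb1.
have b0 : 0 < b by apply: lt_le_trans b1'.
pose q t := - (dgam t) * (cofR a * (cofR a + 1) * (1 - gam t)^-1 ^+ 2 * errA a b (gam t) +
  cofR b^-1 ^+ 2 * rho1 a (1 - gam t)^-1).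
pose zeta t := dgam t * (cofR b * ((gam t)^-1 - 1) + 2 * cofR a * (1 - gam t)^-1).
have bV0 : 0 <= b^-1 by rewrite invr_ge0 ltW.
have hin t : t0 < t < t1 -> t0 <= t <= t1 by move=> /andP[/ltW -> /ltW ->].
have := HK b 0 (b^-1 ^+ 2) t0 t1 (fun t => errA a b (gam t)) (fun t => derrA a b (gam t))
  (fun t => dgam t * derrA a b (gam t)) q zeta b1' (lexx _) (sqr_ge0 _) tt.
have hcont t : t0 <= t <= t1 -> {for t, continuous (fun x => csq (derrA a b (gam x)))}.
  move=> /hcl [h1 h2].
  have [e he] : exists e, cder (fun x => derrA a b (gam x)) t e.
    exact: (@derivable_derrA _ a a0 b gam t (dgam t) ab h2 h1).
  exact: isd_continuous (cder_csq he).
move=> H; have {H} := H _ hcont _ _ _ _ _; case.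
- move=> t /hcl [h1 h2]; exact: isd_continuous (cder_csq (@cder_errA _ a a0 b gam t (dgam t) ab h2 h1)).
- move=> t /hin /hcl [h1 h2]; exact: (@cder_errA _ a a0 b gam t (dgam t) ab h2 h1).
- move=> t ti; have [h1 h2] := hcl t (hin t ti); have [g0 _ _ _] := hop t ti.
  apply: (cder_eq (@cder_derrA _ a a0 b gam t (dgam t) ab h2 h1 g0)).
  by rewrite /zeta /q; ring.
- move=> t ti; have [g0 h1 h2 h3] := hop t ti.
  have -> : zeta t = cofR b * (dgam t * ((gam t)^-1 - 1)) + cofR (2 * a) * (dgam t * (1 - gam t)^-1).
    by rewrite /zeta cofRM cofR_nat; ring.
  rewrite creD !creZ.
  have h4 : `|cre (dgam t * (1 - gam t)^-1)| <= L * tau.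
    by rewrite (le_trans (cre_le_cmod _)) // cmodM ler_pM ?cmod_ge0.
  have h5 : b * d <= b * cre (dgam t * ((gam t)^-1 - 1)) by rewrite ler_pM2l.
  have h6 : 4 * a * tau * L <= b * d.
    rewrite -ler_pdivrMr // -wE; exact: le_trans bb1.
  have h7 : - (L * tau) <= cre (dgam t * (1 - gam t)^-1) by move: h4; rewrite ler_norml => /andP[].
  have h8 : - (2 * a * (L * tau)) <= 2 * a * cre (dgam t * (1 - gam t)^-1).
    by rewrite -mulrN ler_wpM2l // mulr_ge0 // ltW.
  lra.
- move=> t ti; have [g0 h1 h2 h3] := hop t ti.
  rewrite cmodM addr0; apply: ler_pM; rewrite ?cmod_ge0 //.
    by rewrite (le_trans h2) // /c; lra.
  by rewrite lerDr cmod_ge0.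
- move=> t ti; have [g0 h1 h2 h3] := hop t ti.
  rewrite /q cmodM cmodN.
  set G := cmod (errA a b (gam t)).
  have G0 : 0 <= G by exact: cmod_ge0.
  have k1 : cmod (cofR a * (cofR a + 1) * (1 - gam t)^-1 ^+ 2 * errA a b (gam t)) <= a * (a + 1) * tau ^+ 2 * G.
    rewrite cmodM cmodM cmodM cmodX -cofR1 -cofRD !cmod_ofR !ger0_norm ?addr_ge0 ?(ltW a0) //.
    by rewrite ler_wpM2r // ler_wpM2l // lerXn2r ?nnegrE ?cmod_ge0.
  have k2 : cmod (cofR b^-1 ^+ 2 * rho1 a (1 - gam t)^-1) <= b^-1 ^+ 2 * M.
    by rewrite cmodM -cofRX cmod_ofR ger0_norm ?sqr_ge0 // ler_wpM2l ?sqr_ge0 // hM.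
  apply: (@le_trans _ _ (L * (a * (a + 1) * tau ^+ 2 * G + b^-1 ^+ 2 * M))).
    by rewrite ler_pM ?cmod_ge0 // (le_trans (cmodD _ _)) // lerD.
  have s0 : 0 <= b^-1 ^+ 2 by rewrite sqr_ge0.
  have -> : L * (a * (a + 1) * tau ^+ 2 * G + b^-1 ^+ 2 * M) =
     (L * (a * (a + 1) * tau ^+ 2)) * G + (L * M) * b^-1 ^+ 2 by ring.
  rewrite [X in _ <= X]mulrDr; apply: lerD; rewrite ler_wpM2r // /c; lra.
rewrite expr0n /= addr0 -/(energyA b (gam t0)) => H1 H2.
set E0 := energyA b (gam t0) in H1 H2 *.
have E00 : 0 <= E0 by rewrite addr_ge0 ?csq_ge0 // mulr_ge0 ?csq_ge0 // invr_ge0 ltW.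
have e6 : (b^-1 ^+ 2 / b) ^+ 2 = b ^- 6 by rewrite -exprSr -exprM exprVn.
rewrite e6 in H1.
have B0 : 0 <= b ^- 6 by rewrite invr_ge0 exprn_ge0 // ltW.
have hb3 : K / b ^+ 2 * (E0 + (b^-1 ^+ 2) ^+ 2) / b <= K * (E0 + b ^- 6).
  have -> : K / b ^+ 2 * (E0 + (b^-1 ^+ 2) ^+ 2) / b = K * (b ^- 3 * E0 + b^-1 * b ^- 6).
    by field; rewrite gt_eqF.
  rewrite ler_wpM2l ?(ltW K0) // lerD // ler_piMl //.
    by rewrite invf_le1 ?exprn_gt0 // exprn_ege1.
  by rewrite invf_le1.
have hd : csq (derrA a b (gam t1)) / b <= csq (derrA a b (gam t0)) / b + K * (E0 + b ^- 6).
  apply: le_trans (_ : (csq (derrA a b (gam t0)) + K / b ^+ 2 * (E0 + (b^-1 ^+ 2) ^+ 2)) / b <= _).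
    by rewrite ler_wpM2r.
  by rewrite mulrDl lerD2l.
have hd0 : csq (derrA a b (gam t0)) / b <= E0 by rewrite /E0 /energyA lerDr csq_ge0.
rewrite {1}/energyA; apply: le_trans (lerD H1 hd) _.
apply: le_trans (_ : K * (E0 + b ^- 6) + (E0 + K * (E0 + b ^- 6)) <= _).
  by rewrite lerD2l lerD2r.
have k0 : 0 <= K * (E0 + b ^- 6) by apply: mulr_ge0; [exact: ltW|exact: addr_ge0].
have X0 : E0 <= E0 + b ^- 6 by rewrite lerDl.
have -> : (3 * K + 2) * (E0 + b ^- 6) = K * (E0 + b ^- 6) + (E0 + K * (E0 + b ^- 6)) +
  (K * (E0 + b ^- 6) + b ^- 6 + (E0 + b ^- 6)) by ring.
rewrite lerDl; apply: addr_ge0; first exact: addr_ge0.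
exact: addr_ge0.
Qed.

End PartAPath.

Section CompactSets.
Variable R : realType.
Local Notation C := (Cplx R).

Lemma nbhs_cmod (z : C) (d : R) : 0 < d -> \forall w \near z, cmod (w - z) < d.
Proof.
move=> d0; have d0' : 0 < (cofR d : C) by rewrite -cofR0 cofR_lt.
have := @cvgrPdist_lt _ _ _ (nbhs z) _ id z => -[/(_ (@cvg_id _ (nbhs z))) /(_ _ d0') h _].
by apply: filterS h => w /=; rewrite -cofR_lt -normE distrC.
Qed.

Lemma compact_uniform (K : set C) (P : R -> C -> Prop) : compact K ->
  (forall e e' w, 0 < e' <= e -> P e w -> P e' w) ->
  (forall z, K z -> exists e d : R, [/\ 0 < e, 0 < d & forall w, cmod (w - z) < d -> P e w]) ->
  exists2 e : R, 0 < e & forall w, K w -> P e w.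
Proof.
move=> /compact_near_coveringP cK hmono hloc.
have : \forall e \near 0^'+, K `<=` P e.
  apply: cK => z Kz; have [e [d [e0 d0 H]]] := hloc z Kz.
  near=> w e' => /=; apply: (hmono e).
    by apply/andP; split; near: e'; [exact: nbhs_right_gt|exact: nbhs_right_le].
  by apply: H; near: w; exact: nbhs_cmod.
move=> hn; near (0 : R)^'+ => e.
exists e; first by near: e; exact: nbhs_right_gt.
suff : K `<=` P e by exact.
by near: e; exact: hn.
Unshelve. all: by end_near. Qed.

Lemma cre_near (z w : C) d : cmod (w - z) < d -> `|cre w - cre z| < d.
Proof. by rewrite -creB; apply: le_lt_trans; exact: cre_le_cmod. Qed.

Lemma ln_csq (z : C) : z != 0 -> 2^-1 * ln (csq z) = ln (cmod z).
Proof.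
move=> z0; rewrite -cmod_sqr lnXn ?cmod_gt0 //.
by rewrite -[ln _ *+ 2]mulr_natl mulKf // pnatr_eq0.
Qed.

Definition phase (z : C) : R := cre z - 2^-1 * ln (csq z).

Lemma phase_near (z : C) (e : R) : z != 0 -> 0 < e -> exists2 d : R, 0 < d &
  forall w, cmod (w - z) < d -> `|phase w - phase z| < e.
Proof.
move=> z0 e0; have r0 : 0 < cmod z by rewrite cmod_gt0.
have e2 : 0 < e / 2 by rewrite divr_gt0.
have /cvgrPdist_lt /(_ _ e2) := continuous_ln r0.
move=> /nbhs_normP[d1 /= d10 hd1].
pose d := Num.min (e / 2) (Num.min d1 (cmod z)).
have d0 : 0 < d by rewrite !lt_min e2 d10 r0.
exists d => // w hw.
have hwz : `|cmod z - cmod w| <= cmod (w - z).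
  rewrite ler_norml; apply/andP; split.
    by rewrite lerNl opprB lerBlDr (le_trans _ (cmodD _ _)) // subrK.
  by rewrite lerBlDr -(cmodN (w - z)) opprB (le_trans _ (cmodD _ _)) // subrK.
have w0 : w != 0.
  apply: contraTneq hw => ->; rewrite sub0r cmodN -leNgt.
  by rewrite /d !ge_min lexx !orbT.
have h1 : `|ln (cmod z) - ln (cmod w)| < e / 2.
  apply: hd1 => /=; apply: le_lt_trans hwz _; apply: lt_le_trans hw _.
  by rewrite /d !ge_min lexx !orbT.
have h2 : `|cre w - cre z| < e / 2.
  by apply: cre_near; apply: lt_le_trans hw _; rewrite /d ge_min lexx.
rewrite /phase !ln_csq //.
have -> : cre w - ln (cmod w) - (cre z - ln (cmod z)) = (cre w - cre z) + (ln (cmod z) - ln (cmod w)) by ring.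
by apply: le_lt_trans (ler_normD _ _) _; rewrite [e]splitr ltrD.
Qed.

End CompactSets.

Section ModulusCurves.
Variable R : realType.
Local Notation C := (Cplx R).
Variables (l al X sg : R).
Hypothesis sg2 : sg ^+ 2 = 1.

(* The curve [|z| = exp (l - al (X - x))], [x = Re z], along which the phase has slope [1 - al]. *)
Definition mc_sq (x : R) : R := expR (2 * (l - al * (X - x))).
Definition mc_im2 (x : R) : R := mc_sq x - x ^+ 2.
Definition mcurve (x : R) : C := (x +i* (sg * Num.sqrt (mc_im2 x)))%C : R[i].
Definition dmcurve (x : R) : C :=
  (1 +i* (sg * ((al * mc_sq x - x) / Num.sqrt (mc_im2 x))))%C : R[i].

Lemma cre_mcurve x : cre (mcurve x) = x. Proof. by []. Qed.
Lemma cim_mcurve x : cim (mcurve x) = sg * Num.sqrt (mc_im2 x). Proof. by []. Qed.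

Lemma csq_mcurve x : 0 <= mc_im2 x -> csq (mcurve x) = mc_sq x.
Proof.
by move=> h; rewrite /csq cre_mcurve cim_mcurve exprMn sg2 mul1r sqr_sqrtr // /mc_im2 addrC subrK.
Qed.

Lemma cder_mcurve (x : R) : 0 < mc_im2 x -> cder mcurve x (dmcurve x).
Proof.
move=> h.
have h1 : is_derive x 1 (fun y : R => 2 * (l - al * (X - y))) (2 * al).
  apply: (isd_eq (isdZ 2 (isdB (isd_cst l x) (isdZ al (isdB (isd_cst X x) (isd_id x)))))); ring.
have h2 : is_derive x 1 mc_im2 (2 * al * mc_sq x - 2 * x).
  by apply: (isd_eq (isdB (isd_exp h1) (isdX 2 (isd_id x)))); rewrite /mc_sq /=; ring.
split; first exact: isd_id.
apply: (isd_eq (isdZ sg (isd_sqrt h h2))) => /=.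
by rewrite /cim /=; field; rewrite gt_eqF // sqrtr_gt0.
Qed.

Lemma cre_dmcurve_div x : 0 < mc_im2 x -> cre (dmcurve x * (mcurve x)^-1) = al.
Proof.
move=> h; have s0 : 0 < Num.sqrt (mc_im2 x) by rewrite sqrtr_gt0.
have q0 : 0 < mc_sq x by exact: expR_gt0.
have := csq_mcurve (ltW h); rewrite {1}/csq => e.
rewrite creM creV cimV e cre_mcurve cim_mcurve /cre /cim /=.
have -> : 1 * (x / mc_sq x) - sg * ((al * mc_sq x - x) / Num.sqrt (mc_im2 x)) *
    - (sg * Num.sqrt (mc_im2 x) / mc_sq x) = (x + sg ^+ 2 * (al * mc_sq x - x)) / mc_sq x.
  by field; rewrite !gt_eqF.
by rewrite sg2 mul1r addrC subrK mulfK // gt_eqF.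
Qed.

Lemma cmod_dmcurve_le x (ym B : R) : 0 < ym -> ym ^+ 2 <= mc_im2 x -> `|al * mc_sq x - x| <= B ->
  cmod (dmcurve x) <= 1 + B / ym.
Proof.
move=> y0 hy hB; apply: (le_trans (cmod_le_reim _)); rewrite /cre /cim /= normr1 lerD2l.
have s1 : `|sg| = 1.
  by have := congr1 Num.sqrt sg2; rewrite sqrtr_sqr sqrtr1.
have ys : ym <= Num.sqrt (mc_im2 x).
  by rewrite -[ym]ger0_norm ?(ltW y0) // -sqrtr_sqr ler_sqrt // (le_trans _ hy) // sqr_ge0.
rewrite normrM s1 mul1r normrM normfV (ger0_norm (sqrtr_ge0 _)) ler_pM ?invr_ge0 ?sqrtr_ge0 //.
by rewrite lef_pV2 ?posrE ?(lt_le_trans y0).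
Qed.

Lemma mcurve_end (z : C) : z != 0 -> cre z = X -> l = 2^-1 * ln (csq z) ->
  sg * `|cim z| = cim z -> mcurve X = z.
Proof.
move=> z0 hX hl hs; apply: cplxP; first by rewrite cre_mcurve.
rewrite cim_mcurve /mc_im2 /mc_sq subrr mulr0 subr0 hl mulrA mulfV // mul1r lnK ?posrE ?csq_gt0 //.
by rewrite -hX /csq addrAC subrr add0r sqrtr_sqr.
Qed.

Lemma mc_sq_le x : 0 <= al -> x <= X -> mc_sq x <= mc_sq X.
Proof.
move=> al0 xX; rewrite ler_expR ler_pM2l // lerD2l lerN2 ler_wpM2l // subrr subr_ge0 //.
Qed.

End ModulusCurves.

Definition sgn_im (R : realType) (z : Cplx R) : R := if 0 <= cim z then 1 else -1.
Lemma sgn_im2 (R : realType) (z : Cplx R) : sgn_im z ^+ 2 = 1.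
Proof. by rewrite /sgn_im; case: ifP; rewrite ?sqrrN expr1n. Qed.
Lemma sgn_imK (R : realType) (z : Cplx R) : sgn_im z * `|cim z| = cim z.
Proof.
rewrite /sgn_im; case: ifPn => h; first by rewrite mul1r ger0_norm.
by rewrite ltr0_norm ?ltNge // mulN1r opprK.
Qed.

Section PartAFinal.
Variable R : realType.
Local Notation C := (Cplx R).
Variables (a : R).
Hypotheses (a0 : 0 < a).

Lemma partA_ray (d Rr : R) : 0 < d <= 1 -> 0 <= Rr ->
  exists K b1 : R, [/\ 0 < K, a <= b1, 1 <= b1 & forall (b : R) (xi : C), b1 <= b ->
  cre xi <= 1 - d -> cmod xi <= Rr -> energyA a b xi <= K * b ^- 6].
Proof.
move=> /andP[d0 d1] Rr0.
have dV0 : 0 <= d^-1 by rewrite invr_ge0 ltW.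
have [K [b1 [K0 ab1 b11 H]]] := partA_path a0 Rr0 dV0 d0 ler01.
exists K, b1; split=> // b xi bb hx hR.
have ab : a <= b by exact: le_trans bb.
have b1' : 1 <= b by exact: le_trans bb.
have B0 : 0 <= b ^- 6 by rewrite invr_ge0 exprn_ge0 // (le_trans _ b1').
have E0 : energyA a b 0 = 0.
  by rewrite /energyA errA_at0 // derrA_at0 // /csq cre0 cim0 expr0n /= addr0 mul0r addr0.
have [->|x0] := eqVneq xi 0; first by rewrite E0 mulr_ge0 // ltW.
have hre t : 0 <= t <= 1 -> d <= cre (1 - cofR t * xi).
  move=> /andP[t0 t1]; rewrite creD creN creZ cre1.
  have [h|h] := leP 0 (cre xi).
    have : t * cre xi <= cre xi by rewrite ler_piMl.
    lra.
  have : t * cre xi <= 0 by rewrite mulr_ge0_le0 // ltW.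
  lra.
have := H b (fun t => cofR t * xi) (fun _ => xi) 0 1 bb.
rewrite mul0r E0 !add0r mul1r; apply.
- by rewrite ler01 lexx.
- move=> t tt; split; last by left; exact: lt_le_trans (hre t tt).
  by apply: (cder_eq (cderM (cder_ofR (isd_id t)) (cder_cst xi t))); rewrite cofR1; ring.
move=> t /andP[t0 t1]; have tt : 0 <= t <= 1 by rewrite !ltW.
have ct0 : cofR t != 0 :> C by rewrite cofR_eq0 gt_eqF.
split=> //.
- by rewrite mulf_neq0.
- rewrite cmodV lef_pV2 ?posrE //.
    by apply: le_trans (hre t tt) _; apply: le_trans (ler_norm _) (cre_le_cmod _).
  by apply: lt_le_trans d0 _; apply: le_trans (hre t tt) _; apply: le_trans (ler_norm _) (cre_le_cmod _).
- have -> : xi * ((cofR t * xi)^-1 - 1) = cofR t^-1 - xi.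
    by rewrite cofRV; field; rewrite x0 ct0.
  rewrite creB cre_ofR.
  have : 1 <= t^-1 by rewrite invf_ge1 // ltW.
  lra.
Qed.

Lemma partA_curve (eta Rr : R) : 0 < eta <= 1 -> 1 <= Rr ->
  exists K b1 : R, [/\ 0 < K, a <= b1, 1 <= b1 & forall (b : R) (xi : C), b1 <= b ->
  2^-1 <= cre xi -> phase xi <= 1 - eta -> cmod xi <= Rr -> energyA a b xi <= K * b ^- 6].
Proof.
move=> /andP[eta0 eta1] Rr1.
have Rr0 : 0 < Rr by exact: lt_le_trans Rr1.
pose dc := eta / (2 * Rr).
have dc0 : 0 < dc by rewrite divr_gt0 // mulr_gt0.
pose ym := Num.sqrt eta / 4.
have ym0 : 0 < ym by rewrite divr_gt0 // sqrtr_gt0.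
have ym2 : ym ^+ 2 = eta / 16.
  by rewrite /ym exprMn sqr_sqrtr ?ltW // exprVn -natrX.
pose al := 1 + dc.
have al0 : 0 <= al by rewrite addr_ge0 // ltW.
pose B := al * Rr ^+ 2 + Rr.
have B0 : 0 <= B by rewrite addr_ge0 ?mulr_ge0 ?sqr_ge0 // ltW.
pose L := 1 + B / ym.
have L0 : 0 <= L by rewrite addr_ge0 // divr_ge0 // ltW.
have yV0 : 0 <= ym^-1 by rewrite invr_ge0 ltW.
have half : 0 < (2^-1 : R) <= 1 by apply/andP; split; lra.
have [K1 [b1 [K10 ab1 b11 H1]]] := partA_ray half (ltW Rr0).
have [K2 [b2 [K20 ab2 b21 H2]]] := partA_path a0 L0 yV0 dc0 (ltW Rr0).
exists (K2 * (K1 + 1)), (Num.max b1 b2); split.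
- by rewrite mulr_gt0 // addr_gt0.
- by rewrite le_max ab1.
- by rewrite le_max b11.
move=> b xi; rewrite ge_max => /andP[bb1 bb2] hx hphi hR.
have b1' : 1 <= b by exact: le_trans bb1.
have xi0 : xi != 0 by apply: cre_lower_neq0; apply: lt_le_trans hx; case/andP: half.
pose X := cre xi; pose l := 2^-1 * ln (csq xi); pose sg := sgn_im xi.
have sg2 : sg ^+ 2 = 1 by exact: sgn_im2.
pose g := mcurve l al X sg.
have gX : g X = xi by apply: mcurve_end => //; exact: sgn_imK.
have XR : X <= Rr by rewrite (le_trans _ hR) // (le_trans (ler_norm _) (cre_le_cmod _)).
have hl : X - 1 + eta <= l by move: hphi; rewrite /phase -/X -/l; lra.
have dcX : dc * X <= eta / 2.
  by rewrite /dc mulrAC ler_pdivrMr ?mulr_gt0 // mulrA divfK // ler_pM2l.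
have X4 : 4^-1 <= X.
  apply: le_trans hx; rewrite lef_pV2 ?posrE ?ltr0n // ler_nat //.
have him x : 4^-1 <= x <= X -> ym ^+ 2 <= mc_im2 l al X x.
  move=> /andP[x4 xX]; have x0 : 0 < x by apply: lt_le_trans x4; rewrite invr_gt0 ltr0n.
  have hq : x ^+ 2 * expR eta <= mc_sq l al X x.
    rewrite -{1}(lnK (x := x)) ?posrE // -expRM_natl -expRD ler_expR.
    have lnx : ln x <= x - 1.
      by have := @le_ln1Dx R (x - 1); rewrite [1 + _]addrC subrK; apply; rewrite ltrBrDl subrr.
    have dx : dc * (X - x) <= eta / 2.
      by apply: le_trans dcX; rewrite ler_pM2l // gerBl ltW.
    have : al * (X - x) = X - x + dc * (X - x) by rewrite /al; ring.
    lra.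
  have e1 : 1 + eta <= expR eta by exact: expR_ge1Dx.
  have hx2 : 16^-1 <= x ^+ 2.
    have -> : (16^-1 : R) = 4^-1 ^+ 2 by rewrite exprVn -natrX.
    by rewrite lerXn2r ?nnegrE ?invr_ge0 // ltW.
  rewrite ym2 /mc_im2 lerBrDl; apply: le_trans hq.
  apply: le_trans (_ : x ^+ 2 * (1 + eta) <= _); last by rewrite ler_wpM2l ?sqr_ge0.
  by rewrite mulrDr mulr1 lerD2l mulrC ler_wpM2r // ltW.
have him0 x : 4^-1 <= x <= X -> 0 < mc_im2 l al X x.
  by move=> /him; apply: lt_le_trans; rewrite exprn_gt0.
have hqR x : 4^-1 <= x <= X -> mc_sq l al X x <= Rr ^+ 2.
  move=> hxx; have xX : x <= X by case/andP: hxx.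
  apply: le_trans (mc_sq_le l al0 xX) _.
  have XX : 4^-1 <= X <= X by apply/andP; split.
  have := csq_mcurve sg2 (ltW (him0 X XX)); rewrite -/g gX => <-.
  by rewrite -cmod_sqr lerXn2r ?nnegrE ?cmod_ge0 // ltW.
have h4 : (4^-1 : R) <= 4^-1 <= X by apply/andP; split.
have start : energyA a b (g 4^-1) <= K1 * b ^- 6.
  apply: H1 => //.
    rewrite /g cre_mcurve; lra.
  rewrite -(@ler_pXn2r _ 2) ?nnegrE ?cmod_ge0 ?(ltW Rr0) // cmod_sqr /g csq_mcurve //.
    exact: hqR.
  exact: ltW (him0 _ h4).
have := H2 b g (dmcurve l al X sg) 4^-1 X bb2.
rewrite gX => H; apply: le_trans (H _ _ _) _.
- by apply/andP; split => //; rewrite ler_wpDl // invr_ge0.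
- move=> t tt; split; first exact: cder_mcurve (him0 t tt).
  right; rewrite cimB cim1 sub0r oppr_eq0 /g cim_mcurve mulf_neq0 //.
    by rewrite -sqrf_eq0 sg2 oner_eq0.
  by rewrite gt_eqF // sqrtr_gt0 him0.
- move=> t ti; have tt : 4^-1 <= t <= X by case/andP: ti => /ltW -> /ltW ->.
  have g0 : g t != 0.
    by apply: cre_lower_neq0; rewrite /g cre_mcurve; case/andP: tt => h _; apply: lt_le_trans h; rewrite invr_gt0 ltr0n.
  have ysq : ym <= Num.sqrt (mc_im2 l al X t).
    by rewrite -[ym]ger0_norm ?(ltW ym0) // -sqrtr_sqr ler_sqrt ?him // ltW // him0.
  have hcm : ym <= cmod (1 - g t).
    apply: le_trans (cim_le_cmod _); rewrite cimB cim1 sub0r normrN /g cim_mcurve normrM.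
    have -> : `|sg| = 1 by have := congr1 Num.sqrt sg2; rewrite sqrtr_sqr sqrtr1.
    by rewrite mul1r ger0_norm ?sqrtr_ge0.
  split=> //.
  + by rewrite cmodV lef_pV2 ?posrE // (lt_le_trans ym0).
  + apply: cmod_dmcurve_le => //; first exact: him.
    apply: le_trans (ler_normB _ _) _; apply: lerD.
      by rewrite ger0_norm ?mulr_ge0 ?expR_ge0 // ler_wpM2l // hqR.
    rewrite ger0_norm; first by case/andP: tt => _ h; exact: le_trans h XR.
    by case/andP: tt => h _; apply: le_trans h; rewrite invr_ge0.
  + rewrite mulrBr mulr1 creB /g cre_dmcurve_div //; last exact: him0.
    by rewrite /al addrAC /dmcurve /cre /= subrr add0r.
rewrite -mulrA; apply: ler_wpM2l; first exact: ltW.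
by rewrite mulrDl mul1r lerD2r.
Qed.

Lemma partA (K : set C) : compact K -> K `<=` @regA R ->
   exists (M b0 : R), forall b : R, b0 <= b -> forall xi : Cplx R, K xi ->
     let w := xi / (1 - xi) in
     let P := cpow (1 - xi) (cofR (- a)) in
     let S := 1 - cofR (a * (a + 1) / 2) * w ^+ 2 * cofR (b^-1)
              + (cofR (a * (a + 1) * (a + 2) * (a + 3) / 8) * w ^+ 4
                 + cofR (2 * a * (a + 1) * (a + 2) / 3) * w ^+ 3
                 + cofR (a * (a + 1) / 2) * w ^+ 2) * cofR (b ^- 2) in
     `|F11 a b (cofR b * xi) - P * S| <= cofR (M * b ^- 3) * `|P|.
Proof.
move=> cK KA.
pose P (e : R) (z : C) := cmod z <= e^-1 /\
  (cre z <= 1 - e \/ 2^-1 <= cre z /\ phase z <= 1 - e).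
have [e0 e00 hP] : exists2 e : R, 0 < e & forall w, K w -> P e w.
  apply: (compact_uniform cK).
    move=> e e' w /andP[e0 ee] [h1 h2]; split.
      by apply: le_trans h1 _; rewrite lef_pV2 ?posrE // (lt_le_trans e0).
    by case: h2 => [h|[h h']]; [left|right; split => //]; lra.
  move=> z /KA hz; pose m := (cmod z + 1)^-1.
  have m0 : 0 < m by rewrite invr_gt0 ltr_wpDl ?cmod_ge0.
  have hm w d : d <= 1 -> cmod (w - z) < d -> cmod w <= m^-1.
    move=> d1 hw; rewrite invrK; apply: le_trans (_ : cmod (w - z + z) <= _); first by rewrite subrK.
    by apply: le_trans (cmodD _ _) _; rewrite addrC lerD2l ltW // (lt_le_trans hw).
  have [hx|hx] := ltP (cre z) 1.
    pose e := (1 - cre z) / 2.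
    have e0 : 0 < e by rewrite divr_gt0 // subr_gt0.
    exists (Num.min m e), (Num.min e 1); split.
    - by rewrite lt_min m0.
    - by rewrite lt_min e0 ltr01.
    move=> w hw; have hwe : cmod (w - z) < e by apply: lt_le_trans hw _; rewrite ge_min lexx.
    split.
      apply: le_trans (hm w (Num.min e 1) _ hw) _; first by rewrite ge_min lexx orbT.
      by rewrite lef_pV2 ?posrE ?lt_min ?m0 // ge_min lexx.
    left; have := cre_near hwe; rewrite ltr_norml => /andP[_ h].
    have : Num.min m e <= e by rewrite ge_min lexx orbT.
    rewrite /e in h *; lra.
  have hz' : phase z < 1.
    case: hz => h; first by move: hx; rewrite leNgt h.
    by rewrite /phase /csq; lra.
  have z0 : z != 0 by apply: cre_lower_neq0; apply: lt_le_trans hx.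
  pose e := (1 - phase z) / 2.
  have e0 : 0 < e by rewrite divr_gt0 // subr_gt0.
  have [d d0 hd] := phase_near z0 e0.
  have half0 : 0 < 2^-1 :> R by rewrite invr_gt0.
  exists (Num.min m e), (Num.min d 2^-1); split.
  - by rewrite lt_min m0.
  - by rewrite lt_min d0.
  move=> w hw; have hwd : cmod (w - z) < d by apply: lt_le_trans hw _; rewrite ge_min lexx.
  have hw2 : cmod (w - z) < 2^-1 by apply: lt_le_trans hw _; rewrite ge_min lexx orbT.
  split.
    apply: le_trans (hm w 2^-1 _ hw2) _; first by rewrite invf_le1 // ler1n.
    by rewrite lef_pV2 ?posrE ?lt_min ?m0 // ge_min lexx.
  right; split.
    by have := cre_near hw2; rewrite ltr_norml => /andP[h _]; lra.
  have := hd w hwd; rewrite ltr_norml => /andP[_ h].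
  have : Num.min m e <= e by rewrite ge_min lexx orbT.
  rewrite /e in h *; lra.
pose e := Num.min e0 1.
have e1 : 0 < e <= 1 by rewrite lt_min e00 ltr01 /= ge_min lexx orbT.
have ee0 : e <= e0 by rewrite ge_min lexx.
pose Rr := e^-1.
have Rr1 : 1 <= Rr by rewrite invf_ge1; case/andP: e1.
have [K1 [b1 [K10 ab1 b11 H1]]] := partA_ray e1 (le_trans ler01 Rr1).
have [K2 [b2 [K20 ab2 b21 H2]]] := partA_curve e1 Rr1.
exists (Num.sqrt (K1 + K2)), (Num.max b1 b2) => b.
rewrite ge_max => /andP[bb1 bb2] xi Kxi; cbv zeta.
have ab : a <= b by exact: le_trans bb1.
have b1' : 1 <= b by exact: le_trans bb1.
have b0 : 0 < b by exact: lt_le_trans b1'.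
have B0 : 0 <= b ^- 6 by rewrite invr_ge0 exprn_ge0 // ltW.
have [hR hreg] := hP xi Kxi.
have hR' : cmod xi <= Rr.
  by apply: le_trans hR _; rewrite lef_pV2 ?posrE //; case/andP: e1.
have n0 : 1 - xi != 0.
  rewrite subr_eq0; apply/eqP => e1xi.
  have c1 : cre xi = 1 by rewrite -e1xi.
  have c2 : cim xi = 0 by rewrite -e1xi.
  by case: (KA _ Kxi); rewrite c1 ?c2 ?expr1n ?expr0n /= ?addr0 ?ln1; lra.
have hE : energyA a b xi <= (K1 + K2) * b ^- 6.
  case: hreg => [h|[h h']].
    apply: le_trans (H1 b xi bb1 _ hR') _; first by lra.
    by rewrite ler_wpM2r // lerDl ltW.
  apply: le_trans (H2 b xi bb2 h _ hR') _; first by lra.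
  by rewrite ler_wpM2r // lerDr ltW.
have hg : cmod (errA a b xi) <= Num.sqrt (K1 + K2) * b ^- 3.
  have K120 : 0 <= K1 + K2 by rewrite addr_ge0 // ltW.
  have B3 : 0 <= b ^- 3 by rewrite invr_ge0 exprn_ge0 // ltW.
  rewrite -(@ler_pXn2r _ 2) ?nnegrE ?cmod_ge0 ?mulr_ge0 ?sqrtr_ge0 //.
  rewrite cmod_sqr exprMn sqr_sqrtr // exprVn -exprM.
  apply: le_trans hE; rewrite /energyA lerDl mulr_ge0 ?csq_ge0 // invr_ge0.
  exact: ltW.
have := @errAE R a b xi n0; cbv zeta => ->.
by rewrite !normE -cofRM cofR_le cmodM mulrC ler_wpM2r ?cmod_ge0.
Qed.

End PartAFinal.

(** * The Gamma function and Stirling's formula *)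

Section PositiveHalfLine.
Variable R : realType.
Local Notation mu := (@lebesgue_measure R).
Local Notation pos := (`]0%R, +oo[%classic : set R).
Implicit Types f g : R -> R.

Definition cont_pos f := forall t : R, 0 < t -> {for t, continuous f}.

Lemma cont_pos_within f (p q : R) : 0 < p -> cont_pos f -> {within `[p, q], continuous f}.
Proof.
move=> p0 cf; apply: continuous_in_subspaceT => x; rewrite inE /= in_itv /= => /andP[px _].
by apply: cf; exact: lt_le_trans px.
Qed.

Lemma cont_pos_integrable f (p q : R) : 0 < p -> cont_pos f -> mu.-integrable `[p, q] (EFin \o f).
Proof.
move=> p0 cf; apply: continuous_compact_integrable; first exact: segment_compact.
exact: cont_pos_within.
Qed.

Lemma cont_pos_measurable f : cont_pos f -> measurable_fun pos f.
Proof.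
move=> cf; apply: open_continuous_measurable_fun; first exact: interval_open.
by move=> x; rewrite inE /= in_itv /= andbT => x0; exact: cf.
Qed.

Lemma pos_bigcup (p q : nat -> R) : (forall n, 0 < p n) -> p @ \oo --> (0 : R) -> q @ \oo --> +oo ->
  \bigcup_n (`[p n, q n]%classic : set R) = pos.
Proof.
move=> p0 cp cq; apply/seteqP; split=> x /=.
  by move=> [n _] /=; rewrite !in_itv /= andbT => /andP[px _]; exact: lt_le_trans px.
rewrite in_itv /= andbT => x0.
have h1 : \forall n \near \oo, p n <= x by apply: cvgr_le cp _ x0.
have h2 : \forall n \near \oo, x <= q n by move/cvgryPge: cq; apply.
near \oo => n; exists n => //=; rewrite in_itv /=; apply/andP; split; near: n => //.
Unshelve. all: by end_near. Qed.

Lemma integral_pos_cvg f (p q : nat -> R) : (forall n, 0 < p n) ->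
  (forall n m, (n <= m)%N -> p m <= p n) -> (forall n m, (n <= m)%N -> q n <= q m) ->
  p @ \oo --> (0 : R) -> q @ \oo --> +oo -> cont_pos f -> (forall t, 0 < t -> 0 <= f t) ->
  (fun n => \int[mu]_(t in `[p n, q n]) (f t)%:E)%E @ \oo --> (\int[mu]_(t in pos) (f t)%:E)%E.
Proof.
move=> p0 pd qi cp cq cf f0; rewrite -(pos_bigcup p0 cp cq).
apply: ge0_nondecreasing_set_cvg_integral.
- move=> n m nm; rewrite subsetEset => x /=; rewrite !in_itv /= => /andP[h1 h2].
  by rewrite (le_trans (pd _ _ nm)) // (le_trans h2) // qi.
- by move=> n; exact: measurable_itv.
- move=> n; apply/measurable_EFinP; apply: measurable_funS (cont_pos_measurable cf) => //.
  by move=> x /=; rewrite !in_itv /= andbT => /andP[h1 _]; exact: lt_le_trans h1.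
- by move=> n x /=; rewrite in_itv /= => /andP[h1 _]; rewrite lee_fin f0 // (lt_le_trans _ h1).
Qed.

Lemma FTC_pos f (F : R -> R) (p q : R) : 0 < p < q -> cont_pos f ->
  (forall t : R, 0 < t -> is_derive t 1 F (f t)) ->
  (\int[mu]_(t in `[p, q]) (f t)%:E = (F q - F p)%:E)%E.
Proof.
move=> /andP[p0 pq] cf dF; rewrite (@continuous_FTC2 R f F p q pq) ?EFinB //.
- exact: cont_pos_within.
- split.
  + by move=> x; rewrite in_itv /= => /andP[px _]; have h := dF x (lt_trans p0 px); exact: ex_derive.
  + by apply: cvg_at_right_filter; exact: isd_continuous (dF p p0).
  + by apply: cvg_at_left_filter; exact: isd_continuous (dF q (lt_trans p0 pq)).
- move=> x; rewrite in_itv /= => /andP[px _]; rewrite derive1E.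
  by have := dF x (lt_trans p0 px) => h; rewrite (@derive_val _ _ _ _ _ _ _ h).
Qed.

Definition pk (n : nat) : R := n.+2%:R^-1.
Definition qk (n : nat) : R := n.+2%:R.

Lemma pk_gt0 n : 0 < pk n. Proof. by rewrite invr_gt0. Qed.
Lemma pk_lt_qk n : pk n < qk n.
Proof.
rewrite /pk /qk (@lt_trans _ _ 1) ?ltr1n // invf_lt1 ?ltr0n // ltr1n //.
Qed.
Lemma pk_decr n m : (n <= m)%N -> pk m <= pk n.
Proof. by move=> nm; rewrite lef_pV2 ?posrE ?ltr0n // ler_nat !ltnS. Qed.
Lemma qk_incr n m : (n <= m)%N -> qk n <= qk m.
Proof. by move=> nm; rewrite ler_nat !ltnS. Qed.
Lemma qk_cvg : qk @ \oo --> +oo.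
Proof.
apply/cvgryPge => A; near=> n; apply: (@le_trans _ _ n%:R); last by rewrite ler_nat leqW.
by near: n; exact: nbhs_infty_ger.
Unshelve. all: by end_near. Qed.
Lemma pk_cvg : pk @ \oo --> (0 : R).
Proof.
apply/cvgrPdist_lt => e e0; near=> n; rewrite sub0r normrN ger0_norm ?ltW ?pk_gt0 //.
rewrite /pk -[e]invrK ltf_pV2 ?posrE ?invr_gt0 ?ltr0n //.
apply: (@lt_le_trans _ _ n%:R); last by rewrite ler_nat leqW.
by near: n; exact: nbhs_infty_gtr.
Unshelve. all: by end_near. Qed.

End PositiveHalfLine.

Section GammaFunction.
Variable R : realType.
Local Notation mu := (@lebesgue_measure R).
Local Notation pos := (`]0%R, +oo[%classic : set R).
Implicit Types x p t : R.

Definition gker x t : R := t `^ (x - 1) * expR (- t).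
Definition egam x : \bar R := (\int[mu]_(t in pos) (gker x t)%:E)%E.

Lemma gker_gt0 x t : 0 < t -> 0 < gker x t.
Proof. by move=> t0; rewrite mulr_gt0 ?expR_gt0 ?powR_gt0. Qed.

Lemma isd_expN t : is_derive t 1 (fun t : R => expR (- t)) (- expR (- t)).
Proof. by apply: (isd_eq (isd_exp (isdN (isd_id t)))); rewrite mulrN1. Qed.

Lemma isd_gker x t : 0 < t -> is_derive t 1 (gker x) ((x - 1) * gker (x - 1) t - gker x t).
Proof.
move=> t0; apply: (isd_eq (isdM (is_derive1_powR (x - 1) t0) (isd_expN t))).
by rewrite /gker; ring.
Qed.

Lemma gker_cont x : cont_pos (gker x).
Proof. by move=> t t0; exact: isd_continuous (isd_gker x t0). Qed.

Lemma gkerM x t : 0 < t -> t * gker x t = gker (x + 1) t.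
Proof.
move=> t0; have tn : t != 0 by rewrite gt_eqF.
rewrite /gker mulrA; congr (_ * _).
have -> : x + 1 - 1 = 1 + (x - 1) by ring.
by rewrite [RHS]powRD ?tn ?implybT // powRr1 // ltW.
Qed.

Lemma gker_int_seg x (p q : R) : 0 < p -> (\int[mu]_(t in `[p, q]) (gker x t)%:E)%E \is a fin_num.
Proof. by move=> p0; apply: integrable_fin_num => //; exact: cont_pos_integrable p0 (gker_cont (x := x)). Qed.

Lemma egam_cvg x : (fun n => \int[mu]_(t in `[pk R n, qk R n]) (gker x t)%:E)%E @ \oo --> egam x.
Proof.
apply: integral_pos_cvg; [exact: pk_gt0|exact: pk_decr|exact: qk_incr|exact: pk_cvg|exact: qk_cvg|exact: gker_cont|].
by move=> t t0; exact: ltW (gker_gt0 _ t0).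
Qed.

Lemma egam_ge0 x : (0 <= egam x)%E.
Proof.
apply: integral_ge0 => t /=; rewrite in_itv /= andbT => t0.
by rewrite lee_fin ltW // gker_gt0.
Qed.

Lemma gker_le_inv x t : 0 < t -> 1 <= x -> exists2 C : R, 0 < C & forall t, 1 <= t -> gker x t <= C / t.
Proof.
move=> _ x1; pose n := (Num.trunc x).+1.
have xn : x <= n%:R by rewrite ltW // truncnS_gt.
exists ((n`!)%:R); first by rewrite ltr0n fact_gt0.
move=> s s1; have s0 : 0 < s by exact: lt_le_trans s1.
rewrite /gker expRN ler_pdivrMr ?expR_gt0 // mulrAC ler_pdivlMr //.
have h : s ^+ n <= (n`!)%:R * expR s.
  have := expR_ge1Dxn n.-1 (ltW s0); rewrite prednK // => h.
  have h' : s ^+ n / (n`!)%:R <= expR s by apply: le_trans h; rewrite lerDr.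
  by rewrite mulrC -ler_pdivrMr // ltr0n fact_gt0.
apply: le_trans h; rewrite mulrC mulr_powRB1 ?(ltW s0) // ?(lt_le_trans _ x1) //.
by rewrite -powR_mulrn ?(ltW s0) // ler_powR.
Qed.

Lemma gker_cvgy x : 1 <= x -> (fun n => gker x (qk R n)) @ \oo --> (0 : R).
Proof.
move=> x1; have [C C0 HC] := gker_le_inv ltr01 x1.
have h : (fun n => C * pk R n) @ \oo --> (0 : R).
  by rewrite -(mulr0 C); apply: cvgM; [exact: cvg_cst|exact: pk_cvg].
apply: (squeeze_cvgr _ (cvg_cst 0) h); apply: nearW => n.
by rewrite ltW ?gker_gt0 ?ltr0n //=; apply: HC; rewrite ler1n.
Qed.

Lemma gker_cvg0 x : 1 < x -> (fun n => gker x (pk R n)) @ \oo --> (0 : R).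
Proof.
move=> x1.
have h : (fun n => pk R n `^ (x - 1)) @ \oo --> (0 : R).
  have x1' : 0 < x - 1 by rewrite subr_gt0.
  have /cvg_at_rightP := powR_cvg0 x1'; apply.
  by split; [exact: pk_gt0|exact: pk_cvg].
apply: (squeeze_cvgr _ (cvg_cst 0) h); apply: nearW => n.
by rewrite ltW ?gker_gt0 ?pk_gt0 //= /gker ler_piMr ?powR_ge0 // expR_le1 oppr_le0 ltW // pk_gt0.
Qed.

Lemma egam_rec x : 0 < x -> egam (x + 1) = (x%:E * egam x)%E.
Proof.
move=> x0.
pose u n := fine (\int[mu]_(t in `[pk R n, qk R n]) (gker (x + 1) t)%:E)%E.
pose w n := fine (\int[mu]_(t in `[pk R n, qk R n]) (gker x t)%:E)%E.
have uE n : (\int[mu]_(t in `[pk R n, qk R n]) (gker (x + 1) t)%:E)%E = (u n)%:E.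
  by rewrite /u fineK // gker_int_seg // pk_gt0.
have wE n : (\int[mu]_(t in `[pk R n, qk R n]) (gker x t)%:E)%E = (w n)%:E.
  by rewrite /w fineK // gker_int_seg // pk_gt0.
have rel n : u n = x * w n - (gker (x + 1) (qk R n) - gker (x + 1) (pk R n)).
  have hF : (\int[mu]_(t in `[pk R n, qk R n]) (x * gker x t - gker (x + 1) t)%:E =
     (gker (x + 1) (qk R n) - gker (x + 1) (pk R n))%:E)%E.
    apply: (@FTC_pos R (fun t => x * gker x t - gker (x + 1) t) (gker (x + 1))).
    - by rewrite pk_gt0 pk_lt_qk.
    - move=> t t0; apply: continuousB; last exact: gker_cont.
      by apply: continuousM; [exact: cst_continuous|exact: gker_cont].
    - move=> t t0; apply: (isd_eq (isd_gker (x + 1) t0)); congr (_ * gker _ _ - _); ring.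
  have i1 := cont_pos_integrable (qk R n) (pk_gt0 R n) (gker_cont (x := x)).
  have i2 := cont_pos_integrable (qk R n) (pk_gt0 R n) (gker_cont (x := x + 1)).
  have i1' : mu.-integrable `[pk R n, qk R n] (fun t => (x%:E * (gker x t)%:E)%E).
    exact: integrableZl.
  have : (\int[mu]_(t in `[pk R n, qk R n]) ((x%:E * (gker x t)%:E) - (gker (x + 1) t)%:E) =
      (x * w n - u n)%:E)%E.
    rewrite integralB; [|exact: measurable_itv|exact: i1'|exact: i2].
    by rewrite integralZl // wE uE -EFinM -EFinB.
  under eq_integral do rewrite -EFinM -EFinB.
  by rewrite hF => -[->]; ring.
have cu : (fun n => (u n)%:E) @ \oo --> egam (x + 1).
  by have := egam_cvg (x := x + 1); under eq_fun do rewrite uE.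
have cw : (fun n => (w n)%:E) @ \oo --> egam x.
  by have := egam_cvg (x := x); under eq_fun do rewrite wE.
have cd : (fun n => (- (gker (x + 1) (qk R n) - gker (x + 1) (pk R n)))%:E) @ \oo --> 0%:E.
  apply: cvg_EFin; first exact: nearW.
  have : (fun n => - (gker (x + 1) (qk R n) - gker (x + 1) (pk R n))) @ \oo --> - (0 - 0 : R).
    apply: cvgN; apply: cvgB; [apply: gker_cvgy|apply: gker_cvg0]; lra.
  by rewrite subr0 oppr0.
have cu' : (fun n => (u n)%:E) @ \oo --> (x%:E * egam x + 0%:E)%E.
  under eq_fun do rewrite rel EFinD EFinM.
  apply: cvgeD; [by rewrite fin_num_adde_defl|exact: cvgeZl|exact: cd].
by rewrite (cvg_unique _ cu cu') // adde0.
Qed.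

Lemma egam1 : egam 1 = 1%E.
Proof.
have h n : (\int[mu]_(t in `[pk R n, qk R n]) (gker 1 t)%:E = (- gker 1 (qk R n) + expR (- pk R n))%:E)%E.
  have E t : 0 < t -> gker 1 t = expR (- t) by move=> t0; rewrite /gker subrr powRr0 mul1r.
  have dF (t : R) : 0 < t -> is_derive t 1 (fun t => - expR (- t)) (gker 1 t).
    by move=> t0; apply: (isd_eq (isdN (isd_expN t))); rewrite opprK E.
  have pq : 0 < pk R n < qk R n by rewrite pk_gt0 pk_lt_qk.
  have h := FTC_pos pq (gker_cont (x := 1)) dF.
  by rewrite h opprK E // (lt_trans (pk_gt0 _ n)) // pk_lt_qk.
have := egam_cvg (x := 1); under eq_fun do rewrite h.
move=> c; apply: (cvg_unique _ c) => //; apply: cvg_EFin; first exact: nearW.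
have : (fun n => - gker 1 (qk R n) + expR (- pk R n)) @ \oo --> (- 0 + expR (- 0) : R).
  apply: cvgD; first by apply: cvgN; exact: gker_cvgy.
  apply: (@continuous_cvg _ _ _ _ _ _ (fun t => expR (- t))); last exact: pk_cvg.
  exact: isd_continuous (isd_expN 0).
by rewrite !oppr0 expR0 add0r.
Qed.

Lemma egam_nat n : egam n.+1%:R \is a fin_num.
Proof.
elim: n => [|n IH]; first by rewrite egam1.
by rewrite -(natr1 n.+1) egam_rec // fin_numM.
Qed.

Lemma egam_fin x : 0 < x -> egam x \is a fin_num.
Proof.
suff H y : 1 <= y -> egam y \is a fin_num.
  move=> x0; have := H (x + 1); rewrite lerDr => /(_ (ltW x0)); rewrite egam_rec //.
  have := egam_ge0 x; case: (egam x) => // _; rewrite mulry gtr0_sg // mul1e //.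
move=> y1; pose n := (Num.trunc y).+1.
have yn : y <= n.+1%:R by rewrite (le_trans (ltW (truncnS_gt y))) // ler_nat.
rewrite ge0_fin_numE ?egam_ge0 //.
have f1 : (egam 1 + egam n.+1%:R < +oo)%E.
  have f0 := adde_ge0 (egam_ge0 1) (egam_ge0 n.+1%:R).
  by rewrite -(ge0_fin_numE f0) fin_numD egam1 egam_nat.
apply: le_lt_trans f1.
rewrite /egam -ge0_integralD //; last 4 first.
- by move=> t; rewrite /= in_itv /= andbT => t0; rewrite lee_fin ltW ?gker_gt0.
- by apply/measurable_EFinP; apply: cont_pos_measurable; exact: gker_cont.
- by move=> t; rewrite /= in_itv /= andbT => t0; rewrite lee_fin ltW ?gker_gt0.
- by apply/measurable_EFinP; apply: cont_pos_measurable; exact: gker_cont.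
apply: ge0_le_integral => //.
- by move=> t; rewrite /= in_itv /= andbT => t0; rewrite lee_fin ltW ?gker_gt0.
- by apply/measurable_EFinP; apply: cont_pos_measurable; exact: gker_cont.
- by apply: emeasurable_funD; apply/measurable_EFinP; apply: cont_pos_measurable; exact: gker_cont.
move=> t; rewrite /= in_itv /= andbT => t0; rewrite -EFinD lee_fin /gker -mulrDl.
rewrite ler_wpM2r ?expR_ge0 //; have [t1|t1] := leP 1 t.
  by apply: (@le_trans _ _ (t `^ (n.+1%:R - 1))); rewrite ?lerDr ?powR_ge0 // ler_powR // lerD2r.
rewrite subrr powRr0; apply: (@le_trans _ _ 1); last by rewrite lerDl powR_ge0.
have tt : 0 < t <= 1 by rewrite t0 ltW.
have y0 : 0 <= y - 1 by rewrite subr_ge0.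
by have := ger_powR tt y0; rewrite powRr0.
Qed.

Lemma gker_integrable x : 0 < x -> mu.-integrable pos (EFin \o gker x).
Proof.
move=> x0; apply/integrableP; split.
  by apply/measurable_EFinP; apply: cont_pos_measurable; exact: gker_cont.
have := egam_fin x0; rewrite ge0_fin_numE ?egam_ge0 // => h; apply: le_lt_trans h.
rewrite le_eqVlt; apply/orP; left; apply/eqP; apply: eq_integral => t.
by rewrite inE /= in_itv /= andbT => t0; rewrite /= ger0_norm // ?lee_fin ltW // gker_gt0.
Qed.

Lemma GammaE x : (Gamma x)%:E = egam x \/ ~~ (0 < x).
Proof.
have [x0|] := boolP (0 < x); [left|by right].
rewrite /Gamma /Rintegral -integral_itv_obnd_cbnd; last first.
  by apply/measurable_EFinP; apply: cont_pos_measurable; exact: gker_cont.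
by rewrite fineK // egam_fin.
Qed.

Lemma Gamma_pos_int x : 0 < x -> Gamma x = (\int[mu]_(t in pos) gker x t)%R.
Proof. by move=> x0; case: (GammaE x); rewrite ?x0 // /Rintegral -/(egam x) => <-. Qed.

Lemma GammaS x : 0 < x -> Gamma (x + 1) = x * Gamma x.
Proof.
move=> x0; have x1 : 0 < x + 1 by rewrite addr_gt0.
apply: EFin_inj; case: (GammaE (x + 1)); rewrite ?x1 // => ->.
by rewrite egam_rec // EFinM; case: (GammaE x); rewrite ?x0 // => ->.
Qed.

Lemma Gamma1 : Gamma (1 : R) = 1.
Proof. by apply: EFin_inj; case: (GammaE 1); rewrite ?ltr01 // => ->; rewrite egam1. Qed.

Lemma bernoulli_powR (y p : R) : 0 < y -> 1 <= p \/ p <= 0 -> 1 + p * (y - 1) <= y `^ p.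
Proof.
have neg (z q : R) : 0 < z -> q <= 0 -> 1 + q * (z - 1) <= z `^ q.
  move=> z0 q0; rewrite /powR gt_eqF //.
  apply: le_trans (expR_ge1Dx _); rewrite lerD2l ler_wnM2l //.
  by have := @le_ln1Dx R (z - 1); rewrite [1 + _]addrC subrK; apply; rewrite ltrBrDl subrr.
move=> y0 [p1|]; last exact: neg.
have yV0 : 0 < y^-1 by rewrite invr_gt0.
have q0 : - (p - 1) <= 0 by rewrite oppr_le0 subr_ge0.
have h := neg _ _ yV0 q0.
have e : y^-1 `^ (- (p - 1)) = y `^ (p - 1).
  by rewrite -powR_inv1 ?(ltW y0) // -powRrM mulN1r opprK.
rewrite e in h; rewrite -(mulr_powRB1 (ltW y0)) ?(lt_le_trans _ p1) //.
have -> : 1 + p * (y - 1) = y * (1 + - (p - 1) * (y^-1 - 1)) by field; rewrite gt_eqF.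
by rewrite ler_pM2l.
Qed.

(* Jensen's inequality for [t^p] under the Gamma density, by integrating a tangent line *)
Lemma Gamma_ge x p : 0 < x -> 0 < x + p -> 1 <= p \/ p <= 0 -> x `^ p * Gamma x <= Gamma (x + p).
Proof.
move=> x0 xp hp; have x1 : 0 < x + 1 by rewrite addr_gt0.
have i0 := gker_integrable x0; have i1 := gker_integrable x1; have ip := gker_integrable xp.
have iA : mu.-integrable pos (EFin \o (fun t => (x `^ p * (1 - p)) * gker x t)).
  exact: (integrableZl _ (x `^ p * (1 - p)) i0).
have iB : mu.-integrable pos (EFin \o (fun t => (x `^ p * p / x) * gker (x + 1) t)).
  exact: (integrableZl _ (x `^ p * p / x) i1).
have -> : x `^ p * Gamma x = (x `^ p * (1 - p)) * Gamma x + (x `^ p * p / x) * Gamma (x + 1).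
  by rewrite GammaS //; field; rewrite gt_eqF.
rewrite !Gamma_pos_int // -!RintegralZl // -RintegralD //.
apply: le_Rintegral => //.
  exact: (integrableD _ iA iB).
move=> t; rewrite /= in_itv /= andbT => t0.
rewrite -gkerM // mulrA -mulrDl.
have -> : gker (x + p) t = t `^ p * gker x t.
  have tn : t != 0 by rewrite gt_eqF.
  rewrite /gker mulrA; congr (_ * _).
  have -> : x + p - 1 = p + (x - 1) by ring.
  by rewrite [LHS]powRD ?tn ?implybT.
rewrite ler_wpM2r ?(ltW (gker_gt0 _ _)) //.
have tx : 0 < t / x by rewrite divr_gt0.
have := bernoulli_powR tx hp; move=> hb; have {hb} := ler_wpM2l (ltW (powR_gt0 p x0)) hb.
have -> : x `^ p * (t / x) `^ p = t `^ p.
  by rewrite -powRM ?(ltW x0) ?(ltW tx) // mulrC divfK // gt_eqF.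
by apply: le_trans; rewrite le_eqVlt; apply/orP; left; apply/eqP; field; rewrite gt_eqF.
Qed.

Lemma Gamma_gt0 x : 0 < x -> 0 < Gamma x.
Proof.
move=> x0; have x1 : 0 < x + 1 by rewrite addr_gt0.
have h := @Gamma_ge 1 x ltr01; rewrite powR1 Gamma1 mulr1 in h.
suff : 0 < Gamma (x + 1) by rewrite GammaS // pmulr_rgt0.
have h2 := @Gamma_ge 1 (x + 1) ltr01.
have : 0 < Gamma (x + 1 + 1).
  apply: lt_le_trans ltr01 _; have := h2 _ _; rewrite powR1 Gamma1 mulr1 addrC; apply; first by lra.
  by left; lra.
by rewrite GammaS // pmulr_rgt0.
Qed.

Lemma Gamma_half : Gamma (2^-1 : R) = Num.sqrt pi.
Proof.
have h0 : 0 < 2^-1 :> R by rewrite invr_gt0.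
pose p n := pk R n ^+ 2; pose q n := qk R n ^+ 2.
have c1 : (fun n => \int[mu]_(t in `[p n, q n]) (gker 2^-1 t)%:E)%E @ \oo --> egam 2^-1.
  apply: integral_pos_cvg.
  - by move=> n; rewrite exprn_gt0 // pk_gt0.
  - by move=> n m nm; rewrite lerXn2r ?nnegrE ?(ltW (pk_gt0 _ _)) // pk_decr.
  - by move=> n m nm; rewrite lerXn2r ?nnegrE // qk_incr.
  - by rewrite -(mulr0 (0 : R)); apply: cvgM; exact: pk_cvg.
  - apply/cvgryPge => A; near=> n; apply: (@le_trans _ _ (qk R n)).
      by near: n; move/cvgryPge: (@qk_cvg R); apply.
    by rewrite /q expr2 ler_peMl // ler1n.
  - exact: gker_cont.
  - by move=> t t0; exact: ltW (gker_gt0 _ t0).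
have gc : cont_pos (fun s : R => 2 * gauss_fun s).
  move=> t t0; apply: continuousM; [exact: cst_continuous|exact: continuous_gauss_fun].
have c2 := integral_pos_cvg (f := fun s : R => 2 * gauss_fun s) (@pk_gt0 R) (@pk_decr R) (@qk_incr R) (@pk_cvg R) (@qk_cvg R) gc.
have g0 t : 0 < t -> 0 <= 2 * gauss_fun t by move=> _; rewrite mulr_ge0 // gauss_fun_ge0.
have {c2} c2 := c2 g0.
have E n : (\int[mu]_(t in `[p n, q n]) (gker 2^-1 t)%:E)%E =
   (\int[mu]_(t in `[pk R n, qk R n]) (2 * gauss_fun t)%:E)%E.
  have dsq (t : R) : is_derive t 1 (fun s : R => s ^+ 2) (2 * t).
    by apply: (isd_eq (isdX 2 (isd_id t))); rewrite /= expr1 mulr1.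
  have dE : derive1 (fun s : R => s ^+ 2) = (fun t => 2 * t).
    by apply/funext => t; rewrite derive1E; have h := dsq t; rewrite (@derive_val _ _ _ _ _ _ _ h).
  have cl (t : R) : {for t, continuous (fun t : R => 2 * t)}.
    exact: isd_continuous (isdZ 2 (isd_id t)).
  rewrite (@integration_by_substitution_increasing R (fun s => s ^+ 2) (gker 2^-1) (pk R n) (qk R n)).
  - apply: eq_integral => t; rewrite inE /= in_itv /= => /andP[pt _].
    have t0 : 0 < t by apply: lt_le_trans pt; exact: pk_gt0.
    rewrite fctE /= dE; congr EFin; rewrite /gker /gauss_fun.
    have -> : (t ^+ 2) `^ (2^-1 - 1) = t^-1.
      rewrite -powR_mulrn ?(ltW t0) // -powRrM -(powR_inv1 (ltW t0)); congr (_ `^ _).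
      by lra.
    have tn : t != 0 by rewrite gt_eqF.
    by field.
  - exact: ltW (pk_lt_qk R n).
  - move=> x y; rewrite !in_itv /= => /andP[px _] /andP[py _] xy.
    rewrite ltrXn2r // ?nnegrE; apply: le_trans (ltW (pk_gt0 R n)) _ => //.
  - by move=> t _; rewrite dE; exact: cl.
  - by rewrite dE; apply/cvg_ex; exists (2 * pk R n); apply: cvg_at_right_filter; exact: cl.
  - by rewrite dE; apply/cvg_ex; exists (2 * qk R n); apply: cvg_at_left_filter; exact: cl.
  - split.
    + by move=> t _; have h := dsq t; exact: ex_derive.
    + by apply: cvg_at_right_filter; exact: isd_continuous (dsq _).
    + by apply: cvg_at_left_filter; exact: isd_continuous (dsq _).
  - by apply: cont_pos_within; [rewrite exprn_gt0 // pk_gt0|exact: gker_cont].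
apply: EFin_inj; case: (GammaE 2^-1); rewrite ?h0 // => ->.
have {}c1 : (fun n => \int[mu]_(t in `[pk R n, qk R n]) (2 * gauss_fun t)%:E)%E @ \oo --> egam 2^-1.
  by under eq_fun do rewrite -E.
rewrite (cvg_unique _ c1 c2) //.
under eq_integral do rewrite EFinM.
rewrite ge0_integralZl //; last 2 first.
- apply/measurable_EFinP; apply: cont_pos_measurable => t _; exact: continuous_gauss_fun.
- by move=> t _; rewrite lee_fin gauss_fun_ge0.
rewrite integral_itv_obnd_cbnd; last first.
  by apply/measurable_EFinP; apply: cont_pos_measurable => t _; exact: continuous_gauss_fun.
by rewrite integral0y_gauss -EFinM mulrCA mulfV ?mulr1.
Unshelve. all: by end_near. Qed.

End GammaFunction.

#[local] Opaque Gamma.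

Section Stirling.
Variable R : realType.
Implicit Types b x u : R.

Lemma ln1D_bounds x : 0 <= x -> x - x ^+ 2 / 2 + x ^+ 3 / 3 - x ^+ 4 / 4 <= ln (1 + x) /\
  ln (1 + x) <= x - x ^+ 2 / 2 + x ^+ 3 / 3.
Proof.
move=> x0.
have dl (t : R) : 0 <= t -> is_derive t 1 (fun t => ln (1 + t)) (1 + t)^-1.
  move=> t0; have t1 : 0 < 1 + t by rewrite ltr_wpDr.
  apply: (isd_eq (isd_ln (g := fun t => 1 + t) t1 (isdD (isd_cst 1 t) (isd_id t)))).
  by rewrite add0r mul1r.
have dp (n : nat) (t : R) : is_derive t 1 (fun t => t ^+ n.+1 / n.+1%:R) (t ^+ n).
  by apply: (isd_eq (isdM (isdX n.+1 (isd_id t)) (isd_cst n.+1%:R^-1 t))) => /=; field.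
pose p3 t : R := t - t ^+ 2 / 2 + t ^+ 3 / 3.
have d3 (t : R) : is_derive t 1 p3 (1 - t + t ^+ 2).
  by apply: (isd_eq (isdD (isdB (isd_id t) (dp 1%N t)) (dp 2%N t))); rewrite expr1.
split.
- rewrite -subr_ge0; pose f t := ln (1 + t) - (p3 t - t ^+ 4 / 4).
  have df (t : R) : 0 <= t -> is_derive t 1 f ((1 + t)^-1 - (1 - t + t ^+ 2 - t ^+ 3)).
    by move=> t0; exact: (isdB (dl t t0) (isdB (d3 t) (dp 3%N t))).
  have -> : 0 = f 0 by rewrite /f /p3 addr0 ln1 !expr0n /=; ring.
  apply: (nondecr_of_derive x0).
  + by move=> t /andP[t0 _]; exact: isd_continuous (df t t0).
  + by move=> t /andP[t0 _]; exact: df (ltW t0).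
  + move=> t /andP[t0 _]; have t1 : 0 < 1 + t by rewrite ltr_wpDr // ltW.
    have -> : (1 + t)^-1 - (1 - t + t ^+ 2 - t ^+ 3) = t ^+ 4 / (1 + t) by field; rewrite gt_eqF.
    by rewrite divr_ge0 ?exprn_ge0 // ltW.
- rewrite -subr_le0; pose f t := ln (1 + t) - p3 t.
  have df (t : R) : 0 <= t -> is_derive t 1 f ((1 + t)^-1 - (1 - t + t ^+ 2)).
    by move=> t0; exact: (isdB (dl t t0) (d3 t)).
  have -> : 0 = f 0 by rewrite /f /p3 addr0 ln1 !expr0n /=; ring.
  apply: (nonincr_of_derive x0).
  + by move=> t /andP[t0 _]; exact: isd_continuous (df t t0).
  + by move=> t /andP[t0 _]; exact: df (ltW t0).
  + move=> t /andP[t0 _]; have t1 : 0 < 1 + t by rewrite ltr_wpDr // ltW.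
    have -> : (1 + t)^-1 - (1 - t + t ^+ 2) = - (t ^+ 3 / (1 + t)) by field; rewrite gt_eqF.
    by rewrite oppr_le0 divr_ge0 ?exprn_ge0 // ltW.
Qed.

Lemma ln_ratio_bounds x y : 0 < x -> x <= y -> (y - x) / y <= ln y - ln x <= (y - x) / x.
Proof.
move=> x0 xy; have y0 : 0 < y by exact: lt_le_trans xy.
have hl (u : R) : 0 < u -> ln u <= u - 1.
  by move=> u0; have := @le_ln1Dx R (u - 1); rewrite [1 + _]addrC subrK; apply; rewrite ltrBrDl subrr.
apply/andP; split.
  rewrite -lerN2 opprB -ln_div ?posrE //; apply: le_trans (hl _ _) _; first by rewrite divr_gt0.
  by rewrite le_eqVlt; apply/orP; left; apply/eqP; field; rewrite gt_eqF.
rewrite -ln_div ?posrE //; apply: le_trans (hl _ _) _; first by rewrite divr_gt0.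
by rewrite le_eqVlt; apply/orP; left; apply/eqP; field; rewrite gt_eqF.
Qed.

Definition stir b : R := ln (Gamma b) - (b - 2^-1) * ln b + b.

Lemma stir_step b : 1 <= b ->
  `|(stir (b + 1) - (12 * (b + 1))^-1) - (stir b - (12 * b)^-1)| <= 2^-1 * (b ^- 2 - (b + 1) ^- 2).
Proof.
move=> b1; have b0 : 0 < b by exact: lt_le_trans b1.
have bb0 : 0 < b + 1 by rewrite addr_gt0.
pose x := b^-1; have x0 : 0 < x by rewrite invr_gt0.
have x1 : x <= 1 by rewrite invf_le1.
have x10 : 0 < 1 + x by rewrite ltr_wpDr // ltW.
have lnb : ln (b + 1) = ln b + ln (1 + x).
  by rewrite -lnM ?posrE //; congr ln; rewrite /x mulrDr mulr1 mulfV ?gt_eqF.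
have e1 : stir (b + 1) - stir b = 1 - (b + 2^-1) * ln (1 + x).
  by rewrite /stir GammaS // lnM ?posrE ?Gamma_gt0 // lnb; field.
have bx : b = x^-1 by rewrite invrK.
have [h1 h2] := ln1D_bounds (ltW x0).
have c0 : 0 <= b + 2^-1 by rewrite addr_ge0 // ltW.
have k1 := ler_wpM2l c0 h1; have k2 := ler_wpM2l c0 h2.
have E1 : (b + 2^-1) * (x - x ^+ 2 / 2 + x ^+ 3 / 3) = 1 + x ^+ 2 / 12 + x ^+ 3 / 6.
  by rewrite bx; field; rewrite gt_eqF.
have E2 : (b + 2^-1) * (x - x ^+ 2 / 2 + x ^+ 3 / 3 - x ^+ 4 / 4) =
   1 + x ^+ 2 / 12 + x ^+ 3 / 6 - (x ^+ 3 / 4 + x ^+ 4 / 8).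
  by rewrite bx; field; rewrite gt_eqF.
rewrite E2 in k1; rewrite E1 in k2.
have q3 : x ^+ 4 <= x ^+ 3 by rewrite (exprS _ 3) ler_piMl ?exprn_ge0 // ltW.
have x30 : 0 < x ^+ 3 by rewrite exprn_gt0.
have E3 : (12 * b)^-1 - (12 * (b + 1))^-1 = x ^+ 2 / 12 - x ^+ 3 / (12 * (1 + x)).
  by rewrite bx; field; rewrite !gt_eqF // -bx.
have u1 : 0 <= x ^+ 3 / (12 * (1 + x)) by rewrite divr_ge0 ?mulr_ge0 ?ltW.
have u2 : x ^+ 3 / (12 * (1 + x)) <= x ^+ 3 / 12.
  by rewrite ler_wpM2l ?(ltW x30) // lef_pV2 ?posrE ?mulr_gt0 // ler_peMr // lerDl ltW.
have E4 : b ^- 2 - (b + 1) ^- 2 = x ^+ 3 * ((2 + x) / (1 + x) ^+ 2).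
  by rewrite bx; field; rewrite !gt_eqF // -bx.
have u3 : 2^-1 <= (2 + x) / (1 + x) ^+ 2.
  rewrite ler_pdivlMr ?exprn_gt0 //.
  have : x ^+ 2 <= 1 by apply: exprn_ile1 => //; exact: ltW.
  have -> : 2^-1 * (1 + x) ^+ 2 = 2^-1 + x + x ^+ 2 / 2 by field.
  lra.
have u4 : x ^+ 3 / 2 <= x ^+ 3 * ((2 + x) / (1 + x) ^+ 2) by rewrite ler_wpM2l // ltW.
rewrite E4.
have -> : stir (b + 1) - (12 * (b + 1))^-1 - (stir b - (12 * b)^-1) =
  (stir (b + 1) - stir b) + ((12 * b)^-1 - (12 * (b + 1))^-1) by ring.
rewrite e1 E3 ler_norml.
move: k1 k2 q3 x30 u1 u2 u4.
set L := (b + 2^-1) * ln (1 + x); set X := x ^+ 3 / (12 * (1 + x)); set Y := x ^+ 3 * ((2 + x) / (1 + x) ^+ 2).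
set x2 := x ^+ 2; set x3 := x ^+ 3; set x4 := x ^+ 4 => k1 k2 q3 x30 u1 u2 u4.
by apply/andP; split; lra.
Qed.

Definition stirt b : R := stir b - (12 * b)^-1.

Lemma stirt_far b n : 1 <= b -> `|stirt (b + n%:R) - stirt b| <= 2^-1 * (b ^- 2 - (b + n%:R) ^- 2).
Proof.
move=> b1; elim: n => [|n IH]; first by rewrite addr0 !subrr normr0 mulr0.
have bn : 1 <= b + n%:R by rewrite ler_wpDr.
rewrite -(natr1 n) addrA.
have -> : stirt (b + n%:R + 1) - stirt b = (stirt (b + n%:R + 1) - stirt (b + n%:R)) + (stirt (b + n%:R) - stirt b) by ring.
apply: le_trans (ler_normD _ _) _; apply: le_trans (lerD (stir_step bn) IH) _.
by rewrite -mulrDr ler_wpM2l // [X in X <= _]addrC addrA subrK.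
Qed.

Lemma ln_Gamma_shift x be : 0 < x -> 1 <= be ->
  be * ln x <= ln (Gamma (x + be)) - ln (Gamma x) <= be * ln (x + be).
Proof.
move=> x0 be1; have be0 : 0 < be by exact: lt_le_trans be1.
have xb0 : 0 < x + be by exact: addr_gt0.
have g1 : Gamma x \is Num.pos by rewrite posrE Gamma_gt0.
have g2 : Gamma (x + be) \is Num.pos by rewrite posrE Gamma_gt0.
have p1 : x `^ be \is Num.pos by rewrite posrE powR_gt0.
have p2 : (x + be) `^ be \is Num.pos by rewrite posrE powR_gt0.
have m1 : x `^ be * Gamma x <= Gamma (x + be) by exact: (Gamma_ge x0 xb0 (or_introl be1)).
have m2 : Gamma (x + be) <= (x + be) `^ be * Gamma x.
  have h0 : 0 < x + be + - be by rewrite addrK.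
  have hn : - be <= 0 by rewrite oppr_le0 ltW.
  have := Gamma_ge xb0 h0 (or_intror hn); rewrite addrK powRN => h.
  by rewrite -ler_pdivrMl // -posrE.
have q1 : x `^ be * Gamma x \is Num.pos by rewrite posrE mulr_gt0 // -posrE.
have q2 : (x + be) `^ be * Gamma x \is Num.pos by rewrite posrE mulr_gt0 // -posrE.
apply/andP; split.
  by move: m1; rewrite -(ler_ln q1 g2) (lnM p1 g1) ln_powR lerBrDr.
by move: m2; rewrite -(ler_ln g2 q2) (lnM p2 g1) ln_powR lerBlDr.
Qed.

Lemma stir_shift (be : R) (n : nat) : 1 <= be -> (0 < n)%N ->
  `|stir (n%:R + be) - stir n%:R| <= be * (be + 1) / n%:R.
Proof.
move=> be1 n0; have be0 : 0 < be by exact: lt_le_trans be1.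
have N1 : 1 <= n%:R :> R by rewrite ler1n.
rewrite /stir; move: (n%:R : R) N1 => N N1 {n n0}.
have N0 : 0 < N by exact: lt_le_trans N1.
have Nb0 : 0 < N + be by exact: addr_gt0.
have Nle : N <= N + be by rewrite lerDl ltW.
have := ln_ratio_bounds N0 Nle; rewrite addrAC subrr add0r.
have := ln_Gamma_shift N0 be1.
set G2 := ln (Gamma (N + be)); set G1 := ln (Gamma N); set l2 := ln (N + be); set l1 := ln N.
move: G2 G1 l2 l1 => G2 G1 l2 l1 /andP[h1 h2] /andP[r1 r2].
have half : 2^-1 <= N by apply: le_trans N1; rewrite invf_le1 // ler1n.
have Nh : 0 <= N - 2^-1 by rewrite subr_ge0.
have Nh' : 0 <= N + be - 2^-1 by rewrite subr_ge0 (le_trans half).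
have k1 := ler_wpM2l Nh r1; have k2 := ler_wpM2l Nh' r2.
have E1 : (N - 2^-1) * (be / (N + be)) = be - be * (be + 2^-1) / (N + be) by field; rewrite gt_eqF.
have E2 : (N + be - 2^-1) * (be / N) = be + be * (be - 2^-1) / N by field; rewrite gt_eqF.
rewrite E1 in k1; rewrite E2 in k2.
have B : be * (be + 2^-1) / (N + be) <= be * (be + 1) / N.
  apply: ler_pM.
  - by apply: mulr_ge0; [exact: ltW|rewrite addr_ge0 // ltW].
  - by rewrite invr_ge0 ltW.
  - by rewrite ler_wpM2l ?(ltW be0) // lerD2l invf_le1 // ler1n.
  - by rewrite lef_pV2 ?posrE.
have B' : be * (be - 2^-1) / N <= be * (be + 1) / N.
  rewrite ler_wpM2r ?invr_ge0 ?(ltW N0) // ler_wpM2l ?(ltW be0) // lerD2l.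
  by apply: (@le_trans _ _ 0); rewrite ?oppr_le0 ?invr_ge0.
move: k1 k2 B B'; clear E1 E2 Nh Nh' half r1 r2 Nle Nb0.
set B0 := be * (be + 1) / N; move: (_ / (N + be)) (be * (be - 2^-1) / N) => B1 B2 k1 k2 B B'.
rewrite ler_norml; apply/andP; split; lra.
Qed.

Lemma Gamma_duplication (n : nat) :
  Gamma (n%:R + 2^-1 : R) * 4 ^+ n * Gamma (n%:R + 1) = Num.sqrt pi * Gamma (2 * n%:R + 1).
Proof.
elim: n => [|n IH]; first by rewrite mulr0 !add0r expr0 mulr1 Gamma1 Gamma_half mulr1.
have n0 : 0 <= n%:R :> R by rewrite ler0n.
have e1 : n.+1%:R + 2^-1 = (n%:R + 2^-1) + 1 :> R by rewrite -natr1; ring.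
have e2 : n.+1%:R + 1 = (n%:R + 1) + 1 :> R by rewrite -natr1; ring.
have e3 : 2 * n.+1%:R + 1 = ((2 * n%:R + 1) + 1) + 1 :> R by rewrite -natr1; ring.
have p1 : 0 < n%:R + 2^-1 :> R by rewrite ltr_wpDl // invr_gt0.
have p2 : 0 < n%:R + 1 :> R by rewrite ltr_wpDl.
have p3 : 0 < 2 * n%:R + 1 :> R by rewrite ltr_wpDl // mulr_ge0.
have p4 : 0 < 2 * n%:R + 1 + 1 :> R by rewrite addr_gt0.
rewrite e1 e2 e3 (GammaS p1) (GammaS p2) (GammaS p4) (GammaS p3).
transitivity ((2 * n%:R + 1 + 1) * (2 * n%:R + 1) * (Gamma (n%:R + 2^-1 : R) * 4 ^+ n * Gamma (n%:R + 1))).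
  by rewrite exprS; field.
by rewrite IH; ring.
Qed.

Lemma stirt_lim : exists L : R, forall n : nat, (0 < n)%N -> `|stirt n%:R - L| <= 2^-1 * n%:R ^- 2.
Proof.
pose f (n : nat) : R := stirt n.+1%:R - 2^-1 * n.+1%:R ^- 2.
pose g (n : nat) : R := stirt n.+1%:R + 2^-1 * n.+1%:R ^- 2.
have far (n k : nat) : `|stirt (n + k).+1%:R - stirt n.+1%:R| <= 2^-1 * (n.+1%:R ^- 2 - (n + k).+1%:R ^- 2).
  have := @stirt_far n.+1%:R k; rewrite -natrD addSn ler1n; exact.
have ndf : nondecreasing_seq f.
  move=> n m nm; have := far n (m - n)%N; rewrite subnKC // ler_norml /f => /andP[].
  move: (stirt m.+1%:R) (stirt n.+1%:R) (n.+1%:R ^- 2) (m.+1%:R ^- 2) => x y z t h _.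
  have : y - 2^-1 * z <= x - 2^-1 * t by lra.
  by [].
have nig : nonincreasing_seq g.
  move=> n m nm; have := far n (m - n)%N; rewrite subnKC // ler_norml /g => /andP[_].
  move: (stirt m.+1%:R) (stirt n.+1%:R) (n.+1%:R ^- 2) (m.+1%:R ^- 2) => x y z t h.
  have : x + 2^-1 * t <= y + 2^-1 * z by lra.
  by [].
have fg n : f n <= g n.
  rewrite /f /g lerBlDr -addrA lerDl addr_ge0 // mulr_ge0 // invr_ge0 exprn_ge0 //.
have cf : cvgn f.
  apply: nondecreasing_is_cvgn => //; exists (g 0%N) => _ [n _ <-].
  by apply: le_trans (fg n) _; exact: nig.
exists (limn f) => n n0; have h1 := nondecreasing_cvgn_le ndf cf n.-1.
have h2 : limn f <= g n.-1.
  apply: limr_le => //; near=> m.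
  have nm : (n.-1 <= m)%N by near: m; exact: nbhs_infty_ge.
  by apply: le_trans (fg m) _; exact: nig.
rewrite /f /g prednK // in h1 h2; rewrite ler_norml.
by apply/andP; split; lra.
Unshelve. all: by end_near. Qed.

Lemma le0_of_archi (x K : R) : (forall n : nat, (0 < n)%N -> x <= K / n%:R) -> x <= 0.
Proof.
move=> H; rewrite leNgt; apply/negP => x0.
have := H (Num.trunc (K / x)).+1 (ltn0Sn _); apply/negP; rewrite -ltNge.
by rewrite ltr_pdivrMr ?ltr0n // mulrC -ltr_pdivrMr // truncnS_gt.
Qed.

Lemma ln_Gamma_duplication (n : nat) (N : R) : N = n%:R ->
  ln (Gamma (N + 2^-1)) + N * (2 * ln 2) + ln (Gamma (N + 1)) = 2^-1 * ln pi + ln (Gamma (2 * N + 1)).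
Proof.
move=> NE; have N0 : 0 <= N by rewrite NE.
have p1 : 0 < N + 2^-1 by rewrite ltr_wpDl // invr_gt0.
have p2 : 0 < N + 1 by rewrite ltr_wpDl.
have p3 : 0 < 2 * N + 1 by rewrite ltr_wpDl // mulr_ge0.
have := Gamma_duplication n; rewrite -NE.
move: (Gamma_gt0 p1) (Gamma_gt0 p2) (Gamma_gt0 p3).
move: (Gamma (N + 2^-1)) (Gamma (N + 1)) (Gamma (2 * N + 1)) => g1 g2 g3 q1 q2 q3 /(congr1 (@ln R)).
have p4 : 0 < 4 ^+ n :> R by rewrite exprn_gt0.
have pi0 : 0 < pi :> R by exact: pi_gt0.
have sp : 0 < Num.sqrt pi :> R by rewrite sqrtr_gt0.
rewrite (lnM (x := g1 * 4 ^+ n)) ?posrE ?mulr_gt0 // (lnM (x := g1)) ?posrE // (lnM (x := Num.sqrt pi)) ?posrE //.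
rewrite lnXn // -[ln 4 *+ n]mulr_natl -powR12_sqrt ?(ltW pi0) // ln_powR -NE.
have -> : ln (4 : R) = 2 * ln 2.
  have -> : 4 = 2 ^+ 2 :> R by rewrite -natrX.
  by rewrite lnXn // mulr_natl.
by [].
Qed.

Lemma stir_duplication (n : nat) (N : R) : N = n%:R ->
  stir (N + 2^-1) + stir (N + 1) - stir (2 * N + 1) =
   2^-1 * ln (2 * pi) - ((N + 2^-1) * (ln (N + 1) - ln (N + 2^-1)) - 2^-1).
Proof.
move=> NE; have N0 : 0 <= N by rewrite NE.
have p1 : 0 < N + 2^-1 by rewrite ltr_wpDl // invr_gt0.
have pi0 : 0 < pi :> R by exact: pi_gt0.
have l2N : ln (2 * N + 1) = ln 2 + ln (N + 2^-1).
  by rewrite -lnM ?posrE //; congr ln; field.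
have l2pi : ln (2 * pi : R) = ln 2 + ln pi by rewrite lnM ?posrE.
have := ln_Gamma_duplication NE; rewrite /stir l2pi l2N.
move: (ln (Gamma (N + 2^-1))) (ln (Gamma (N + 1))) (ln (Gamma (2 * N + 1))) => G1 G2 G3.
move: (ln (N + 2^-1)) (ln (N + 1)) (ln pi) (ln 2) => m k lp l2 h.
have -> : G1 = 2^-1 * lp + G3 - N * (2 * l2) - G2 by rewrite -h; ring.
by field.
Qed.

Lemma ln_midpoint (N : R) : 1 <= N ->
  2^-1 - 1 / N <= (N + 2^-1) * (ln (N + 1) - ln (N + 2^-1)) <= 2^-1.
Proof.
move=> N1; have N0 : 0 < N by exact: lt_le_trans N1.
have Nh : 0 < N + 2^-1 by rewrite addr_gt0 // invr_gt0.
have N10 : 0 < N + 1 by rewrite addr_gt0.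
have hN1 : N + 2^-1 <= N + 1 by rewrite lerD2l invf_le1 // ler1n.
have := ln_ratio_bounds Nh hN1.
have -> : N + 1 - (N + 2^-1) = 2^-1 by field.
move=> /andP[r1 r2].
have k1 := ler_wpM2l (ltW Nh) r1; have k2 := ler_wpM2l (ltW Nh) r2.
apply/andP; split.
  apply: le_trans k1.
  have -> : (N + 2^-1) * (2^-1 / (N + 1)) = 2^-1 - 4^-1 / (N + 1).
    by field; rewrite gt_eqF.
  rewrite lerD2l lerN2; apply: ler_pM.
  - by rewrite invr_ge0.
  - by rewrite invr_ge0 ltW.
  - by rewrite invf_le1 // ler1n.
  - by rewrite lef_pV2 ?posrE // lerDl.
apply: le_trans k2 _; rewrite mulrC divfK //.
by rewrite gt_eqF.
Qed.

Lemma stir_main b : 1 <= b -> `|stir b - (12 * b)^-1 - 2^-1 * ln (2 * pi)| <= 2^-1 * b ^- 2.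
Proof.
have [L hL] := stirt_lim.
have hs (n : nat) : (0 < n)%N -> `|stir n%:R - L| <= 1 / n%:R.
  move=> n0; have N0 : 0 < n%:R :> R by rewrite ltr0n.
  have := hL n n0; rewrite /stirt => h.
  have -> : stir n%:R - L = (stir n%:R - (12 * n%:R)^-1 - L) + (12 * n%:R)^-1 by ring.
  apply: le_trans (ler_normD _ _) _; apply: le_trans (lerD h (lexx _)) _.
  rewrite ger0_norm ?invr_ge0 ?mulr_ge0 ?ler0n //.
  have h2 : n%:R ^- 2 <= n%:R^-1 :> R.
    by rewrite lef_pV2 ?posrE ?exprn_gt0 // -natrX ler_nat -{1}(expn1 n) leq_pexp2l.
  have -> : (12 * n%:R)^-1 = 12^-1 * n%:R^-1 :> R by rewrite invfM.
  have : 0 < n%:R^-1 :> R by rewrite invr_gt0.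
  rewrite mul1r; move: h2; set y := _^-1; set z := _^-1; lra.
have far1 b' : 1 <= b' -> `|stirt b' - L| <= 2^-1 * b' ^- 2.
  move=> b1; have b0 : 0 < b' by exact: lt_le_trans b1.
  rewrite -subr_le0; apply: (@le0_of_archi _ (b' * (b' + 1) + 2)) => n n0.
  have N0 : 0 < n%:R :> R by rewrite ltr0n.
  have k1 := @stirt_far b' n b1; have k2 := @stir_shift b' n b1 n0; have k3 := hs n n0.
  have k4 : (12 * (b' + n%:R))^-1 <= 1 / n%:R.
    rewrite mul1r lef_pV2 ?posrE ?mulr_gt0 ?addr_gt0 //.
    by lra.
  have k40 : 0 <= (12 * (b' + n%:R))^-1 by rewrite invr_ge0 mulr_ge0 // addr_ge0 // ltW.
  have k5 : 0 <= (b' + n%:R) ^- 2 by rewrite invr_ge0 exprn_ge0 // addr_ge0 // ltW.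
  rewrite [n%:R + b']addrC in k2.
  have -> : stirt b' - L = - (stirt (b' + n%:R) - stirt b') + (stir (b' + n%:R) - stir n%:R) +
     (stir n%:R - L) - (12 * (b' + n%:R))^-1 by rewrite /stirt; ring.
  rewrite lerBlDr; apply: le_trans (ler_normB _ _) _.
  apply: le_trans (lerD (ler_normD _ _) (lexx _)) _.
  apply: le_trans (lerD (lerD (ler_normD _ _) (lexx _)) (lexx _)) _.
  rewrite normrN (ger0_norm k40).
  have -> : (b' * (b' + 1) + 2) / n%:R = b' * (b' + 1) / n%:R + 1 / n%:R + 1 / n%:R.
    by field; rewrite gt_eqF.
  move: k1 k2 k3 k4 k5; move: (b' * (b' + 1) / n%:R) (1 / n%:R) ((12 * _)^-1) (b' ^- 2) ((b' + n%:R) ^- 2) => y3 y4 y5 y1 y2.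
  by move: `|_| `|_| `|_| => N1 N2 N3; lra.
have sb x : 1 <= x -> `|stir x - L| <= 1 / x.
  move=> x1; have x0 : 0 < x by exact: lt_le_trans x1.
  have -> : stir x - L = (stirt x - L) + (12 * x)^-1 by rewrite /stirt; ring.
  have q1 : x ^- 2 <= x^-1 by rewrite lef_pV2 ?posrE ?exprn_gt0 // expr2 ler_peMr // ltW.
  have q3 : 0 < x^-1 by rewrite invr_gt0.
  apply: le_trans (ler_normD _ _) _; apply: le_trans (lerD (far1 x x1) (lexx _)) _.
  rewrite (invfM 12 x) mul1r ger0_norm; last by rewrite mulr_ge0 // ltW.
  by move: q1 q3; move: (x ^- 2) (x^-1) => y z; lra.
suff -> : 2^-1 * ln (2 * pi) = L by exact: far1.
apply/eqP; rewrite -subr_eq0 -normr_le0.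
apply: (@le0_of_archi _ 4) => n n0.
have [N NE] : exists N : R, N = n%:R by eexists.
have N1 : 1 <= N by rewrite NE ler1n.
have N0 : 0 < N by exact: lt_le_trans N1.
have inv x : N <= x -> 1 / x <= 1 / N.
  by move=> Nx; rewrite ler_wpM2l // lef_pV2 ?posrE // (lt_le_trans N0).
have sb' x : N <= x -> `|stir x - L| <= 1 / N.
  by move=> Nx; apply: le_trans (sb x (le_trans N1 Nx)) (inv x Nx).
have t1 : `|stir (N + 2^-1) - L| <= 1 / N by apply: sb'; rewrite lerDl invr_ge0.
have t2 : `|stir (N + 1) - L| <= 1 / N by apply: sb'; rewrite lerDl.
have t3 : `|stir (2 * N + 1) - L| <= 1 / N.
  by apply: sb'; rewrite mulr_natl mulr2n -addrA lerDl addr_ge0 // ltW.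
have key := stir_duplication NE; have := ln_midpoint N1.
rewrite -NE (_ : 4 / N = 4 * (1 / N)); last by rewrite mul1r.
move: key t1 t2 t3; clear -R.
move: (stir _) (stir (N + 1)) (stir (2 * N + 1)) (_ * (ln (N + 1) - _)) (1 / N) (2^-1 * ln (2 * pi)) => a1 a2 a3 Z y P.
rewrite !ler_norml => key /andP[u1 u1'] /andP[u2 u2'] /andP[u3 u3'] /andP[k1 k2].
by apply/andP; split; lra.
Qed.

Lemma expR_2nd u : u <= 2^-1 -> `|expR u - 1 - u| <= 2 * u ^+ 2.
Proof.
move=> u2; have h := expR_ge1Dx u.
have v0 : 0 < 1 - u by lra.
rewrite ger0_norm; last by lra.
suff : expR u <= 1 + u + 2 * u ^+ 2 by lra.
apply: (@le_trans _ _ (1 - u)^-1).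
  rewrite -[expR u]invrK -expRN lef_pV2 ?posrE ?expR_gt0 //.
  exact: expR_ge1Dx.
rewrite -[_^-1]mul1r ler_pdivrMr //.
have -> : (1 + u + 2 * u ^+ 2) * (1 - u) = 1 + u ^+ 2 * (1 - 2 * u) by ring.
by rewrite lerDl mulr_ge0 ?sqr_ge0 //; lra.
Qed.

Lemma stirling b : 4 <= b ->
  `|Gamma b * b `^ (2^-1 - b) * expR b - Num.sqrt (2 * pi) * (1 + (12 * b)^-1)| <=
  2 * Num.sqrt (2 * pi) * b ^- 2.
Proof.
move=> b4; have b0 : 0 < b by lra.
have b1 : 1 <= b by lra.
have pi20 : 0 < 2 * pi :> R by rewrite mulr_gt0 // pi_gt0.
have -> : Gamma b * b `^ (2^-1 - b) * expR b = expR (stir b).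
  rewrite /stir expRD; congr (_ * _); rewrite expRD lnK ?posrE ?Gamma_gt0 //; congr (_ * _).
  by rewrite /powR gt_eqF //; congr expR; ring.
have -> : Num.sqrt (2 * pi : R) = expR (2^-1 * ln (2 * pi)).
  by rewrite -powR12_sqrt ?(ltW pi20) // /powR gt_eqF.
set L := 2^-1 * ln (2 * pi); have := stir_main b1; rewrite -/L => h.
pose u := stir b - L; pose x := b^-1.
have x0 : 0 < x by rewrite invr_gt0.
have x4 : x <= 4^-1 by rewrite lef_pV2 ?posrE.
have h' : `|u - x / 12| <= 2^-1 * x ^+ 2.
  have -> : u - x / 12 = stir b - (12 * b)^-1 - L by rewrite /u /x invfM; ring.
  by rewrite /x exprVn.
have xx : x ^+ 2 <= 4^-1 * x by rewrite expr2 ler_wpM2r // ltW.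
have x20 : 0 <= x ^+ 2 by rewrite sqr_ge0.
have [u1 u2] : - (x / 3) <= u /\ u <= x / 3.
  by move: h'; rewrite ler_norml => /andP[]; split; lra.
have uu : u ^+ 2 <= x ^+ 2 / 9.
  have : 0 <= (x / 3 - u) * (x / 3 + u) by rewrite mulr_ge0; lra.
  have -> : (x / 3 - u) * (x / 3 + u) = x ^+ 2 / 9 - u ^+ 2 by field.
  by rewrite subr_ge0.
have uh : u <= 2^-1 by lra.
have := expR_2nd uh => he.
have -> : expR (stir b) - expR L * (1 + (12 * b)^-1) = expR L * ((expR u - 1 - u) + (u - x / 12)).
  have -> : stir b = L + u by rewrite /u; ring.
  by rewrite expRD /x invfM; ring.
rewrite normrM (ger0_norm (expR_ge0 _)) [X in _ <= X]mulrAC [X in X <= _]mulrC.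
rewrite ler_wpM2r ?expR_ge0 //.
apply: le_trans (ler_normD _ _) _; apply: le_trans (lerD he h') _.
rewrite -exprVn -/x; lra.
Qed.

End Stirling.

(** * The Kummer function at infinity on the real axis *)

Section KummerAtInfinity.
Variable R : realType.
Variables (a b : R).
Hypotheses (a0 : 0 < a) (ab1 : a + 1 <= b).
Let be : R := b - a.
Let be1 : 1 <= be. Proof. by rewrite /be lerBrDl. Qed.
Let be0 : 0 < be. Proof. exact: lt_le_trans be1. Qed.
Let ab : a <= b. Proof. by apply: le_trans ab1; rewrite lerDl. Qed.
Let b0 : 0 < b. Proof. exact: lt_le_trans ab. Qed.
Let c1 : R := Gamma b / Gamma a.
Let c10 : 0 < c1. Proof. by rewrite divr_gt0 ?Gamma_gt0. Qed.

Lemma poch_Gamma (x : R) k : 0 < x -> Gamma (x + k%:R) = poch x k * Gamma x.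
Proof.
move=> x0; elim: k => [|k IH]; first by rewrite addr0 poch0 mul1r.
have h : 0 < x + k%:R by rewrite ltr_wpDr.
have := GammaS h; rewrite IH -(natr1 k) addrA pochS => ->.
by rewrite mulrA (mulrC (poch x k)).
Qed.

Lemma dkcoefE k : dcoef (kcoef a b) k =
  c1 * (Gamma (a + 1 + k%:R) / Gamma (a + 1 + k%:R + be)) / (k`!)%:R.
Proof.
have -> : a + 1 + k%:R = a + k.+1%:R by rewrite -natr1; ring.
have -> : a + k.+1%:R + be = b + k.+1%:R by rewrite /be; ring.
rewrite !poch_Gamma // /c1 /dcoef /kcoef factS natrM.
have g1 := Gamma_gt0 a0; have g2 := Gamma_gt0 b0; have p1 := poch_gt0 k.+1 b0.
have f0 : (k`!)%:R != 0 :> R by rewrite pnatr_eq0 -lt0n fact_gt0.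
have k0 : k.+1%:R != 0 :> R by rewrite pnatr_eq0.
by move: f0 g1 g2 p1 k0; move: (Gamma a) (Gamma b) (poch b _) (poch a _) => ga gb pb pa f0 g1 g2 p1 k0; field; rewrite f0 !gt_eqF.
Qed.

Lemma Gamma_quotient_bounds (x : R) : 0 < x ->
  (x + be) `^ (- be) <= Gamma x / Gamma (x + be) <= x `^ (- be).
Proof.
move=> x0; have xb : 0 < x + be by rewrite addr_gt0.
have g2 := Gamma_gt0 xb; apply/andP; split.
  rewrite ler_pdivlMr //; have := @Gamma_ge R (x + be) (- be) xb; rewrite addrK; apply => //.
  by right; rewrite oppr_le0 ltW.
rewrite ler_pdivrMr // powRN mulrC ler_pdivlMr ?powR_gt0 // mulrC.
by apply: Gamma_ge => //; left.
Qed.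

Lemma powR_ge_tangent (x z : R) : 0 < x -> 0 < z ->
  z `^ (- be) * (1 - be * (x / z - 1)) <= x `^ (- be).
Proof.
move=> x0 z0; have xz : 0 < x / z by rewrite divr_gt0.
have hb : 1 <= - be \/ - be <= 0 by right; rewrite oppr_le0 ltW.
have := bernoulli_powR xz hb; rewrite mulNr => h.
apply: le_trans (ler_wpM2l (powR_ge0 _ _) h) _.
by rewrite -powRM ?(ltW z0) ?(ltW xz) // mulrCA mulfV ?gt_eqF // mulr1.
Qed.

Lemma powR_le_secant (x z : R) (N : nat) : 0 < x -> 0 < z -> be <= N%:R ->
  x `^ (- be) <= z `^ (- be) * (1 - be / N%:R + be / N%:R * (z / x) ^+ N).
Proof.
move=> x0 z0 bN; have N0 : 0 < N%:R :> R by exact: lt_le_trans bN.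
have xz : 0 < z / x by rewrite divr_gt0.
have y0 : 0 < (z / x) `^ be by rewrite powR_gt0.
have hp : 1 <= N%:R / be \/ N%:R / be <= 0 by left; rewrite ler_pdivlMr // mul1r.
have := bernoulli_powR y0 hp.
have -> : ((z / x) `^ be) `^ (N%:R / be) = (z / x) ^+ N.
  by rewrite -powRrM (mulrC be) divfK ?gt_eqF // powR_mulrn // ltW.
move=> h.
have h' : (z / x) `^ be <= 1 - be / N%:R + be / N%:R * (z / x) ^+ N.
  have c0 : 0 < be / N%:R by rewrite divr_gt0.
  have := ler_wpM2l (ltW c0) h.
  have -> : be / N%:R * (1 + N%:R / be * ((z / x) `^ be - 1)) = be / N%:R + (z / x) `^ be - 1.
    by field; rewrite !gt_eqF.
  by lra.
apply: le_trans (ler_wpM2l (powR_ge0 _ _) h').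
rewrite powRM ?(ltW z0) ?invr_ge0 ?(ltW x0) // mulrA -powRD; last by apply/implyP => _; rewrite gt_eqF.
by rewrite addNr powRr0 mul1r -powR_inv1 ?(ltW x0) // -powRrM mulN1r.
Qed.

Lemma cvg_exp_psum (z : R) : (fun n => \sum_(k < n) z ^+ k / (k`!)%:R) @ \oo --> expR z.
Proof.
have := is_cvg_series_exp_coeff z; rewrite /series => h.
have e : (fun n => \sum_(k < n) z ^+ k / (k`!)%:R) = (fun n => \sum_(0 <= k < n) exp_coeff z k).
  by apply/funext => n; rewrite big_mkord.
by rewrite e.
Qed.

Lemma rkum1_lower (z : R) : 0 < z ->
  c1 * z `^ (- be) * expR z * (1 - be * (b + 1) / z) <= rkum1 a b z.
Proof.
move=> z0.
pose E (n : nat) : R := \sum_(k < n) z ^+ k / (k`!)%:R.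
have cE : E @ \oo --> expR z by exact: cvg_exp_psum.
have cES : (fun n => E n.+1) @ \oo --> expR z by have := cE; rewrite -cvg_shiftS.
have h1 : (fun n => c1 * z `^ (- be) * ((1 + be - be * (b + 1) / z) * E n.+1 - be * E n)) @ \oo -->
   c1 * z `^ (- be) * ((1 + be - be * (b + 1) / z) * expR z - be * expR z).
  apply: cvgM; first exact: cvg_cst.
  by apply: cvgB; (apply: cvgM; [exact: cvg_cst|]).
have h2 : (fun n => \sum_(k < n.+1) dcoef (kcoef a b) k * z ^+ k) @ \oo --> rkum1 a b z.
  by have := rkum1_cvg a0 ab (x:=z); rewrite -cvg_shiftS.
have -> : c1 * z `^ (- be) * expR z * (1 - be * (b + 1) / z) =
  c1 * z `^ (- be) * ((1 + be - be * (b + 1) / z) * expR z - be * expR z) by ring.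
apply: (ler_cvg_to h1 h2); apply: nearW => n.
have -> : be * E n = \sum_(k < n.+1) be * (k%:R / z) * (z ^+ k / (k`!)%:R).
  rewrite big_ord_recl /= mul0r mulr0 mul0r add0r /E mulr_sumr.
  apply: eq_bigr => i _; rewrite /bump /= add1n factS natrM exprS.
  have f0 : (i`!)%:R != 0 :> R by rewrite pnatr_eq0 -lt0n fact_gt0.
  have i0 : i.+1%:R != 0 :> R by rewrite pnatr_eq0.
  move: (i.+1%:R : R) ((i`!)%:R : R) i0 f0 => u v u0 v0.
  by field; rewrite u0 v0 gt_eqF.
rewrite /E mulr_sumr -sumrB mulr_sumr; apply: ler_sum => k _.
have x0 : 0 < a + 1 + k%:R by rewrite ltr_wpDr // addr_gt0.
have xb : 0 < a + 1 + k%:R + be by rewrite addr_gt0.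
have /andP[q1 _] := Gamma_quotient_bounds x0.
have q2 := powR_ge_tangent xb z0.
have q := le_trans q2 q1.
have w0 : 0 <= c1 * (z ^+ k / (k`!)%:R).
  by apply: mulr_ge0; [exact: ltW|apply: divr_ge0; [apply: exprn_ge0; exact: ltW|exact: ler0n]].
have := ler_wpM2r w0 q; rewrite dkcoefE.
set G := Gamma _ / _; set W := z ^+ k / _ => h.
have -> : c1 * G / (k`!)%:R * z ^+ k = G * (c1 * W) by rewrite /W; ring.
apply: le_trans h; rewrite le_eqVlt; apply/orP; left; apply/eqP.
by rewrite /be; field; rewrite gt_eqF.
Qed.

Lemma inv_pow_le (N k : nat) : ((k.+1%:R : R) ^- N) <=
  (k`!)%:R / ((k + N)`!)%:R * (1 + (N.+1 ^ N.+1)%:R / (k + N).+1%:R).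
Proof.
have f0 m : 0 < (m`!)%:R :> R by rewrite ltr0n fact_gt0.
have P j : ((k + j)`!)%:R <= (k`!)%:R * k.+1%:R ^+ j * (1 + j%:R / k.+1%:R) ^+ j :> R.
  have k0 : 0 < k.+1%:R :> R by rewrite ltr0n.
  elim: j => [|j IH]; first by rewrite addn0 !expr0 !mulr1.
  rewrite addnS factS natrM.
  apply: le_trans (ler_pM (ler0n _ _) (ler0n _ _) (lexx _) IH) _.
  have s1 : (k + j).+1%:R <= k.+1%:R * (1 + j.+1%:R / k.+1%:R) :> R.
    rewrite mulrDr mulr1 mulrCA mulfV ?gt_eqF // mulr1 -natrD ler_nat; lia.
  have s2 : (1 + j%:R / k.+1%:R) ^+ j <= (1 + j.+1%:R / k.+1%:R) ^+ j :> R.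
    by rewrite lerXn2r ?nnegrE ?addr_ge0 ?divr_ge0 // lerD2l ler_wpM2r ?invr_ge0 // ler_nat.
  have -> : (k`!)%:R * k.+1%:R ^+ j.+1 * (1 + j.+1%:R / k.+1%:R) ^+ j.+1 =
    (k.+1%:R * (1 + j.+1%:R / k.+1%:R)) * ((k`!)%:R * k.+1%:R ^+ j * (1 + j.+1%:R / k.+1%:R) ^+ j) :> R.
    by rewrite !exprS; ring.
  by rewrite ler_pM ?ler0n // ?mulr_ge0 ?exprn_ge0 ?addr_ge0 ?divr_ge0 // ler_wpM2l ?mulr_ge0 ?exprn_ge0.
have Q (t : R) j : 0 <= t <= 1 -> (1 + N%:R * t) ^+ j <= 1 + t * (N.+1%:R ^+ j - 1).
  move=> /andP[t0 t1]; elim: j => [|j IH]; first by rewrite !expr0 subrr mulr0 addr0.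
  have N1 : 0 <= 1 + N%:R * t by rewrite addr_ge0 // mulr_ge0.
  rewrite exprS; apply: le_trans (ler_wpM2l N1 IH) _.
  have X0 : 1 <= (N.+1%:R : R) ^+ j by rewrite exprn_ege1 // ler1n.
  rewrite (exprS N.+1%:R); move: X0; move: (N.+1%:R ^+ j : R) => X X0.
  rewrite -(nat1r N).
  have n0 : 0 <= N%:R :> R by rewrite ler0n.
  have : 0 <= N%:R * t * ((X - 1) * (1 - t)) by rewrite mulr_ge0 // mulr_ge0 // subr_ge0.
  by move: n0 X0; move: (N%:R : R) => n n0 X0; lra.
have k0 : 0 < k.+1%:R :> R by rewrite ltr0n.
have t01 : 0 <= (k.+1%:R^-1 : R) <= 1 by rewrite invr_ge0 ler0n /= invf_le1 // ler1n.
have q := Q _ N t01.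
have p := P N.
have e : (N.+1%:R ^+ N) / k.+1%:R <= (N.+1 ^ N.+1)%:R / (k + N).+1%:R :> R.
  rewrite ler_pdivrMr // mulrAC ler_pdivlMr ?ltr0n // -natrX -!natrM ler_nat expnSr -mulnA leq_mul2l.
  have h : ((k + N).+1 <= N.+1 * k.+1)%N by rewrite mulSn -addSn leq_add2l mulnS leq_addr.
  by apply/orP; right.
rewrite -[X in X <= _]mul1r ler_pdivrMr ?exprn_gt0 //.
rewrite mulrAC mulrAC -mulrA -mulrA mulrCA.
have kN : 0 < k.+1%:R ^+ N :> R by rewrite exprn_gt0.
have : 1 <= ((k + N)`!)%:R^-1 * ((k`!)%:R * k.+1%:R ^+ N * (1 + N%:R / k.+1%:R) ^+ N) :> R.
  by rewrite mulrC ler_pdivlMr // mul1r.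
move=> h; apply: le_trans h _.
have h2 : (1 + N%:R / k.+1%:R) ^+ N <= 1 + (N.+1 ^ N.+1)%:R / (k + N).+1%:R :> R.
  apply: le_trans q _; rewrite lerD2l; apply: le_trans e.
  by rewrite [X in X <= _]mulrC ler_wpM2r ?invr_ge0 // lerBlDr lerDl.
have w0 : 0 <= ((k + N)`!)%:R^-1 * ((k`!)%:R * k.+1%:R ^+ N) :> R.
  by rewrite mulr_ge0 ?invr_ge0 ?ler0n // mulr_ge0 ?ler0n // ltW.
have := ler_wpM2l w0 h2; rewrite -!mulrA => h3; apply: le_trans h3 _.
by rewrite le_eqVlt; apply/orP; left; apply/eqP; ring.
Qed.

Lemma exp_psum_shift_le (z : R) m n : 0 <= z ->
  \sum_(k < n) z ^+ (k + m) / ((k + m)`!)%:R <= expR z.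
Proof.
move=> z0; apply: le_trans (exp_psum_le (n + m) z0).
rewrite -(big_mkord xpredT (fun k => z ^+ (k + m) / ((k + m)`!)%:R)).
rewrite -(big_mkord xpredT (fun k => z ^+ k / (k`!)%:R)).
rewrite (@big_cat_nat _ _ _ m 0 (n + m)) ?leq_addl //=.
have -> : \sum_(m <= k < n + m) z ^+ k / (k`!)%:R = \sum_(0 <= k < n) z ^+ (k + m) / ((k + m)`!)%:R.
  by rewrite -{1}[m]add0n big_addn addnK.
rewrite lerDr.
by apply: sumr_ge0 => i _; rewrite divr_ge0 ?exprn_ge0.
Qed.

Lemma rkum1_upper : exists2 C : R, 0 <= C & forall z : R, 0 < z ->
  rkum1 a b z <= c1 * z `^ (- be) * expR z * (1 + C / z).
Proof.
pose N := (Num.trunc be).+1.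
have bN : be <= N%:R by rewrite ltW // truncnS_gt.
have N0 : 0 < N%:R :> R by exact: lt_le_trans bN.
have f0 m : 0 < (m`!)%:R :> R by rewrite ltr0n fact_gt0.
pose C0 : R := (N.+1 ^ N.+1)%:R.
have C00 : 0 <= C0 by rewrite ler0n.
have c0 : 0 <= be / N%:R by rewrite divr_ge0 ?ltW.
have c0' : 0 <= 1 - be / N%:R by rewrite subr_ge0 ler_pdivrMr // mul1r.
exists (be / N%:R * C0); first by rewrite mulr_ge0.
move=> z z0; have z0' := ltW z0.
apply: (cvgr_to_le (rkum1_cvg a0 ab (x:=z))); apply: nearW => n.
pose T1 (k : nat) : R := z ^+ k / (k`!)%:R.
have term (k : nat) : dcoef (kcoef a b) k * z ^+ k <=
   c1 * z `^ (- be) * ((1 - be / N%:R) * T1 k + be / N%:R * (T1 (k + N)%N + C0 / z * T1 (k + N.+1)%N)).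
  have k0 : 0 < k.+1%:R :> R by rewrite ltr0n.
  have x0 : 0 < a + 1 + k%:R by rewrite ltr_wpDr // addr_gt0.
  have /andP[_ q1] := Gamma_quotient_bounds x0.
  have q2 : (a + 1 + k%:R) `^ (- be) <= k.+1%:R `^ (- be).
    rewrite !powRN lef_pV2 ?posrE ?powR_gt0 // ge0_ler_powR ?nnegrE ?(ltW be0) ?(ltW x0) ?ler0n //.
    by rewrite -nat1r lerD2r lerDr ltW.
  have q3 := powR_le_secant k0 z0 bN.
  have q4 : (z / k.+1%:R) ^+ N <= z ^+ N * ((k`!)%:R / ((k + N)`!)%:R * (1 + C0 / (k + N).+1%:R)).
    by rewrite exprMn exprVn ler_wpM2l ?exprn_ge0 // inv_pow_le.
  have q5 : Gamma (a + 1 + k%:R) / Gamma (a + 1 + k%:R + be) <=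
     z `^ (- be) * (1 - be / N%:R + be / N%:R * (z ^+ N * ((k`!)%:R / ((k + N)`!)%:R * (1 + C0 / (k + N).+1%:R)))).
    apply: le_trans q1 _; apply: le_trans q2 _; apply: le_trans q3 _.
    by rewrite ler_wpM2l ?powR_ge0 // lerD2l ler_wpM2l.
  have w0 : 0 <= c1 * T1 k.
    by apply: mulr_ge0; [exact: ltW|apply: divr_ge0; [exact: exprn_ge0|exact: ler0n]].
  have := ler_wpM2r w0 q5; rewrite dkcoefE.
  set G := Gamma _ / _ => h.
  have -> : c1 * G / (k`!)%:R * z ^+ k = G * (c1 * T1 k) by rewrite /T1; ring.
  apply: le_trans h _; rewrite le_eqVlt; apply/orP; left; apply/eqP.
  rewrite /T1 addnS factS natrM exprS exprD.
  have g1 := f0 k; have g2 := f0 (k + N)%N.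
  have g3 : (k + N).+1%:R != 0 :> R by rewrite pnatr_eq0.
  move: (k`!%:R : R) ((k + N)`!%:R : R) ((k + N).+1%:R : R) g1 g2 g3 => u v w u0 v0 w0'.
  by field; rewrite w0' !gt_eqF.
apply: le_trans (ler_sum _ (fun (k : 'I_n) _ => term k)) _.
rewrite -mulr_sumr big_split /= -!mulr_sumr big_split /= -!mulr_sumr -[X in _ <= X]mulrA.
apply: ler_wpM2l; first by apply: mulr_ge0; [exact: ltW|exact: powR_ge0].
have s1 := exp_psum_le n z0'; have s2 := exp_psum_shift_le N n z0'; have s3 := exp_psum_shift_le N.+1 n z0'.
have cz : 0 <= C0 / z by rewrite divr_ge0.
have -> : expR z * (1 + be / N%:R * C0 / z) =
  (1 - be / N%:R) * expR z + be / N%:R * (expR z + C0 / z * expR z) by ring.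
apply: lerD; first by apply: ler_wpM2l.
apply: ler_wpM2l => //; apply: lerD => //.
by apply: ler_wpM2l.
Qed.

Lemma rkum1_asymp : exists C : R, forall z : R, 0 < z ->
  `|rkum1 a b z * expR (- z) * z `^ be - c1| <= C / z.
Proof.
have [C C0 hC] := rkum1_upper.
exists (c1 * (C + be * (b + 1))) => z z0.
have h1 := rkum1_lower z0; have h2 := hC z z0.
have w : 0 < expR (- z) * z `^ be by rewrite mulr_gt0 ?expR_gt0 ?powR_gt0.
have one : (c1 * z `^ (- be) * expR z) * (expR (- z) * z `^ be) = c1.
  rewrite expRN powRN; field.
  by rewrite !gt_eqF ?expR_gt0 ?powR_gt0.
have k1 := ler_wpM2r (ltW w) h1; have k2 := ler_wpM2r (ltW w) h2.
rewrite mulrAC one in k1; rewrite [X in _ <= X]mulrAC one in k2.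
rewrite -mulrA ler_norml.
have zV : 0 < z^-1 by rewrite invr_gt0.
have b1 : 0 <= be * (b + 1) by apply: mulr_ge0; [exact: ltW|apply: addr_ge0; [exact: ltW|exact: ler01]].
have e1 : 0 <= c1 * C / z by apply: mulr_ge0; [apply: mulr_ge0 => //; exact: ltW|exact: ltW].
have e2 : 0 <= c1 * (be * (b + 1)) / z by apply: mulr_ge0; [apply: mulr_ge0 => //; exact: ltW|exact: ltW].
have E1 : c1 * (1 - be * (b + 1) / z) = c1 - c1 * (be * (b + 1)) / z by ring.
have E2 : c1 * (1 + C / z) = c1 + c1 * C / z by ring.
have E3 : c1 * (C + be * (b + 1)) / z = c1 * C / z + c1 * (be * (b + 1)) / z by ring.
rewrite E1 in k1; rewrite E2 in k2; rewrite E3.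
by apply/andP; split; lra.
Qed.

End KummerAtInfinity.

(** * Part (b) *)

Section ExpansionTerms.
Variable F : fieldType.
Implicit Types a e s : F.

(* With [s = 1 / (xi - 1)] and [e = 1 / b], [mu_t a e s] is the truncated expansion of [f / f'],
   [mu_t_riccati] its defect in the Riccati equation satisfied by [f / f'], and [pi_t a s] the
   first correction to [exp(- b psi) (xi - 1)^(- a) f']. *)
Definition mu_k a s : F := (1 - a) * s - a.
Definition mu_u a e s : F := 1 + e * s * mu_k a s.
Definition mu_t a e s : F := e * (1 + s) * mu_u a e s.
Definition dmu_t a e s : F := e + e ^+ 2 * ((2 * s + 1) * mu_k a s + (s ^+ 2 + s) * (1 - a)).
Definition res1 a s : F := - (2 * a * (1 + s) * mu_k a s) + (2 * s + 1) * mu_k a s + (s ^+ 2 + s) * (1 - a).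
Definition res2 a s : F := a * s * (1 + s) * mu_k a s ^+ 2.
Definition pi_t a s : F := a ^+ 2 * s - a * (1 - a) / 2 * s ^+ 2.


Lemma mu_t_riccati a e s :
  1 - mu_u a e s - a * s * (e * (1 + s)) * mu_u a e s ^+ 2 + s ^+ 2 * dmu_t a e s =
  e ^+ 2 * s ^+ 2 * (res1 a s - e * res2 a s).
Proof. by rewrite /dmu_t /res1 /res2 /mu_u /mu_k; ring. Qed.

End ExpansionTerms.

Section ExpansionBounds.
Variable R : realType.
Local Notation C := (Cplx R).
Variable a : R.

Lemma lbdd_mu_k : lbdd (mu_k (cofR a : C)).
Proof. by rewrite /mu_k; lbdd_auto. Qed.
Lemma lbdd_res1 : lbdd (res1 (cofR a : C)).
Proof. by rewrite /res1 /mu_k; lbdd_auto. Qed.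
Lemma lbdd_res2 : lbdd (res2 (cofR a : C)).
Proof. by rewrite /res2 /mu_k; lbdd_auto. Qed.
Lemma lbdd_pi_t : lbdd (pi_t (cofR a : C)).
Proof. by rewrite /pi_t; lbdd_auto. Qed.

Lemma cofR_mu_k s : cofR (mu_k a s) = mu_k (cofR a) (cofR s) :> C.
Proof. by rewrite /mu_k cofRB cofRM cofRB cofR1. Qed.
Lemma cofR_mu_t e s : cofR (mu_t a e s) = mu_t (cofR a) (cofR e) (cofR s) :> C.
Proof. by rewrite /mu_t /mu_u !cofRM !cofRD !cofRM cofR_mu_k cofR1. Qed.
Lemma cofR_res1 s : cofR (res1 a s) = res1 (cofR a) (cofR s) :> C.
Proof. by rewrite /res1 !(cofRD, cofRN, cofRM, cofRX, cofR_mu_k, cofR1). Qed.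
Lemma cofR_res2 s : cofR (res2 a s) = res2 (cofR a) (cofR s) :> C.
Proof. by rewrite /res2 !(cofRD, cofRM, cofRX, cofR_mu_k, cofR1). Qed.
Lemma cofR_pi_t s : cofR (pi_t a s) = pi_t (cofR a) (cofR s) :> C.
Proof. by rewrite /pi_t !(cofRB, cofRM, cofRX, cofRV, cofR1) (cofR_nat _ 2). Qed.

Lemma real_bound (P : C -> C) (p : R -> R) (tau : R) : lbdd P ->
  (forall s, cofR (p s) = P (cofR s)) ->
  exists2 M : R, 0 <= M & forall s, 0 <= s <= tau -> `|p s| <= M.
Proof.
move=> /(_ tau) [M hM] e; exists `|M| => // s /andP[s0 st].
rewrite -(cmod_ofR (p s)) e; apply: le_trans (ler_norm M).
by apply: hM; rewrite cmod_ofR ger0_norm.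
Qed.

End ExpansionBounds.

Section RealAxis.
Variable R : realType.

Lemma damped_scalar (E zeta q : R -> R) (kap Q t0 t1 : R) : t0 <= t1 -> 0 < kap ->
  (forall t, t0 <= t <= t1 -> is_derive t 1 E (- zeta t * E t + q t)) ->
  (forall t, t0 <= t <= t1 -> kap <= zeta t /\ `|q t| <= Q) ->
  E t1 ^+ 2 <= E t0 ^+ 2 * expR (- kap * (t1 - t0)) + (Q / kap) ^+ 2.
Proof.
move=> t01 k0 hE hb.
have hd t : t0 <= t <= t1 -> is_derive t 1 (fun x => E x ^+ 2) (2 * E t * (- zeta t * E t + q t)).
  by move=> tt; apply: (isd_eq (isdX 2 (hE t tt))); rewrite /= expr1.
have hin t : t0 < t < t1 -> t0 <= t <= t1 by move=> /andP[/ltW -> /ltW ->].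
have := @gronwall R (fun x => E x ^+ 2) (fun t => 2 * E t * (- zeta t * E t + q t)) (- kap)
  (- (Q / kap) ^+ 2) t0 t1 t01.
move=> H; have {H} := H (fun t tt => isd_continuous (hd t tt)) (fun t tt => hd t (hin t tt)).
move=> H.
have h : E t1 ^+ 2 + - (Q / kap) ^+ 2 <= (E t0 ^+ 2 + - (Q / kap) ^+ 2) * expR (- kap * (t1 - t0)).
  apply: H => t /hin tt; have [hz hq] := hb t tt.
  have h1 : 2 * E t * q t <= 2 * `|E t| * Q.
    rewrite -!mulrA ler_pM2l //; apply: le_trans (ler_norm _) _; rewrite normrM.
    by rewrite ler_wpM2l.
  have h2 : 2 * `|E t| * Q <= kap * E t ^+ 2 + kap * (Q / kap) ^+ 2.
    have -> : Q = kap * (Q / kap) by rewrite mulrCA mulfV ?gt_eqF // mulr1.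
    move: (Q / kap) => w; rewrite [in X in _ <= X](mulrC kap w) mulfK ?gt_eqF //.
    rewrite -(real_normK (num_real (E t))).
    have : 0 <= kap * (`|E t| - w) ^+ 2 by rewrite mulr_ge0 ?sqr_ge0 // ltW.
    lra.
  have h3 : kap * E t ^+ 2 <= zeta t * E t ^+ 2 by rewrite ler_wpM2r ?sqr_ge0.
  lra.
have e0 : 0 < expR (- kap * (t1 - t0)) by exact: expR_gt0.
have : 0 <= (Q / kap) ^+ 2 * expR (- kap * (t1 - t0)) by rewrite mulr_ge0 ?sqr_ge0 // ltW.
lra.
Qed.


Lemma expR_decay6 (y : R) : 0 < y -> expR (- y) <= 720 / y ^+ 6.
Proof.
move=> y0; have h : y ^+ 6 / 720 <= expR y.
  apply: le_trans (exp_psum_le 7 (ltW y0)); rewrite big_ord_recr /= lerDr.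
  by apply: sumr_ge0 => i _; rewrite divr_ge0 ?ler0n // exprn_ge0 // ltW.
have c0 : 0 < 720 :> R by rewrite ltr0n.
move: (720 : R) c0 h => c c0 h.
have y6 : 0 < y ^+ 6 / c by rewrite divr_gt0 ?exprn_gt0.
have -> : c / y ^+ 6 = (y ^+ 6 / c)^-1 by rewrite invf_div.
by rewrite expRN lef_pV2 // posrE ?expR_gt0.
Qed.

End RealAxis.

Section RealKummer.
Variable R : realType.
Local Notation C := (Cplx R).
Variables (a b : R).
Hypotheses (a0 : 0 < a) (ab1 : a + 1 <= b).
Let ab : a <= b. Proof. by apply: le_trans ab1; rewrite lerDl. Qed.
Let b0 : 0 < b. Proof. exact: lt_le_trans ab. Qed.

Definition rf0 (x : R) : R := rkum0 a b (b * x).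
Definition rf1 (x : R) : R := b * rkum1 a b (b * x).
Definition rf2 (x : R) : R := b / x * ((x - 1) * rf1 x + a * rf0 x).

Lemma sk0_real x : sk0 a b (cofR x) = cofR (rf0 x) :> C.
Proof. by rewrite /sk0 -cofRM kum0_real. Qed.

Lemma sk1_real x : sk1 a b (cofR x) = cofR (rf1 x) :> C.
Proof. by rewrite /sk1 -cofRM kum1_real // -cofRM. Qed.

Lemma isd_rf0 (x : R) : is_derive x 1 rf0 (rf1 x).
Proof.
have [h _] := cder_sk0 a0 ab (cder_ofR (isd_id x)).
have -> : rf0 = (fun t => cre (sk0 a b (cofR t))).
  by apply/funext => t; rewrite sk0_real cre_ofR.
by apply: (isd_eq h); rewrite cofR1 mul1r sk1_real cre_ofR.
Qed.

Lemma isd_rf1 (x : R) : 0 < x -> is_derive x 1 rf1 (rf2 x).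
Proof.
move=> x0; have [h _] := cder_sk1 a0 ab (cder_ofR (isd_id x)).
have -> : rf1 = (fun t => cre (sk1 a b (cofR t))).
  by apply/funext => t; rewrite sk1_real cre_ofR.
apply: (isd_eq h); rewrite cofR1 mul1r.
have := congr1 (@cre R) (sk_ode a0 ab (cofR x)).
rewrite creZ sk0_real sk1_real -cofR1 -cofRB -!cofRM -cofRD -cofRM cre_ofR => e.
have x0' : x != 0 by rewrite gt_eqF.
apply: (mulfI x0').
by rewrite e /rf2; move: (rf1 x) (rf0 x) => u v; field.
Qed.

Lemma rf0_gt0 x : 0 <= x -> 0 < rf0 x.
Proof. by move=> x0; apply: rkum0_gt0 => //; rewrite mulr_ge0 // ltW. Qed.

Lemma rf1_ge x : 0 <= x -> a * rf0 x <= rf1 x.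
Proof. by move=> x0; apply: rkum1_ge => //; rewrite mulr_ge0 // ltW. Qed.

Lemma rf1_gt0 x : 0 <= x -> 0 < rf1 x.
Proof. by move=> x0; apply: lt_le_trans (rf1_ge x0); rewrite mulr_gt0 ?rf0_gt0. Qed.

Definition rmu x := rf0 x / rf1 x.

Lemma rmu_bounds x : 0 <= x -> 0 <= rmu x <= a^-1.
Proof.
move=> x0; have f0 := rf0_gt0 x0; have f1 := rf1_gt0 x0; apply/andP; split.
  by rewrite divr_ge0 // ltW.
by rewrite ler_pdivrMr // ler_pdivlMl // rf1_ge.
Qed.

Lemma isd_rmu (x : R) : 0 < x ->
  is_derive x 1 rmu (1 - b * (x - 1) / x * rmu x - a * b / x * rmu x ^+ 2).
Proof.
move=> x0; have f1 := rf1_gt0 (ltW x0); have f10 : rf1 x != 0 by rewrite gt_eqF.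
have x0' : x != 0 by rewrite gt_eqF.
apply: (isd_eq (isdM (isd_rf0 x) (isdV (f := rf1) f10 (isd_rf1 x0)))).
by rewrite /rmu /rf2; field; rewrite f10 x0'.
Qed.

Definition rs (x : R) : R := (x - 1)^-1.

Lemma isd_rs (x : R) : 1 < x -> is_derive x 1 rs (- rs x ^+ 2).
Proof.
move=> x1; have h : x - 1 != 0 by rewrite subr_eq0 gt_eqF.
apply: (isd_eq (isdV (f := fun t => t - 1) h (isdB (isd_id x) (isd_cst 1 x)))).
by rewrite subr0 mulN1r /rs exprVn.
Qed.

Lemma isd_mu_t e (x : R) : 1 < x -> is_derive x 1 (fun t => mu_t a e (rs t)) (- (rs x ^+ 2 * dmu_t a e (rs x))).
Proof.
move=> x1; have h := isd_rs x1.
rewrite /mu_t /mu_u /mu_k.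
have h1 := isdD (isd_cst 1 x) h.
have h2 := isdB (isdZ (1 - a) h) (isd_cst a x).
have h3 := isdD (isd_cst 1 x) (isdM (isdZ e h) h2).
by apply: (isd_eq (isdM (isdZ e h1) h3)); rewrite /dmu_t /mu_k; ring.
Qed.

Definition rE x := (x - 1) ^+ 2 * (rmu x - mu_t a b^-1 (rs x)).
Definition rzeta x := b / (1 + rs x) + a * b * rs x / (1 + rs x) * (rmu x + mu_t a b^-1 (rs x)) - 2 * rs x.

Lemma isd_rE (x : R) : 1 < x -> is_derive x 1 rE
  (- rzeta x * rE x + b^-1 ^+ 2 * (res1 a (rs x) - b^-1 * res2 a (rs x))).
Proof.
move=> x1; have x0 : 0 < x by exact: lt_trans x1.
have s0 : 0 < rs x by rewrite invr_gt0 subr_gt0.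
have hx : x = 1 + (rs x)^-1 by rewrite /rs invrK; ring.
have h := isdM (isdX 2 (isdB (isd_id x) (isd_cst 1 x))) (isdB (isd_rmu x0) (isd_mu_t b^-1 x1)).
apply: (isd_eq h).
have R1 := mu_t_riccati a b^-1 (rs x).
have hd : rs x ^+ 2 * dmu_t a b^-1 (rs x) = b^-1 ^+ 2 * rs x ^+ 2 * (res1 a (rs x) - b^-1 * res2 a (rs x))
  - (1 - mu_u a b^-1 (rs x) - a * rs x * (b^-1 * (1 + rs x)) * mu_u a b^-1 (rs x) ^+ 2).
  by rewrite -R1; ring.
rewrite /= expr1 subr0 mulr1 hd /rE /rzeta.
have xm : x - 1 = (rs x)^-1 by rewrite /rs invrK.
have s10 : 1 + rs x != 0 by rewrite gt_eqF // addr_gt0.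
have s20 : rs x != 0 by rewrite gt_eqF.
have xV : x^-1 = rs x / (1 + rs x).
  by rewrite {1}hx; move: (rs x) s10 s20 => s h1 h2; field; rewrite h1 h2.
have xr : b * (x - 1) / x = b / (1 + rs x).
  by rewrite xm xV; move: (rs x) s10 s20 => s h1 h2; field; rewrite h1 h2.
have xr2 : a * b / x = a * b * rs x / (1 + rs x).
  by rewrite xV mulrA.
rewrite xr xr2 xm /mu_t.
move: (rmu x) (res1 a (rs x) - b^-1 * res2 a (rs x)) (mu_u a b^-1 (rs x)) (rs x) s0 => m r u s s0.
have s1 : 1 + s != 0 by rewrite gt_eqF // addr_gt0.
have s2 : s != 0 by rewrite gt_eqF.
have bn : b != 0 by rewrite gt_eqF.
by field; rewrite bn s2 s1.
Qed.

End RealKummer.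

Section RealAxisAsymptotics.
Variable R : realType.
Variables (a : R).
Hypothesis a0 : 0 < a.

Lemma rs_bounds (eta x : R) : 0 < eta -> 1 + eta <= x -> 0 < rs x /\ rs x <= eta^-1.
Proof.
move=> e0 hx; have h : eta <= x - 1 by rewrite lerBrDl.
have h0 : 0 < x - 1 by exact: lt_le_trans h.
by rewrite /rs invr_gt0 h0 lef_pV2 ?posrE.
Qed.

Lemma rmu_asymp (eta : R) : 0 < eta -> exists K b1 : R, [/\ 0 <= K, 1 <= b1, a + 1 <= b1 &
  forall b x : R, b1 <= b -> 1 + 2 * eta <= x ->
  `|rmu a b x - mu_t a b^-1 (rs x)| <= K * b^-1 ^+ 3 * rs x ^+ 2].
Proof.
move=> e0; pose tau := eta^-1; have t0 : 0 < tau by rewrite invr_gt0.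
have [M0 M00 H0] := real_bound tau (lbdd_mu_k a) (cofR_mu_k a).
have [M1 M10 H1] := real_bound tau (lbdd_res1 a) (cofR_res1 a).
have [M2 M20 H2] := real_bound tau (lbdd_res2 a) (cofR_res2 a).
have [kap kE] : exists k, k = (2 * (1 + tau))^-1 by eexists.
have k0 : 0 < kap by rewrite kE invr_gt0 mulr_gt0 // addr_gt0.
pose C0 := eta ^+ 2 * (a^-1 + (1 + tau) * 2).
have C00 : 0 <= C0 by rewrite mulr_ge0 ?sqr_ge0 // addr_ge0 ?invr_ge0 ?(ltW a0) // mulr_ge0 // addr_ge0 // ltW.
have [c1 c1E] : exists c, c = 4 * tau * (1 + tau) by eexists.
have [c2 c2E] : exists c, c = tau * M0 by eexists.
have c10 : 0 <= c1 by rewrite c1E !mulr_ge0 ?addr_ge0 // ltW.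
have c20 : 0 <= c2 by rewrite c2E mulr_ge0 // ltW.
pose V := 720 / (kap * eta) ^+ 6.
have V0 : 0 <= V by rewrite divr_ge0 ?exprn_ge0 ?mulr_ge0 ?ler0n // ltW.
pose W := (M1 + M2) / kap.
pose K0 := C0 ^+ 2 * V + W ^+ 2.
have K00 : 0 <= K0 by rewrite addr_ge0 ?sqr_ge0 // mulr_ge0 // sqr_ge0.
exists (K0 + 1), (1 + a + c1 + c2); split.
- by rewrite addr_ge0.
- by rewrite -!addrA lerDl !addr_ge0 // ltW.
- by rewrite (addrC a) -addrA lerDl addr_ge0.
move=> b x hb hx.
have b1 : 1 <= b by apply: le_trans hb; rewrite -!addrA lerDl !addr_ge0 // ltW.
have bc1 : c1 <= b by move: hb c20 a0; clear; lra.
have bc2 : c2 <= b by move: hb c10 a0; clear; lra.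
have ab1 : a + 1 <= b by move: hb c10 c20; clear; lra.
have b0 : 0 < b by move: b1; clear; lra.
have eb0 : 0 < b^-1 by rewrite invr_gt0.
have eb1 : b^-1 <= 1 by rewrite invf_le1.
have bc2' : b^-1 * c2 <= 1 by rewrite ler_pdivrMl // mulr1.
have hs t : 1 + eta <= t -> 0 <= rs t <= tau.
  by move=> /(rs_bounds e0)[/ltW -> ->].
have hu t : 1 + eta <= t -> `|b^-1 * rs t * mu_k a (rs t)| <= 1.
  move=> /hs tt; apply: le_trans bc2'; rewrite c2E normrM (normrM b^-1) (ger0_norm (ltW eb0)) -mulrA ler_pM2l //.
  have /andP[s0 s1] := tt.
  by apply: ler_pM => //; [rewrite ger0_norm|exact: H0].
have hm t : 1 + eta <= t -> 0 <= mu_t a b^-1 (rs t) <= b^-1 * (1 + tau) * 2.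
  move=> tt; have := hu t tt; rewrite ler_norml => /andP[u1 u2].
  have /andP[s0 s1] := hs t tt.
  rewrite /mu_t /mu_u; apply/andP; split.
    by apply: mulr_ge0; [apply: mulr_ge0; [exact: ltW|exact: addr_ge0]|lra].
  apply: ler_pM; [|lra| |lra].
  - by apply: mulr_ge0; [exact: ltW|exact: addr_ge0].
  - by rewrite ler_pM2l // lerD2l.
have hE t : 1 + eta <= t -> is_derive t 1 (rE a b)
    (- rzeta a b t * rE a b t + b^-1 ^+ 2 * (res1 a (rs t) - b^-1 * res2 a (rs t))).
  by move=> tt; apply: isd_rE => //; lra.
have hz t : 1 + eta <= t -> b * kap <= rzeta a b t.
  move=> tt; have /andP[s0 s1] := hs t tt; have /andP[m0 _] := hm t tt.
  have t0' : 0 <= t by lra.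
  have /andP[r0 _] := @rmu_bounds R a b a0 ab1 t t0'.
  have n0 : 0 <= a * b * rs t / (1 + rs t) * (rmu a b t + mu_t a b^-1 (rs t)).
    apply: mulr_ge0; last exact: addr_ge0.
    apply: mulr_ge0; last by rewrite invr_ge0 addr_ge0.
    by apply: mulr_ge0 => //; apply: mulr_ge0; exact: ltW.
  have n1 : b * (2 * kap) <= b / (1 + rs t).
    have k2 : 2 * kap = (1 + tau)^-1 by rewrite kE invfM mulrA mulfV ?mul1r ?pnatr_eq0.
    rewrite ler_pM2l // k2 lef_pV2 ?lerD2l // posrE; first by apply: addr_gt0.
    by apply: ltr_wpDr.
  have n2 : 2 * rs t <= b * kap.
    apply: le_trans (_ : c1 * kap <= _); last by rewrite ler_pM2r.
    apply: le_trans (_ : 2 * tau <= _); first by rewrite ler_pM2l.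
    rewrite le_eqVlt; apply/orP; left; apply/eqP; rewrite kE c1E; field.
    by rewrite gt_eqF // addr_gt0.
  rewrite /rzeta; move: n0 n1 n2; move: (_ * _ * _ / _ * _) (b / _) => u v; lra.
have hq t : 1 + eta <= t -> `|b^-1 ^+ 2 * (res1 a (rs t) - b^-1 * res2 a (rs t))| <= b^-1 ^+ 2 * (M1 + M2).
  move=> /hs tt; rewrite normrM ger0_norm ?sqr_ge0 // ler_wpM2l ?sqr_ge0 //.
  apply: le_trans (ler_normB _ _) _; apply: lerD; first exact: H1.
  rewrite normrM (ger0_norm (ltW eb0)) -[M2]mul1r; apply: ler_pM => //; [exact: ltW|exact: H2].
have x01 : 1 + eta <= x by lra.
have bk0 : 0 < b * kap by rewrite mulr_gt0.
have := @damped_scalar R (rE a b) (rzeta a b) (fun t => b^-1 ^+ 2 * (res1 a (rs t) - b^-1 * res2 a (rs t)))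
  (b * kap) (b^-1 ^+ 2 * (M1 + M2)) (1 + eta) x x01 bk0
  (fun t tt => hE t (proj1 (andP tt))) (fun t tt => conj (hz t (proj1 (andP tt))) (hq t (proj1 (andP tt)))).
move=> hD.
have hE0 : rE a b (1 + eta) ^+ 2 <= C0 ^+ 2.
  have tt : 1 + eta <= 1 + eta by [].
  have t0' : 0 <= 1 + eta by lra.
  have /andP[r0 r1] := @rmu_bounds R a b a0 ab1 _ t0'; have /andP[m0 m1] := hm _ tt.
  rewrite -(real_normK (num_real (rE _ _ _))) lerXn2r ?nnegrE // /rE normrM.
  have -> : 1 + eta - 1 = eta by ring.
  rewrite ger0_norm ?sqr_ge0 // /C0 ler_wpM2l ?sqr_ge0 //.
  have m2 : mu_t a b^-1 (rs (1 + eta)) <= (1 + tau) * 2.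
    apply: le_trans m1 _; rewrite -mulrA; apply: ler_piMl eb1.
    by apply: mulr_ge0 => //; apply: addr_ge0 => //; exact: ltW.
  apply: le_trans (ler_normB _ _) _; rewrite !ger0_norm //; exact: lerD.
have hX : expR (- (b * kap) * (x - (1 + eta))) <= b^-1 ^+ 6 * V.
  apply: le_trans (_ : expR (- (b * kap * eta)) <= _).
    rewrite ler_expR mulNr lerN2 ler_pM2l //; lra.
  apply: le_trans (expR_decay6 _) _; first by rewrite mulr_gt0.
  have -> : (b * kap * eta) ^+ 6 = b ^+ 6 * (kap * eta) ^+ 6 by rewrite -exprMn mulrA.
  by rewrite /V exprVn invfM mulrCA.
have hfin : rE a b x ^+ 2 <= (b^-1 ^+ 3 * (K0 + 1)) ^+ 2.
  apply: le_trans hD _; apply: le_trans (_ : b^-1 ^+ 6 * K0 <= _).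
    have e2 : b^-1 ^+ 2 * (M1 + M2) / (b * kap) = b^-1 ^+ 3 * W.
      by rewrite /W invfM; ring.
    rewrite e2.
    have e3 : b^-1 ^+ 6 * K0 = C0 ^+ 2 * (b^-1 ^+ 6 * V) + (b^-1 ^+ 3 * W) ^+ 2 by rewrite /K0; ring.
    rewrite e3; apply: lerD => //.
    by apply: ler_pM (sqr_ge0 _) (expR_ge0 _) hE0 hX.
  have -> : (b^-1 ^+ 3 * (K0 + 1)) ^+ 2 = b^-1 ^+ 6 * (K0 + 1) ^+ 2 by ring.
  rewrite ler_wpM2l ?exprn_ge0 ?(ltW eb0) //.
  have := sqr_ge0 K0; move: K00; clear; rewrite !expr2; lra.
have p0 : 0 <= b^-1 ^+ 3 * (K0 + 1) by apply: mulr_ge0; [apply: exprn_ge0; exact: ltW|exact: addr_ge0].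
have hab : `|rE a b x| <= b^-1 ^+ 3 * (K0 + 1).
  by rewrite -(@ler_pXn2r _ 2) ?nnegrE // (real_normK (num_real _)).
have s0 : 0 < x - 1 by lra.
have e4 : rmu a b x - mu_t a b^-1 (rs x) = rE a b x * rs x ^+ 2.
  rewrite /rE; move: (rmu a b x - _) => w; rewrite /rs; field; by rewrite gt_eqF.
rewrite e4 normrM (ger0_norm (sqr_ge0 _)) (mulrC (K0 + 1)).
by rewrite ler_wpM2r ?sqr_ge0.
Qed.

End RealAxisAsymptotics.

Section RealAxisConstant.
Variable R : realType.
Variables (a b : R).
Hypotheses (a0 : 0 < a) (ab1 : a + 1 <= b).
Let b0 : 0 < b.
Proof. by apply: lt_le_trans ab1; rewrite addr_gt0. Qed.

Definition rL (x : R) : R :=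
  ln (rf1 a b x) - b * (x - 1 - ln x) - a * ln (x - 1) - b^-1 * pi_t a (rs x).

Lemma isd_pi_t (e x : R) : 1 < x -> is_derive x 1 (fun t => e * pi_t a (rs t))
  (e * (- rs x ^+ 2 * (a ^+ 2 - a * (1 - a) * rs x))).
Proof.
move=> x1; have h := isd_rs x1; rewrite /pi_t.
apply: (isd_eq (isdZ e (isdB (isdZ (a ^+ 2) h) (isdZ (a * (1 - a) / 2) (isdX 2 h))))).
by rewrite /= expr1; field.
Qed.

Lemma isd_rL (x : R) : 1 < x -> is_derive x 1 rL
  (a * b * rs x / (1 + rs x) * (rmu a b x - mu_t a b^-1 (rs x))).
Proof.
move=> x1; have x0 : 0 < x by exact: lt_trans x1.
have xm : 0 < x - 1 by rewrite subr_gt0.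
have f1 := rf1_gt0 a0 ab1 (ltW x0).
have s0 : 0 < rs x by rewrite invr_gt0.
have d1 := isd_ln (g := rf1 a b) f1 (isd_rf1 a0 ab1 x0).
have d2 := isdZ b (isdB (isdB (isd_id x) (isd_cst 1 x)) (isd_ln (g := fun t => t) x0 (isd_id x))).
have d3 := isdZ a (isd_ln (g := fun t => t - 1) xm (isdB (isd_id x) (isd_cst 1 x))).
have d4 := isd_pi_t b^-1 x1.
apply: (isd_eq (isdB (isdB (isdB d1 d2) d3) d4)).
have e1 : rf2 a b x / rf1 a b x = b / x * ((x - 1) + a * rmu a b x).
  rewrite /rf2 /rmu; move: (rf1 a b x) (rf0 a b x) f1 => u v u0; field.
  by rewrite !gt_eqF.
rewrite e1; have hx : x = 1 + (rs x)^-1 by rewrite /rs invrK; ring.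
have hm : x - 1 = (rs x)^-1 by rewrite /rs invrK.
have s10 : 1 + rs x != 0 by rewrite gt_eqF // addr_gt0.
have s20 : rs x != 0 by rewrite gt_eqF.
have xV : x^-1 = rs x / (1 + rs x).
  by rewrite {1}hx; move: (rs x) s10 s20 => s h1 h2; field; rewrite h1 h2.
rewrite xV hm /mu_t /mu_u /mu_k; move: (rmu a b x) (rs x) s10 s20 => m s h1 h2.
have bn : b != 0 by rewrite gt_eqF.
by field; rewrite bn h1 h2.
Qed.

Definition rLam : R := ln (Gamma b / Gamma a) + ln b + b + (a - b) * ln b.

Lemma cvg_harmonic_dist (u : nat -> R) (g K : R) :
  (forall n, `|u n - g| <= K * harmonic n) -> u @ \oo --> g.
Proof.
move=> h.
have hK : (fun n => K * harmonic n) @ \oo --> K * 0.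
  by apply: cvgM; [exact: cvg_cst|exact: cvg_harmonic].
have hm : (fun n => g - K * harmonic n) @ \oo --> g - K * 0 by apply: cvgB hK; exact: cvg_cst.
have hp : (fun n => g + K * harmonic n) @ \oo --> g + K * 0 by apply: cvgD hK; exact: cvg_cst.
rewrite mulr0 subr0 in hm; rewrite mulr0 addr0 in hp.
apply: (squeeze_cvgr _ hm hp).
by apply: nearW => n; have := h n; rewrite ler_distl.
Qed.

Let X (n : nat) : R := n%:R + 2.

Let rs_X n : rs (X n) = harmonic n.
Proof. by rewrite /rs /harmonic /= /X -natr1; congr (_^-1); ring. Qed.

Lemma rL_cvg : (fun n => rL (X n)) @ \oo --> rLam.
Proof.
have g0 : 0 < Gamma b / Gamma a by rewrite divr_gt0 // Gamma_gt0.
have [K hK] := rkum1_asymp a0 ab1.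
pose W (z : R) := rkum1 a b z * expR (- z) * z `^ (b - a).
have X0 n : 0 < X n by rewrite ltr_wpDl.
have bX n : 0 < b * X n by rewrite mulr_gt0.
have cW : (fun n => W (b * X n)) @ \oo --> Gamma b / Gamma a.
  apply: (@cvg_harmonic_dist _ _ (`|K| / b)) => n.
  apply: le_trans (hK _ (bX n)) _; rewrite invfM mulrA.
  apply: le_trans (_ : `|K| / b / X n <= _).
    by rewrite ler_wpM2r ?invr_ge0 ?(ltW (X0 n)) // ler_wpM2r ?invr_ge0 ?(ltW b0) // ler_norm.
  rewrite ler_wpM2l ?divr_ge0 ?(ltW b0) // /harmonic /= lef_pV2 ?posrE // /X -natr1.
  by rewrite lerD2l ler1n.
have clW : (fun n => ln (W (b * X n))) @ \oo --> ln (Gamma b / Gamma a).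
  exact: (continuous_cvg _ (h := @ln R) (continuous_ln g0) cW).
pose G (s : R) := a * ln (1 + s) - b^-1 * pi_t a s.
have cG : (fun n => G (harmonic n)) @ \oo --> G 0.
  apply: (continuous_cvg _ (h := G) _ (@cvg_harmonic R)).
  have p1 : 0 < (1 + 0 : R) by rewrite addr0.
  rewrite /G /pi_t.
  apply: (isd_continuous (isdB (isdZ a (isd_ln (g := fun t => 1 + t) p1 (isdD (isd_cst 1 0) (isd_id 0))))
   (isdZ b^-1 (isdB (isdZ (a ^+ 2) (isd_id 0)) (isdZ (a * (1 - a) / 2) (isdX 2 (isd_id 0))))))).
have G0 : G 0 = 0.
  by rewrite /G addr0 ln1 /pi_t expr0n !mulr0 subrr mulr0 subrr.
rewrite G0 in cG.
have e n : rL (X n) = ln (W (b * X n)) + (ln b + b + (a - b) * ln b) + G (harmonic n).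
  have w0 := @rf1_gt0 R a b a0 ab1 (X n) (ltW (X0 n)).
  have r0 : 0 < rkum1 a b (b * X n) by move: w0; rewrite /rf1 pmulr_rgt0.
  have x1 : 0 < X n - 1.
    have -> : X n - 1 = n%:R + 1 by rewrite /X; ring.
    by rewrite ltr_wpDl.
  rewrite /rL /rf1 /W /G -rs_X.
  have -> : 1 + rs (X n) = X n / (X n - 1) by rewrite /rs; field; rewrite gt_eqF.
  rewrite (lnM (x := rkum1 a b (b * X n) * _)) ?posrE ?mulr_gt0 ?expR_gt0 ?powR_gt0 //.
  rewrite (lnM (x := rkum1 a b (b * X n))) ?posrE ?expR_gt0 //.
  rewrite expRK ln_powR (lnM (x := b) (y := X n)) ?posrE // (lnM (x := b)) ?posrE //.
  rewrite (lnM (x := X n)) ?posrE ?invr_gt0 // lnV ?posrE //; ring.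
have -> : (fun n => rL (X n)) = (fun n => ln (W (b * X n)) + (ln b + b + (a - b) * ln b) + G (harmonic n)).
  by apply/funext => n; exact: e.
have -> : rLam = ln (Gamma b / Gamma a) + (ln b + b + (a - b) * ln b) + 0.
  by rewrite /rLam addr0 !addrA.
apply: cvgD cG; apply: cvgD clW _; exact: cvg_cst.
Qed.

Lemma rL_near (x0 Kp : R) : 1 < x0 ->
  (forall x, x0 <= x -> `|a * b * rs x / (1 + rs x) * (rmu a b x - mu_t a b^-1 (rs x))| <= Kp * rs x ^+ 2) ->
  forall x, x0 <= x -> `|rL x - rLam| <= Kp * rs x.
Proof.
move=> x01 hb x hx; have x1 : 1 < x by exact: lt_le_trans hx.
pose D t := a * b * rs t / (1 + rs t) * (rmu a b t - mu_t a b^-1 (rs t)).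
have dU sg t : x <= t -> is_derive t 1 (fun t => rL t + sg * rs t) (D t - sg * rs t ^+ 2).
  move=> xt; have t1 : 1 < t by exact: lt_le_trans xt.
  by apply: (isd_eq (isdD (isd_rL t1) (isdZ sg (isd_rs t1)))); rewrite mulrN.
have hD t : x <= t -> - (Kp * rs t ^+ 2) <= D t <= Kp * rs t ^+ 2.
  by move=> xt; rewrite -ler_norml; apply: hb; exact: le_trans xt.
have up n : x <= X n -> rL (X n) + Kp * rs (X n) <= rL x + Kp * rs x.
  move=> xX; apply: (@nonincr_of_derive R (fun t => rL t + Kp * rs t) (fun t => D t - Kp * rs t ^+ 2)) => //.
  - by move=> t /andP[xt _]; exact: isd_continuous (dU Kp t xt).
  - by move=> t /andP[/ltW xt _]; exact: dU.
  - by move=> t /andP[/ltW /hD /andP[_ h] _]; rewrite subr_le0.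
have dn n : x <= X n -> rL x + - Kp * rs x <= rL (X n) + - Kp * rs (X n).
  move=> xX; apply: (@nondecr_of_derive R (fun t => rL t + - Kp * rs t) (fun t => D t - - Kp * rs t ^+ 2)) => //.
  - by move=> t /andP[xt _]; exact: isd_continuous (dU (- Kp) t xt).
  - by move=> t /andP[/ltW xt _]; exact: dU.
  - by move=> t /andP[/ltW /hD /andP[h _] _]; rewrite mulNr opprK; move: h; lra.
have cU sg : (fun n => rL (X n) + sg * rs (X n)) @ \oo --> rLam.
  have eh : (fun n => rs (X n)) = @harmonic R by apply/funext => n; exact: rs_X.
  have h : (fun n => sg * rs (X n)) @ \oo --> sg * 0.
    by apply: cvgM; [exact: cvg_cst|rewrite eh; exact: cvg_harmonic].
  by rewrite mulr0 in h; rewrite -[rLam]addr0; apply: cvgD rL_cvg h.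
have ev : \forall n \near \oo, x <= X n.
  exists (Num.trunc x).+1 => // n /= hn.
  apply: le_trans (ltW (truncnS_gt x)) _.
  have h : (Num.trunc x).+1%:R <= n%:R :> R by rewrite ler_nat.
  by apply: le_trans h _; rewrite /X lerDl.
have h1 : rLam <= rL x + Kp * rs x.
  by apply: (cvgr_to_le (cU Kp)); near=> n; apply: up; near: n.
have h2 : rL x + - Kp * rs x <= rLam.
  by apply: (cvgr_to_ge (cU (- Kp))); near=> n; apply: dn; near: n.
by rewrite ler_distl; apply/andP; split; lra.
Unshelve. all: by end_near. Qed.

End RealAxisConstant.

Section RealAxisFinal.
Variable R : realType.
Variable a : R.
Hypothesis a0 : 0 < a.

(* the limit of [exp(- b psi) (xi - 1)^(- a) f'] as [xi] tends to infinity along the real axis *)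
Definition conK (b : R) : R := b * (Gamma b / Gamma a * b `^ (a - b) * expR b).

Lemma expR_rLam b : 0 < b -> expR (rLam a b) = conK b.
Proof.
move=> b0; have g0 : 0 < Gamma b / Gamma a by rewrite divr_gt0 // Gamma_gt0.
rewrite /rLam !expRD lnK ?posrE // lnK ?posrE // /conK.
have -> : expR ((a - b) * ln b) = b `^ (a - b) by rewrite /powR gt_eqF.
ring.
Qed.

Lemma real_axis (eta : R) : 0 < eta -> exists K b1 : R, [/\ 0 <= K, 1 <= b1, a + 1 <= b1 &
  forall b x : R, b1 <= b -> 1 + 2 * eta <= x ->
  let w := expR (- b * (x - 1 - ln x)) * expR (- a * ln (x - 1)) in
  `|rf1 a b x * w - conK b * (1 + b^-1 * pi_t a (rs x))| <= K * b^-1 ^+ 2 * conK b /\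
  `|(rf0 a b x - mu_t a b^-1 (rs x) * rf1 a b x) * w| <= K * b^-1 ^+ 3 * conK b].
Proof.
move=> e0; have [K [b1 [K0 b11 ab1 H]]] := rmu_asymp a0 e0.
pose tau := eta^-1; have t0 : 0 < tau by rewrite invr_gt0.
have [P P0 HP] := real_bound tau (lbdd_pi_t a) (cofR_pi_t a).
have [P' PE] : exists p, p = P + a * K * tau ^+ 2 by eexists.
have PP : P <= P' by rewrite PE lerDl mulr_ge0 ?sqr_ge0 // mulr_ge0 // ltW.
have P'0 : 0 <= P' by exact: le_trans PP.
have P'K : a * K * tau ^+ 2 <= P' by rewrite PE lerDr.
exists (2 * P' ^+ 2 + P' + 2 * K * tau ^+ 2), (b1 + 2 * P'); split.
- by apply: addr_ge0; [apply: addr_ge0 => //|]; apply: mulr_ge0 => //; [exact: sqr_ge0|exact: mulr_ge0|exact: sqr_ge0].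
- by apply: le_trans b11 _; rewrite lerDl mulr_ge0.
- by apply: le_trans ab1 _; rewrite lerDl mulr_ge0.
move=> b x hb hx.
have bb1 : b1 <= b by apply: le_trans hb; rewrite lerDl mulr_ge0.
have bP : 2 * P' <= b by apply: le_trans hb; rewrite lerDr (le_trans _ b11).
have b1' : 1 <= b by exact: le_trans bb1.
have ab1' : a + 1 <= b by exact: le_trans bb1.
have b0 : 0 < b by exact: lt_le_trans b1'.
have eb0 : 0 < b^-1 by rewrite invr_gt0.
have x1 : 1 < 1 + 2 * eta by rewrite ltrDl mulr_gt0.
have hs t : 1 + 2 * eta <= t -> 0 < rs t /\ rs t <= tau.
  move=> tt; apply: rs_bounds => //; apply: le_trans tt; rewrite lerD2l mulrDl mul1r lerDl ltW //.
have near := @rL_near R a b a0 ab1' (1 + 2 * eta) (a * K * tau * b^-1 ^+ 2) x1.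
have {near} near : `|rL a b x - rLam a b| <= a * K * tau * b^-1 ^+ 2 * rs x.
  apply: near => // t tt; have [s0 s1] := hs t tt; rewrite normrM.
  have e3 : a * K * tau * b^-1 ^+ 2 * rs t ^+ 2 = (a * b * tau) * (K * b^-1 ^+ 3 * rs t ^+ 2).
    by move: (rs t) => s; field; rewrite gt_eqF.
  rewrite e3; apply: ler_pM => //; last exact: H.
  have s10 : 0 < 1 + rs t by rewrite addr_gt0.
  have p0 : 0 <= a * b * rs t by apply: mulr_ge0; [apply: mulr_ge0|]; exact: ltW.
  rewrite ger0_norm; last by rewrite divr_ge0 // ltW.
  apply: le_trans (_ : a * b * rs t <= _); last by rewrite ler_wpM2l // mulr_ge0 // ltW.
  by rewrite ler_pdivrMr // ler_peMr // lerDl ltW.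
have [s0 s1] := hs x hx.
have x0 : 0 <= x by lra.
have f1 := rf1_gt0 a0 ab1' x0.
have C0 : 0 < conK b by rewrite -expR_rLam // expR_gt0.
set w := _ * _.
have w0 : 0 < w by rewrite mulr_gt0 ?expR_gt0.
have [u uE] : exists u, u = b^-1 * pi_t a (rs x) + (rL a b x - rLam a b) by eexists.
have ew : rf1 a b x * w = conK b * expR u.
  rewrite -expR_rLam // -expRD uE /w -expRD -{1}(lnK (x := rf1 a b x)) ?posrE // -expRD.
  by congr expR; rewrite /rL; ring.
have hpi : `|pi_t a (rs x)| <= P by apply: HP; rewrite ltW.
have hd : `|rL a b x - rLam a b| <= P' * b^-1 ^+ 2.
  apply: le_trans near _.
  have -> : a * K * tau * b^-1 ^+ 2 * rs x = a * K * tau * rs x * b^-1 ^+ 2 by ring.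
  rewrite ler_wpM2r ?sqr_ge0 //; apply: le_trans P'K.
  by rewrite expr2 mulrA ler_wpM2l // mulr_ge0 ?(ltW t0) // mulr_ge0 // ltW.
have hu : `|u| <= P' * b^-1.
  rewrite uE; apply: le_trans (ler_normD _ _) _.
  have h1 : `|b^-1 * pi_t a (rs x)| <= P * b^-1.
    by rewrite normrM ger0_norm ?(ltW eb0) // mulrC ler_wpM2r // ltW.
  have h2 : `|rL a b x - rLam a b| <= a * K * tau ^+ 2 * b^-1.
    apply: le_trans near _.
    have -> : a * K * tau * b^-1 ^+ 2 * rs x = a * K * tau * b^-1 * (b^-1 * rs x) by ring.
    have -> : a * K * tau ^+ 2 * b^-1 = a * K * tau * b^-1 * tau by ring.
    apply: ler_wpM2l; first by apply: mulr_ge0; [apply: mulr_ge0; [apply: mulr_ge0|]|]; rewrite // ltW.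
    apply: le_trans s1; rewrite ler_piMl ?(ltW s0) // invf_le1 //.
  by rewrite PE mulrDl; exact: lerD.
have hu2 : `|u| <= 2^-1.
  apply: le_trans hu _; rewrite ler_pdivrMr // ler_pdivlMl //.
have u2 : u <= 2^-1 by exact: le_trans (ler_norm u) hu2.
have hx2 := expR_2nd u2.
have usq : u ^+ 2 <= P' ^+ 2 * b^-1 ^+ 2.
  rewrite -exprMn -(real_normK (num_real u)) lerXn2r ?nnegrE // mulr_ge0 // ltW //.
split.
  rewrite ew.
  have -> : conK b * expR u - conK b * (1 + b^-1 * pi_t a (rs x)) =
     ((expR u - 1 - u) + (rL a b x - rLam a b)) * conK b by rewrite uE; ring.
  rewrite normrM (ger0_norm (ltW C0)) ler_wpM2r ?(ltW C0) //.
  apply: le_trans (ler_normD _ _) _.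
  apply: le_trans (lerD hx2 hd) _.
  have q : 0 <= 2 * K * tau ^+ 2 * b^-1 ^+ 2.
    by apply: mulr_ge0 (sqr_ge0 _); apply: mulr_ge0 (sqr_ge0 _); exact: mulr_ge0.
  have -> : (2 * P' ^+ 2 + P' + 2 * K * tau ^+ 2) * b^-1 ^+ 2 =
    2 * (P' ^+ 2 * b^-1 ^+ 2) + P' * b^-1 ^+ 2 + 2 * K * tau ^+ 2 * b^-1 ^+ 2 by ring.
  move: q usq; move: (2 * K * tau ^+ 2 * b^-1 ^+ 2) (P' ^+ 2 * b^-1 ^+ 2) (P' * b^-1 ^+ 2) (u ^+ 2).
  by clear => q1 q2 q3 q4; lra.
have eu : expR u <= 2.
  move: hx2 (hu2); rewrite ler_distl => /andP[_ h]; rewrite ler_norml => /andP[h1 h2].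
  have : u ^+ 2 <= 4^-1.
    have -> : 4^-1 = 2^-1 ^+ 2 :> R by rewrite exprVn -natrX.
    by rewrite -(real_normK (num_real u)) lerXn2r ?nnegrE ?invr_ge0.
  lra.
have -> : (rf0 a b x - mu_t a b^-1 (rs x) * rf1 a b x) * w = (rmu a b x - mu_t a b^-1 (rs x)) * (rf1 a b x * w).
  by rewrite /rmu; move: (rf1 a b x) (rf0 a b x) f1 (mu_t _ _ _) => v v' v0 m; field; rewrite gt_eqF.
rewrite ew normrM (ger0_norm (x := _ * _)); last by rewrite mulr_ge0 ?expR_ge0 // ltW.
have h := H b x bb1 hx.
have h3 : K * b^-1 ^+ 3 * rs x ^+ 2 <= K * b^-1 ^+ 3 * tau ^+ 2.
  rewrite ler_wpM2l ?mulr_ge0 ?exprn_ge0 ?(ltW eb0) // lerXn2r ?nnegrE ?(ltW s0) ?(ltW t0) //.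
apply: le_trans (_ : K * b^-1 ^+ 3 * tau ^+ 2 * (conK b * 2) <= _).
  apply: ler_pM => //; [by rewrite mulr_ge0 ?expR_ge0 // ltW|exact: le_trans h3|by rewrite ler_wpM2l // ltW].
have -> : K * b^-1 ^+ 3 * tau ^+ 2 * (conK b * 2) = (2 * K * tau ^+ 2) * b^-1 ^+ 3 * conK b by ring.
have p2 : 0 <= 2 * P' ^+ 2 + P' by apply: addr_ge0 => //; apply: mulr_ge0 => //; exact: sqr_ge0.
by rewrite ler_wpM2r ?(ltW C0) // ler_wpM2r ?exprn_ge0 ?(ltW eb0) // lerDr.
Qed.

End RealAxisFinal.

Section PartBErrors.
Variable R : realType.
Local Notation C := (Cplx R).
Variable a : R.
Hypothesis a0 : 0 < a.
Local Notation ca := (cofR a : C).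

Definition weightB (b : R) (xi : C) : C :=
  cexp (- (cofR b * (xi - 1 - clog xi))) * cpow (xi - 1) (- ca).
Definition leadB (b : R) (xi : C) : C := sk1 a b xi * weightB b xi.
Definition errB (b : R) (xi : C) : C := leadB b xi - cofR (conK a b) * (1 + cofR b^-1 * pi_t ca (xi - 1)^-1).
Definition ratB (b : R) (xi : C) : C :=
  cofR b * ((sk0 a b xi - mu_t ca (cofR b^-1) (xi - 1)^-1 * sk1 a b xi) * weightB b xi).

Variables (b : R) (gam : R -> C) (t : R) (d : C).
Hypotheses (ab1 : a + 1 <= b) (hg : cder gam t d) (g1 : 1 < cre (gam t)).
Let ab : a <= b. Proof. by apply: le_trans ab1; rewrite lerDl. Qed.
Let b0 : 0 < b. Proof. exact: lt_le_trans ab. Qed.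
Let slit1 : slit (gam t). Proof. by left; exact: lt_trans g1. Qed.
Let slit2 : slit (gam t - 1). Proof. by left; rewrite creB cre1 subr_gt0. Qed.
Let g0 : gam t != 0. Proof. exact: slit_neq0 slit1. Qed.
Let gm0 : gam t - 1 != 0. Proof. exact: slit_neq0 slit2. Qed.
Local Notation s := ((gam t - 1)^-1).
Local Notation e := (cofR b^-1 : C).
Let s0 : s != 0. Proof. by rewrite invr_eq0. Qed.
Let gE : gam t = 1 + s^-1. Proof. by rewrite invrK addrCA subrr addr0. Qed.
Let s1 : 1 + s != 0.
Proof.
have e1 : 1 + s = gam t * s by move: (gam t) gm0 => z z0; field.
by rewrite e1 mulf_neq0.
Qed.
Let gV : (gam t)^-1 = s / (1 + s).
Proof. by rewrite {1}gE; move: s s0 s1 => z z0 z1; field; rewrite z1 z0. Qed.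

Let cder_gm : cder (fun x => gam x - 1) t d.
Proof. by apply: (cder_eq (cderB hg (cder_cst 1 t))); rewrite subr0. Qed.

Let cder_s : cder (fun x => (gam x - 1)^-1) t (- (d * s ^+ 2)).
Proof. by apply: (cder_eq (cderV gm0 cder_gm)); rewrite mulNr exprVn. Qed.

Let cder_weightB : cder (fun x => weightB b (gam x)) t
  (- (d * (cofR b / (1 + s) + ca * s)) * weightB b (gam t)).
Proof.
have h1 := cder_cexp (cderN (cderZ (cofR b) (cderB cder_gm (cder_clog slit1 hg)))).
apply: (cder_eq (cderM h1 (cder_cpow (- ca) slit2 cder_gm))).
rewrite /weightB gV; move: (cexp _) (cpow _ _) s s0 s1 => u v z z0 z1.
by field.
Qed.

Let cder_mu_t : cder (fun x => mu_t ca e (gam x - 1)^-1) t (- (d * s ^+ 2 * dmu_t ca e s)).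
Proof.
rewrite /mu_t /mu_u /mu_k.
have h1 := cderD (cder_cst 1 t) cder_s.
have h2 := cderB (cderZ (1 - ca) cder_s) (cder_cst ca t).
have h3 := cderD (cder_cst 1 t) (cderM (cderZ e cder_s) h2).
by apply: (cder_eq (cderM (cderZ e h1) h3)); rewrite /dmu_t /mu_k; ring.
Qed.

Let sk2E : sk2 a b (gam t) = cofR b * (sk1 a b (gam t) + ca * s * sk0 a b (gam t)) / (1 + s).
Proof.
apply: (mulfI g0); rewrite (sk_ode a0 ab).
move: (sk0 _ _ _) (sk1 _ _ _) => u v.
move: (gam t) g0 gm0 s1 => z z0 z1 z2; field.
by rewrite z1 subrK z0.
Qed.

Let eb : e = (cofR b)^-1. Proof. exact: cofRV. Qed.
Let cb0 : cofR b != 0 :> C. Proof. by rewrite cofR_eq0 gt_eqF. Qed.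

Lemma cder_errB : cder (fun x => errB b (gam x)) t
  (d * (ca / gam t * ratB b (gam t) + e * (ca * s ^+ 2 * mu_k ca s) * errB b (gam t)
    + cofR (b^-1 ^+ 2 * conK a b) * (ca * s ^+ 2 * mu_k ca s * pi_t ca s))).
Proof.
have h1 := cderM (cder_sk1 a0 ab hg) cder_weightB.
have h2 : cder (fun x => pi_t ca (gam x - 1)^-1) t (d * (ca * s ^+ 2 * mu_k ca s)).
  apply: (cder_eq (cderB (cderZ (ca ^+ 2) cder_s) (cderZ (ca * (1 - ca) / 2) (cderX 2 cder_s)))).
  by rewrite /mu_k /= expr1; move: s => z; field.
have h3 := cderB h1 (cderZ (cofR (conK a b)) (cderD (cder_cst 1 t) (cderZ e h2))).
apply: (cder_eq h3).
rewrite /ratB /errB /leadB sk2E gV (cofRM (b^-1 ^+ 2)) cofRX /mu_t /mu_u eb.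
move: (sk0 _ _ _) (sk1 _ _ _) (weightB _ _) (mu_k _ _) (pi_t _ _) (cofR (conK a b)) => u v w k p c.
by move: (gam t - 1)^-1 s1 => z z1; field; rewrite cb0 z1.
Qed.

Lemma cder_ratB : cder (fun x => ratB b (gam x)) t
  (- (d * (cofR b * (1 - (gam t)^-1) + ca * s * mu_u ca e s + ca * s)) * ratB b (gam t)
   + d * e * s ^+ 2 * (res1 ca s - e * res2 ca s) * leadB b (gam t)).
Proof.
have h1 := cderB (cder_sk0 a0 ab hg) (cderM cder_mu_t (cder_sk1 a0 ab hg)).
apply: (cder_eq (cderZ (cofR b) (cderM h1 cder_weightB))).
have R1 := mu_t_riccati ca e s.
have hd : s ^+ 2 * dmu_t ca e s = e ^+ 2 * s ^+ 2 * (res1 ca s - e * res2 ca s)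
  - (1 - mu_u ca e s - ca * s * (e * (1 + s)) * mu_u ca e s ^+ 2).
  by rewrite -R1; ring.
rewrite -mulrA hd /ratB /leadB sk2E gV /mu_t eb.
move: (sk0 _ _ _) (sk1 _ _ _) (weightB _ _) (res1 _ _ - _) (mu_u _ _ _) => u v w r k.
by move: (gam t - 1)^-1 s1 => z z1; field; rewrite cb0 z1.
Qed.

End PartBErrors.

Section PartBPath.
Variable R : realType.
Local Notation C := (Cplx R).
Variable a : R.
Hypothesis a0 : 0 < a.
Local Notation ca := (cofR a : C).

Lemma conK_gt0 (b : R) : 0 < b -> 0 < conK a b.
Proof. by move=> b0; rewrite -expR_rLam // expR_gt0. Qed.

Definition closeB (b T : R) (xi : C) : Prop :=
  csq (errB a b xi) <= T * (b^-1 ^+ 2 * conK a b) ^+ 2 /\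
  csq (ratB a b xi) <= T * (b^-1 ^+ 2 * conK a b) ^+ 2.

Lemma lbdd_ge0 (P : C -> C) tau : lbdd P -> exists2 M : R, 0 <= M & forall T, cmod T <= tau -> cmod (P T) <= M.
Proof.
move=> /(_ tau) [M hM]; exists `|M| => // T /hM h; exact: le_trans (ler_norm M).
Qed.

Lemma partB_path (L tau d Len : R) : 0 <= L -> 0 <= tau -> 0 < d -> 0 <= Len ->
  exists K b1 : R, [/\ 0 < K, a + 1 <= b1, 1 <= b1 &
  forall (b : R) (gam dgam : R -> C) (t0 t1 T : R),
  b1 <= b -> t0 <= t1 <= t0 + Len ->
  (forall t, t0 <= t <= t1 -> cder gam t (dgam t) /\ 1 < cre (gam t)) ->
  (forall t, t0 < t < t1 -> [/\ cmod (gam t - 1)^-1 <= tau, cmod (dgam t) <= L &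
     d <= cre (dgam t * (1 - (gam t)^-1))]) ->
  0 <= T -> closeB b T (gam t0) -> closeB b (K * (T + 1)) (gam t1)].
Proof.
move=> L0 tau0 d0 Len0.
have [Mk Mk0 Hk] := lbdd_ge0 tau (lbdd_mu_k a).
have [M1 M10 H1] := lbdd_ge0 tau (lbdd_res1 a).
have [M2 M20 H2] := lbdd_ge0 tau (lbdd_res2 a).
have [Mp Mp0 Hp] := lbdd_ge0 tau (lbdd_pi_t a).
have [A1' A1E] : exists c, c = a * tau ^+ 2 * Mk by eexists.
have A10 : 0 <= A1' by rewrite A1E; apply: mulr_ge0 => //; apply: mulr_ge0 (sqr_ge0 _); exact: ltW.
have [A2' A2E] : exists c, c = tau ^+ 2 * (M1 + M2) by eexists.
have A20 : 0 <= A2' by rewrite A2E; apply: mulr_ge0 (sqr_ge0 _) _; exact: addr_ge0.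
pose c := L * (a + A1' + A1' * Mp + A2' * (1 + Mp)) + 1.
have hsum : 0 <= a + A1' + A1' * Mp + A2' * (1 + Mp).
  apply: addr_ge0; last by apply: mulr_ge0 => //; exact: addr_ge0.
  by apply: addr_ge0; [apply: addr_ge0 => //; exact: ltW|exact: mulr_ge0].
have c0 : 0 < c by rewrite ltr_wpDl // mulr_ge0.
have d2 : 0 < d / 2 by rewrite divr_gt0.
have [K K0 HK] := @damped_system R c (d / 2) Len c0 d2 Len0.
have [w wE] : exists w, w = L * (a * tau * (1 + tau * Mk) + a * tau) * 2 / d by eexists.
have w0 : 0 <= w.
  rewrite wE; apply: divr_ge0 (ltW d0); apply: mulr_ge0 => //; apply: mulr_ge0 => //.
  have at0 : 0 <= a * tau by apply: mulr_ge0 => //; exact: ltW.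
  by apply: addr_ge0 => //; apply: mulr_ge0 => //; apply: addr_ge0 => //; exact: mulr_ge0.
exists (2 * K + 1), (1 + a + w); split.
- by rewrite ltr_wpDl // mulr_ge0 // ltW.
- by rewrite (addrC 1) lerDl.
- by rewrite -addrA lerDl addr_ge0 // ltW.
move=> b gam dgam t0 t1 T hb tt hcl hop T0 [hg0 hh0].
have b1 : 1 <= b by move: hb w0 a0; clear; lra.
have ab1 : a + 1 <= b by move: hb w0; clear; lra.
have bw : w <= b by move: hb a0; clear; lra.
have b0 : 0 < b by exact: lt_le_trans b1.
have eb0 : 0 < b^-1 by rewrite invr_gt0.
have eb1 : b^-1 <= 1 by rewrite invf_le1.
have hin t : t0 < t < t1 -> t0 <= t <= t1 by move=> /andP[/ltW -> /ltW ->].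
have cK0 := conK_gt0 b0.
pose r := b^-1 ^+ 2 * conK a b; pose s' := b^-1 * conK a b.
have r0 : 0 <= r by rewrite mulr_ge0 ?sqr_ge0 // ltW.
have s'0 : 0 <= s' by rewrite mulr_ge0 // ltW.
pose e := cofR b^-1 : C; pose sg t := (gam t - 1)^-1.
pose p t := dgam t * (ca / gam t * ratB a b (gam t) + e * (ca * sg t ^+ 2 * mu_k ca (sg t)) * errB a b (gam t)
    + cofR r * (ca * sg t ^+ 2 * mu_k ca (sg t) * pi_t ca (sg t))).
pose q t := dgam t * e * sg t ^+ 2 * (res1 ca (sg t) - e * res2 ca (sg t)) * leadB a b (gam t).
pose zeta t := dgam t * (cofR b * (1 - (gam t)^-1) + ca * sg t * mu_u ca e (sg t) + ca * sg t).
have me : cmod e = b^-1 by rewrite cmod_ofR ger0_norm // ltW.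
have mca : cmod ca = a by rewrite cmod_ofR ger0_norm // ltW.
have hk2 t : cmod (sg t) <= tau -> cmod (ca * sg t ^+ 2 * mu_k ca (sg t)) <= A1'.
  move=> ht; rewrite A1E cmodM (cmodM ca) mca cmodX.
  apply: ler_pM (cmod_ge0 _) _ (Hk _ ht); first by apply: mulr_ge0 (sqr_ge0 _); exact: ltW.
  by apply: ler_wpM2l; [exact: ltW|rewrite lerXn2r ?nnegrE ?cmod_ge0].
have hg t : t0 <= t <= t1 -> cder (fun x => errB a b (gam x)) t (p t).
  by move=> /hcl[h1 h2]; exact: cder_errB.
have hh t : t0 <= t <= t1 -> cder (fun x => ratB a b (gam x)) t (- zeta t * ratB a b (gam t) + q t).
  by move=> /hcl[h1 h2]; exact: cder_ratB.
have := HK b r s' t0 t1 (fun t => errB a b (gam t)) (fun t => ratB a b (gam t)) p q zeta b1 r0 s'0 tt.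
case.
- by move=> t /hg /cder_csq /isd_continuous.
- by move=> t /hh /cder_csq /isd_continuous.
- by move=> t /hin /hg.
- by move=> t /hin /hh.
- move=> t ti; have [hs hL hd] := hop t ti.
  have -> : zeta t = cofR b * (dgam t * (1 - (gam t)^-1)) + dgam t * (ca * sg t * mu_u ca e (sg t) + ca * sg t).
    by rewrite /zeta; ring.
  rewrite creD creZ.
  have hu : cmod (mu_u ca e (sg t)) <= 1 + tau * Mk.
    rewrite /mu_u; apply: le_trans (cmodD _ _) _; rewrite cmod1 lerD2l cmodM cmodM me.
    apply: ler_pM; rewrite ?mulr_ge0 ?cmod_ge0 ?(ltW eb0) //; last exact: Hk.
    by rewrite -[tau]mul1r; apply: ler_pM; rewrite ?cmod_ge0 ?(ltW eb0).
  have hrest : cmod (dgam t * (ca * sg t * mu_u ca e (sg t) + ca * sg t)) <=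
      L * (a * tau * (1 + tau * Mk) + a * tau).
    rewrite cmodM; apply: ler_pM; rewrite ?cmod_ge0 //.
    have h3 : cmod (ca * sg t) <= a * tau by rewrite cmodM mca ler_wpM2l // ltW.
    apply: le_trans (cmodD _ _) _; apply: lerD => //.
    by rewrite cmodM; apply: ler_pM; rewrite ?cmod_ge0.
  have h5 : b * d <= b * cre (dgam t * (1 - (gam t)^-1)) by rewrite ler_pM2l.
  have h6 : L * (a * tau * (1 + tau * Mk) + a * tau) * 2 <= b * d by rewrite -ler_pdivrMr // -wE.
  have h7 := le_trans (cre_le_cmod _) hrest; move: h7; rewrite ler_norml => /andP[h7 _].
  move: h5 h6 h7; rewrite mulrA; move: (L * _) (cre (_ * (_ + _))) (b * cre _) (b * d); clear => u1 u2 u3 u4; lra.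
- move=> t ti; have [hs hL hd] := hop t ti.
  set G := cmod (errB a b (gam t)); set H := cmod (ratB a b (gam t)).
  have G0 : 0 <= G by exact: cmod_ge0.
  have H0 : 0 <= H by exact: cmod_ge0.
  have g1 : cmod (gam t)^-1 <= 1.
    have [_ h1] := hcl t (hin t ti).
    have h2 : 1 <= cmod (gam t) by apply: le_trans (cre_le_cmod _); exact: le_trans (ltW h1) (ler_norm _).
    by rewrite cmodV invf_le1 // (lt_le_trans _ h2).
  have k1 : cmod (ca / gam t * ratB a b (gam t)) <= a * H.
    by rewrite cmodM ler_wpM2r // cmodM mca ler_piMr // ltW.
  have k2 : cmod (e * (ca * sg t ^+ 2 * mu_k ca (sg t)) * errB a b (gam t)) <= A1' * G.
    rewrite cmodM ler_wpM2r // (cmodM e) me -[A1']mul1r.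
    by apply: ler_pM; rewrite ?cmod_ge0 ?(ltW eb0) ?hk2.
  have k3 : cmod (cofR r * (ca * sg t ^+ 2 * mu_k ca (sg t) * pi_t ca (sg t))) <= A1' * Mp * r.
    rewrite cmodM cmod_ofR ger0_norm // mulrC ler_wpM2r // cmodM.
    by apply: ler_pM; rewrite ?cmod_ge0 ?hk2 ?Hp.
  apply: (@le_trans _ _ (L * (a * H + A1' * G + A1' * Mp * r))).
    rewrite cmodM; apply: ler_pM; rewrite ?cmod_ge0 //.
    apply: le_trans (cmodD _ _) _; apply: lerD => //.
    by apply: le_trans (cmodD _ _) _; exact: lerD.
  have u1 : 0 <= A1' * Mp by exact: mulr_ge0.
  have u2 : 0 <= A2' * (1 + Mp) by apply: mulr_ge0 => //; exact: addr_ge0.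
  apply: (@le_trans _ _ (L * ((a + A1' + A1' * Mp + A2' * (1 + Mp)) * (G + H + r)))).
    apply: ler_wpM2l => //.
    have v1 : 0 <= (A1' + A1' * Mp + A2' * (1 + Mp)) * H by apply: mulr_ge0 => //; apply: addr_ge0 => //; exact: addr_ge0.
    have v2 : 0 <= (a + A1' * Mp + A2' * (1 + Mp)) * G.
      by apply: mulr_ge0 => //; apply: addr_ge0 => //; apply: addr_ge0 => //; exact: ltW.
    have v3 : 0 <= (a + A1' + A2' * (1 + Mp)) * r.
      by apply: mulr_ge0 => //; apply: addr_ge0 => //; apply: addr_ge0 => //; exact: ltW.
    move: v1 v2 v3; move: (A2' * (1 + Mp)) (A1' * Mp) => z1 z2; move: (r) => z3; clear; lra.
  rewrite mulrA /c mulrDl mul1r lerDl.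
  by apply: addr_ge0 => //; exact: addr_ge0.
- move=> t ti; have [hs hL hd] := hop t ti.
  set G := cmod (errB a b (gam t)).
  have G0 : 0 <= G by exact: cmod_ge0.
  have k1 : cmod (leadB a b (gam t)) <= G + conK a b * (1 + Mp).
    have -> : leadB a b (gam t) = errB a b (gam t) + cofR (conK a b) * (1 + e * pi_t ca (sg t)).
      by rewrite /errB subrK.
    apply: le_trans (cmodD _ _) _; rewrite lerD2l cmodM cmod_ofR ger0_norm ?(ltW cK0) // ler_pM2l //.
    apply: le_trans (cmodD _ _) _; rewrite cmod1 lerD2l cmodM me -[Mp]mul1r.
    by apply: ler_pM; rewrite ?cmod_ge0 ?(ltW eb0) ?Hp.
  have k2 : cmod (sg t ^+ 2 * (res1 ca (sg t) - e * res2 ca (sg t))) <= A2'.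
    rewrite A2E cmodM cmodX; apply: ler_pM; rewrite ?cmod_ge0 ?sqr_ge0 //.
      by rewrite lerXn2r ?nnegrE ?cmod_ge0.
    apply: le_trans (cmodB _ _) _; apply: lerD; first exact: H1.
    by rewrite cmodM me -[M2]mul1r; apply: ler_pM; rewrite ?cmod_ge0 ?(ltW eb0) ?H2.
  have -> : q t = dgam t * (sg t ^+ 2 * (res1 ca (sg t) - e * res2 ca (sg t))) * (e * leadB a b (gam t)).
    by rewrite /q; ring.
  have k3 : cmod (e * leadB a b (gam t)) <= (1 + Mp) * (G + s').
    rewrite cmodM me; apply: (@le_trans _ _ (b^-1 * (G + conK a b * (1 + Mp)))).
      by rewrite ler_pM2l.
    have v1 : b^-1 * G <= 1 * G by rewrite ler_wpM2r.
    have v2 : 0 <= Mp * G by exact: mulr_ge0.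
    have -> : b^-1 * (G + conK a b * (1 + Mp)) = b^-1 * G + (1 + Mp) * s' by rewrite /s'; ring.
    by rewrite mulrDr lerD2r mulrDl mul1r; move: v1; rewrite mul1r => v1; apply: le_trans v1 _; rewrite lerDl.
  rewrite cmodM; apply: (@le_trans _ _ (L * A2' * ((1 + Mp) * (G + s')))).
    apply: ler_pM; rewrite ?cmod_ge0 // cmodM; apply: ler_pM; rewrite ?cmod_ge0 //.
  have -> : L * A2' * ((1 + Mp) * (G + s')) = L * (A2' * (1 + Mp)) * (G + s') by ring.
  apply: ler_wpM2r; first exact: addr_ge0.
  rewrite /c; apply: (@le_trans _ _ (L * (a + A1' + A1' * Mp + A2' * (1 + Mp)))); last by rewrite lerDl.
  apply: ler_wpM2l => //; rewrite lerDr; apply: addr_ge0; last exact: mulr_ge0.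
  by apply: addr_ge0 => //; exact: ltW.
move=> R1 R2.
have es : (s' / b) ^+ 2 = r ^+ 2 by rewrite /s' /r; congr (_ ^+ 2); ring.
have hhb : csq (ratB a b (gam t0)) / b <= T * r ^+ 2.
  by apply: le_trans hh0; rewrite ler_piMr ?csq_ge0.
rewrite es in R1; split.
  apply: le_trans R1 _.
  have : K * (csq (errB a b (gam t0)) + csq (ratB a b (gam t0)) / b + r ^+ 2 + r ^+ 2) <=
     K * (T * r ^+ 2 + T * r ^+ 2 + r ^+ 2 + r ^+ 2).
    by apply: ler_wpM2l; [exact: ltW|rewrite !lerD2r; exact: lerD].
  move=> h; apply: le_trans h _.
  have -> : K * (T * r ^+ 2 + T * r ^+ 2 + r ^+ 2 + r ^+ 2) = (2 * K) * (T + 1) * r ^+ 2 by ring.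
  apply: ler_wpM2r; first exact: sqr_ge0.
  by apply: ler_wpM2r; [exact: addr_ge0|rewrite lerDl].
apply: le_trans R2 _.
have e2 : K / b ^+ 2 * (csq (errB a b (gam t0)) + csq (ratB a b (gam t0)) / b + r ^+ 2 + s' ^+ 2) =
  K * (b^-1 ^+ 2 * (csq (errB a b (gam t0)) + csq (ratB a b (gam t0)) / b + r ^+ 2) + r ^+ 2).
  by rewrite -es exprVn; move: (csq _ + _ + _) => z; field; rewrite gt_eqF.
rewrite e2.
have : K * (b^-1 ^+ 2 * (csq (errB a b (gam t0)) + csq (ratB a b (gam t0)) / b + r ^+ 2) + r ^+ 2) <=
  K * (T * r ^+ 2 + T * r ^+ 2 + r ^+ 2 + r ^+ 2).
  apply: ler_wpM2l; [exact: ltW|rewrite lerD2r].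
  apply: le_trans (_ : csq (errB a b (gam t0)) + csq (ratB a b (gam t0)) / b + r ^+ 2 <= _); last first.
    by rewrite lerD2r; exact: lerD.
  apply: ler_piMl; last by rewrite exprn_ile1 // ltW.
  apply: addr_ge0 (sqr_ge0 _); apply: addr_ge0; first exact: csq_ge0.
  by apply: mulr_ge0; [exact: csq_ge0|exact: ltW].
move=> h; apply: le_trans (lerD hh0 h) _.
have -> : K * (T * r ^+ 2 + T * r ^+ 2 + r ^+ 2 + r ^+ 2) = (2 * K) * (T + 1) * r ^+ 2 by ring.
have -> : (2 * K + 1) * (T + 1) * r ^+ 2 = T * r ^+ 2 + 2 * K * (T + 1) * r ^+ 2 + r ^+ 2 by ring.
by rewrite lerDl sqr_ge0.
Qed.

End PartBPath.

Section PartBRegion.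
Variable R : realType.
Local Notation C := (Cplx R).
Variable a : R.
Hypothesis a0 : 0 < a.
Local Notation ca := (cofR a : C).

Lemma clog_ofR (x : R) : 0 < x -> clog (cofR x : C) = cofR (ln x).
Proof.
move=> x0; apply: cplxP; first by rewrite cre_clog cre_ofR cmod_ofR ger0_norm // ltW.
rewrite cim_clog cim_ofR /carg cofR_eq0 gt_eqF // cim_ofR lexx cre_ofR cmod_ofR ger0_norm ?ltW //.
by rewrite mulfV ?gt_eqF // acos1.
Qed.

Lemma closeB_le (b T T' : R) (xi : C) : T <= T' -> closeB a b T xi -> closeB a b T' xi.
Proof.
by move=> TT [h1 h2]; split; [apply: le_trans h1 _|apply: le_trans h2 _]; rewrite ler_wpM2r ?sqr_ge0.
Qed.

Lemma weightB_real (b x : R) : 1 < x ->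
  weightB a b (cofR x) = cofR (expR (- b * (x - 1 - ln x)) * expR (- a * ln (x - 1))) :> C.
Proof.
move=> x1; have x0 : 0 < x by exact: lt_trans x1.
have xm : 0 < x - 1 by rewrite subr_gt0.
rewrite /weightB clog_ofR // -cofR1 -!cofRB -cofRM -cofRN cexp_ofR /cpow clog_ofR //.
by rewrite -cofRN -[cofR _ * cofR (ln _)]cofRM cexp_ofR -cofRM -mulNr.
Qed.

Lemma real_close (eta : R) : 0 < eta -> exists T b1 : R, [/\ 0 <= T, 1 <= b1 &
  forall b x : R, b1 <= b -> 1 + eta <= x -> closeB a b T (cofR x)].
Proof.
move=> e0; have e2 : 0 < eta / 2 by rewrite divr_gt0.
have [K [b1 [K0 b11 ab1 H]]] := real_axis a0 e2.
exists (K ^+ 2), b1; split; [exact: sqr_ge0|by []|].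
move=> b x hb hx; have hx' : 1 + 2 * (eta / 2) <= x by rewrite mulrCA mulfV ?mulr1 // pnatr_eq0.
have x1 : 1 < x by apply: lt_le_trans hx; rewrite ltrDl.
have [h1 h2] := H b x hb hx'.
have b0 : 0 < b by apply: lt_le_trans hb; exact: lt_le_trans b11.
have b0' : b != 0 by rewrite gt_eqF.
have cK := conK_gt0 a0 b0.
have ab : a + 1 <= b by exact: le_trans hb.
have hV : (cofR x - 1)^-1 = cofR (rs x) :> C by rewrite -cofR1 -cofRB -cofRV.
have csqR (y : R) : csq (cofR y : C) = y ^+ 2 by rewrite /csq cre_ofR cim_ofR expr0n addr0.
have p0 : 0 <= K * (b^-1 ^+ 2 * conK a b) by apply: mulr_ge0 => //; apply: mulr_ge0 (sqr_ge0 _) (ltW cK).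
split; rewrite -exprMn.
  rewrite /errB /leadB weightB_real // (sk1_real a0 ab) hV -cofR_pi_t -cofRM -(cofRM b^-1) -cofR1 -cofRD -cofRM -cofRB.
  rewrite csqR -(real_normK (num_real _)) lerXn2r ?nnegrE //.
  by apply: le_trans h1 _; rewrite -[X in X <= _]mulrA.
rewrite /ratB weightB_real // (sk1_real a0 ab) (sk0_real a0 ab) hV -cofR_mu_t -(cofRM (mu_t _ _ _)) -cofRB -cofRM -(cofRM b).
rewrite csqR -(real_normK (num_real _)) lerXn2r ?nnegrE // normrM (ger0_norm (ltW b0)).
have -> : K * (b^-1 ^+ 2 * conK a b) = b * (K * b^-1 ^+ 3 * conK a b).
  by move: (conK a b) => c; field.
by rewrite ler_pM2l.
Qed.

Lemma line_close (eta Rr : R) : 0 < eta -> 1 <= Rr -> exists T b1 : R, [/\ 0 <= T, 1 <= b1 &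
  forall (b : R) (xi : C), b1 <= b -> 1 + eta <= cre xi - `|cim xi| -> cmod xi <= Rr -> closeB a b T xi].
Proof.
move=> e0 R1; have [T [b1 [T0 b11 H1]]] := real_close e0.
have R0 : 0 < Rr by exact: lt_le_trans R1.
have eV0 : 0 <= eta^-1 by rewrite invr_ge0 ltW.
have d0 : 0 < eta / Rr ^+ 2 by rewrite divr_gt0 ?exprn_gt0.
have [K [b2 [K0 ab2 b21 H2]]] := partB_path a0 (ler0n _ 2) eV0 d0 (ltW R0).
exists (K * (T + 1)), (Num.max b1 b2); split.
- by apply: mulr_ge0; [exact: ltW|exact: addr_ge0].
- by rewrite le_max b11.
move=> b xi; rewrite ge_max => /andP[bb1 bb2] hx hR.
pose Y := `|cim xi|; pose x1 := cre xi - Y; pose sg := sgn_im xi.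
have Y0 : 0 <= Y by exact: normr_ge0.
have sg2 : sg ^+ 2 = 1 by exact: sgn_im2.
pose g (t : R) : C := ((x1 + t) +i* (sg * t))%C : R[i].
pose dg (t : R) : C := (1 +i* sg)%C : R[i].
have g0 : g 0 = cofR x1 by apply: cplxP => /=; rewrite /g /cre /cim /= ?addr0 ?mulr0.
have gY : g Y = xi.
  by apply: cplxP; [rewrite /g {1}/cre /= subrK|rewrite /g {1}/cim /= sgn_imK].
have h0 : closeB a b T (g 0) by rewrite g0; apply: H1.
have crg t : cre (g t) = x1 + t by [].
have cig t : cim (g t) = sg * t by [].
rewrite -gY; apply: (H2 b g dg 0 Y T) => //.
- by rewrite Y0 add0r (le_trans _ hR) // cim_le_cmod.
- move=> t /andP[t0 tY]; split; last first.
    by rewrite crg; have : 1 + eta <= x1 by []; lra.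
  split; first by apply: (isd_eq (isdD (isd_cst x1 t) (isd_id t))); rewrite add0r.
  by apply: (isd_eq (isdZ sg (isd_id t))); rewrite mulr1.
move=> t /andP[t0 tY].
have hx1 : 1 + eta <= x1 by [].
have he : eta <= cmod (g t - 1).
  apply: le_trans (cre_le_cmod _); apply: le_trans (ler_norm _); rewrite creB crg cre1; lra.
have cq : csq (g t) = (x1 + t) ^+ 2 + t ^+ 2 by rewrite /csq crg cig exprMn sg2 mul1r.
have x1t : 0 < x1 + t by lra.
have cq0 : 0 < (x1 + t) ^+ 2 + t ^+ 2 by rewrite ltr_pwDl ?sqr_ge0 // exprn_gt0.
split.
- by rewrite cmodV lef_pV2 ?posrE // (lt_le_trans e0).
- apply: le_trans (cmod_le_reim _) _; rewrite /dg /cre /cim /= normr1.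
  by have := congr1 Num.sqrt sg2; rewrite sqrtr_sqr sqrtr1 => ->.
rewrite mulrBr mulr1 creB creM creV cimV -/(csq (g t)) cq crg cig.
have -> : cre (dg t) = 1 by [].
have -> : cim (dg t) = sg by [].
have -> : 1 - (1 * ((x1 + t) / ((x1 + t) ^+ 2 + t ^+ 2)) - sg * - (sg * t / ((x1 + t) ^+ 2 + t ^+ 2))) =
  ((x1 + t) ^+ 2 + t ^+ 2 - (x1 + t) - sg ^+ 2 * t) / ((x1 + t) ^+ 2 + t ^+ 2).
  by move: cq0; move: (x1 + t) => u cq0; field; rewrite gt_eqF.
rewrite sg2 mul1r.
have hq : (x1 + t) ^+ 2 + t ^+ 2 <= Rr ^+ 2.
  apply: le_trans (_ : csq xi <= _); last by rewrite -cmod_sqr lerXn2r ?nnegrE ?cmod_ge0 // ltW.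
  rewrite /csq; apply: lerD.
    rewrite lerXn2r ?nnegrE ?(ltW x1t) //; rewrite /x1 in x1t *; lra.
  by rewrite -(real_normK (num_real (cim xi))) lerXn2r ?nnegrE // ltW.
have hn : eta <= (x1 + t) ^+ 2 + t ^+ 2 - (x1 + t) - t.
  have u0 : 0 <= x1 - 1 - eta by lra.
  have -> : (x1 + t) ^+ 2 + t ^+ 2 - (x1 + t) - t =
    eta + ((x1 - 1 - eta) + (x1 - 1) ^+ 2 + 2 * t * (x1 - 1) + 2 * t ^+ 2) by ring.
  rewrite lerDl; apply: addr_ge0; last by rewrite mulr_ge0 ?sqr_ge0.
  apply: addr_ge0; first by apply: addr_ge0 => //; exact: sqr_ge0.
  apply: mulr_ge0; [by rewrite mulr_ge0 // ltW|lra].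
apply: ler_pM => //; [exact: ltW|by rewrite invr_ge0 exprn_ge0 // ltW|].
by rewrite lef_pV2 // posrE exprn_gt0.
Qed.

End PartBRegion.

Section PartBCurve.
Variable R : realType.
Local Notation C := (Cplx R).
Variable a : R.
Hypothesis a0 : 0 < a.

Lemma mc_im2_cross (l al X nu xs : R) : 0 < nu -> 0 < xs -> xs <= X -> 1 <= al * xs ->
  mc_im2 l al X xs <= nu -> nu <= mc_im2 l al X X ->
  exists x2 : R, [/\ xs <= x2 <= X, mc_im2 l al X x2 = nu &
    forall x, x2 <= x <= X -> nu <= mc_im2 l al X x].
Proof.
move=> nu0 xs0 xsX hal h1 h2.
have hd (x : R) : is_derive x 1 (fun y : R => 2 * (l - al * (X - y))) (2 * al).
  apply: (isd_eq (isdZ 2 (isdB (isd_cst l x) (isdZ al (isdB (isd_cst X x) (isd_id x)))))); ring.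
have hc (x : R) : {for x, continuous (mc_im2 l al X)}.
  exact: isd_continuous (isdB (isd_exp (hd x)) (isdX 2 (isd_id x))).
have [||x2] := @IVT R (mc_im2 l al X) xs X nu xsX.
- by apply: continuous_subspaceT => x; exact: hc.
- by rewrite ge_min h1 /= le_max h2 orbT.
rewrite in_itv /= => /andP[x21 x22] e2.
exists x2; split => //; first by rewrite x21.
move=> x /andP[x2x xX].
have p0 (t : R) : 0 < t ^+ 2 + nu by rewrite ltr_wpDl // sqr_ge0.
pose r t := 2 * (l - al * (X - t)) - ln (t ^+ 2 + nu).
have hr (t : R) : is_derive t 1 r (2 * al - 2 * t / (t ^+ 2 + nu)).
  apply: (isd_eq (isdB (hd t) (isd_ln (g := fun t => t ^+ 2 + nu) (p0 t) (isdD (isdX 2 (isd_id t)) (isd_cst nu t))))).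
  by rewrite /= expr1 mulr1 addr0.
have rx : r x2 <= r x.
  apply: (@nondecr_of_derive R r (fun t => 2 * al - 2 * t / (t ^+ 2 + nu))) => //.
  - by move=> t _; exact: isd_continuous (hr t).
  - move=> t /andP[t2 tx]; have t0 : 0 < t by apply: lt_trans t2; exact: lt_le_trans x21.
    have alt : 1 <= al * t.
      have al0 : 0 < al by rewrite -(pmulr_lgt0 _ xs0); exact: lt_le_trans hal.
      by apply: le_trans hal _; rewrite ler_pM2l // (le_trans x21) // ltW.
    rewrite subr_ge0 ler_pdivrMr // -mulrA ler_pM2l //.
    rewrite -[X in X <= _]mulr1 mulrDr.
    apply: (@le_trans _ _ (t * (al * t))); first by rewrite ler_pM2l.
    rewrite expr2 mulrCA mulrA lerDl mulr_ge0 ?(ltW nu0) //.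
    by have : 0 < al * t by [exact: lt_le_trans alt]; rewrite pmulr_lgt0 // => /ltW.
have r2 : r x2 = 0.
  have e3 : x2 ^+ 2 + nu = mc_sq l al X x2 by rewrite -e2 /mc_im2 addrC subrK.
  by rewrite /r e3 /mc_sq expRK subrr.
move: rx; rewrite r2 /r subr_ge0 => h.
rewrite /mc_im2 lerBrDl -[X in X <= _](lnK (x := x ^+ 2 + nu)) ?posrE //.
by rewrite /mc_sq ler_expR.
Qed.

Lemma partB_close (eta Rr : R) : 0 < eta <= 1 -> 1 <= Rr ->
  exists T b1 : R, [/\ 0 <= T, 1 <= b1 & forall (b : R) (xi : C), b1 <= b ->
  1 + eta <= cre xi -> 1 + eta <= phase xi -> cmod xi <= Rr -> closeB a b T xi].
Proof.
move=> /andP[eta0 eta1] Rr1.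
have Rr0 : 0 < Rr by exact: lt_le_trans Rr1.
have [ym ymE] : exists y, y = eta / 16 by eexists.
have ym0 : 0 < ym by rewrite ymE divr_gt0 // ltr0n.
have ym16 : ym * 16 = eta by rewrite ymE divfK // pnatr_eq0.
have [dc dcE] : exists y, y = eta / (8 * Rr) by eexists.
have dc0 : 0 < dc by rewrite dcE divr_gt0 // mulr_gt0 // ltr0n.
have dcR : dc * Rr * 8 = eta by rewrite dcE; field; rewrite gt_eqF.
have dc8 : dc * 8 <= eta by rewrite -dcR ler_pM2r ?ltr0n // ler_peMr // ltW.
pose al := 1 - dc.
have al0 : 0 <= al by rewrite /al; lra.
pose B := Rr ^+ 2 + Rr.
have B0 : 0 <= B by rewrite addr_ge0 ?sqr_ge0 // ltW.
pose L := 1 + B / ym.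
have L0 : 0 <= L by rewrite addr_ge0 // divr_ge0 // ltW.
have e8 : 0 < eta / 8 by rewrite divr_gt0 // ltr0n.
have e4 : 0 < eta / 4 by rewrite divr_gt0 // ltr0n.
have tau0 : 0 <= (eta / 4)^-1 by rewrite invr_ge0 ltW.
have [T [b1 [T0 b11 H1]]] := line_close a0 e8 Rr1.
have [K [b2 [K0 ab2 b21 H2]]] := partB_path a0 L0 tau0 dc0 (ltW Rr0).
have KT : 0 <= K * (T + 1) by apply: mulr_ge0; [exact: ltW|exact: addr_ge0].
exists (K * (T + 1) + T), (Num.max b1 b2); split.
- exact: addr_ge0.
- by rewrite le_max b11.
move=> b xi; rewrite ge_max => /andP[bb1 bb2] hx hphi hR.
have [hY|hY] := leP `|cim xi| ym.
  apply: (@closeB_le _ a b T); first by rewrite lerDr.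
  by apply: H1 => //; move: hY ym16 hx; clear -eta0; lra.
apply: (@closeB_le _ a b (K * (T + 1))); first by rewrite lerDl.
have xi0 : xi != 0 by apply: cre_lower_neq0; lra.
pose X := cre xi; pose l := 2^-1 * ln (csq xi); pose sg := sgn_im xi.
have sg2 : sg ^+ 2 = 1 by exact: sgn_im2.
have sg1 : `|sg| = 1 by have := congr1 Num.sqrt sg2; rewrite sqrtr_sqr sqrtr1.
pose g := mcurve l al X sg.
have gX : g X = xi by apply: mcurve_end => //; exact: sgn_imK.
have XR : X <= Rr by rewrite (le_trans _ hR) // (le_trans (ler_norm _) (cre_le_cmod _)).
have hl : 1 + eta <= X - l by exact: hphi.
have hX : 1 + eta <= X by exact: hx.
have sqX : mc_sq l al X X = csq xi.
  by rewrite /mc_sq subrr mulr0 subr0 /l mulrA mulfV ?pnatr_eq0 // mul1r lnK // posrE csq_gt0.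
have cR : csq xi <= Rr ^+ 2 by rewrite -cmod_sqr lerXn2r ?nnegrE ?cmod_ge0 // ltW.
have hqR x : x <= X -> mc_sq l al X x <= Rr ^+ 2.
  by move=> xX; apply: le_trans (mc_sq_le l al0 xX) _; rewrite sqX.
pose xs := 1 + eta / 4.
have xs0 : 0 < xs by rewrite /xs; lra.
have [||||||x2 [/andP[x21 x22] im2x2 him]] := @mc_im2_cross l al X (ym ^+ 2) xs.
- by rewrite exprn_gt0.
- by [].
- by rewrite /xs; lra.
- rewrite /al /xs; have : 0 <= eta * (1 - eta) by rewrite mulr_ge0 ?subr_ge0 // ltW.
  have : 0 <= (eta / 8 - dc) * (1 + eta / 4) by rewrite mulr_ge0; lra.
  by move: eta0 eta1 dc0; clear; lra.
- apply: (@le_trans _ _ 0); last exact: sqr_ge0.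
  rewrite /mc_im2 subr_le0; apply: (@le_trans _ _ 1); last by rewrite exprn_ege1 // /xs; lra.
  rewrite /mc_sq -[X in _ <= X]expR0 ler_expR.
  have hdx : dc * (X - xs) <= dc * Rr by rewrite ler_pM2l //; lra.
  have -> : 2 * (l - al * (X - xs)) = 2 * (l - X + xs + dc * (X - xs)) by rewrite /al; ring.
  move: hdx; move: (dc * (X - xs)) (dc * Rr) dcR => u v; rewrite /xs; move: hl eta0; clear; lra.
- rewrite /mc_im2 sqX /csq -/X [X in _ <= X]addrAC subrr add0r -(real_normK (num_real (cim xi))).
  by rewrite lerXn2r ?nnegrE // ltW.
have him0 x : x2 <= x <= X -> 0 < mc_im2 l al X x.
  by move=> /him; apply: lt_le_trans; rewrite exprn_gt0.
have h22 : x2 <= x2 <= X by rewrite lexx.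
have start : closeB a b T (g x2).
  have cimg : `|cim (g x2)| = ym.
    by rewrite /g cim_mcurve im2x2 normrM sg1 mul1r sqrtr_sqr normr_id ger0_norm // ltW.
  apply: H1 => //.
    by rewrite cimg /g cre_mcurve; move: x21 ym16; rewrite /xs; move: eta0; clear; lra.
  rewrite -(@ler_pXn2r _ 2) ?nnegrE ?cmod_ge0 ?(ltW Rr0) // cmod_sqr /g csq_mcurve //.
    exact: hqR.
  exact: ltW (him0 _ h22).
rewrite -gX; apply: (H2 b g (dmcurve l al X sg) x2 X T bb2) => //.
- rewrite x22 /=; apply: le_trans XR _; rewrite lerDr; lra.
- move=> t tt; split; first exact: cder_mcurve (him0 t tt).
  by rewrite /g cre_mcurve; case/andP: tt => h _; apply: lt_le_trans (le_trans x21 h); rewrite /xs ltrDl.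
move=> t ti; have tt : x2 <= t <= X by case/andP: ti => /ltW -> /ltW ->.
have xst : xs <= t by case/andP: tt => h _; exact: le_trans h.
split.
- have hc : eta / 4 <= cmod (g t - 1).
    apply: le_trans (cre_le_cmod _); apply: le_trans (ler_norm _); rewrite creB cre1 /g cre_mcurve.
    by move: xst; rewrite /xs; clear; lra.
  by rewrite cmodV lef_pV2 ?posrE // (lt_le_trans e4).
- apply: cmod_dmcurve_le => //; first exact: him.
  apply: le_trans (ler_normB _ _) _; apply: lerD.
    rewrite ger0_norm ?mulr_ge0 ?expR_ge0 //; apply: le_trans (_ : 1 * mc_sq l al X t <= _).
      by rewrite ler_wpM2r ?expR_ge0 // /al gerBl ltW.
    by rewrite mul1r hqR //; case/andP: tt.
  rewrite ger0_norm; first by case/andP: tt => _ h; exact: le_trans h XR.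
  by apply: le_trans xst; exact: ltW.
rewrite mulrBr mulr1 creB /g cre_dmcurve_div //; last exact: him0.
by rewrite /al /dmcurve /cre /= opprB addrCA subrr addr0.
Qed.

End PartBCurve.

Section PartBFinal.
Variable R : realType.
Local Notation C := (Cplx R).
Variable a : R.
Hypothesis a0 : 0 < a.
Local Notation ca := (cofR a : C).

Definition stirK (b : R) : R := Gamma b * b `^ (2^-1 - b) * expR b / Num.sqrt (2 * pi).
Definition kapB (b : R) : R := b `^ (a - 2^-1) * (Num.sqrt (2 * pi) / Gamma a).

Lemma sqrt2pi_gt0 : 0 < Num.sqrt (2 * pi : R).
Proof. by rewrite sqrtr_gt0 mulr_gt0 // pi_gt0. Qed.

Lemma kapB_gt0 b : 0 < b -> 0 < kapB b.
Proof.
by move=> b0; apply: mulr_gt0; [exact: powR_gt0|apply: divr_gt0 sqrt2pi_gt0 (Gamma_gt0 a0)].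
Qed.

Lemma conKE b : 0 < b -> conK a b = b * (kapB b * stirK b).
Proof.
move=> b0; have s0 := sqrt2pi_gt0; have g0 := Gamma_gt0 a0.
have e : b `^ (a - b) = b `^ (a - 2^-1) * b `^ (2^-1 - b).
  rewrite -powRD; last by apply/implyP => _; rewrite gt_eqF.
  by congr (_ `^ _); ring.
rewrite /conK /kapB /stirK e; move: (Num.sqrt _) (Gamma a) (Gamma b) (b `^ _) (b `^ _) (expR b) s0 g0.
by move=> u v w x y z u0 v0; field; rewrite !gt_eqF.
Qed.

Lemma stirK_near b : 4 <= b -> `|stirK b - (1 + (12 * b)^-1)| <= 2 * b^-1 ^+ 2.
Proof.
move=> b4; have := stirling b4; rewrite exprVn; have s0 := sqrt2pi_gt0.
rewrite /stirK; move: (Gamma b * _ * _) (Num.sqrt _) s0 => u v v0 h.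
have -> : u / v - (1 + (12 * b)^-1) = (u - v * (1 + (12 * b)^-1)) / v.
  by move: (12 * b)^-1 => z; field; rewrite gt_eqF.
rewrite normrM normfV (gtr0_norm v0) ler_pdivrMr //; apply: le_trans h _.
by rewrite mulrAC.
Qed.

Definition prefB (b : R) (xi : C) : C :=
  cexp (cofR b * (xi - 1 - clog xi)) * cofR (b `^ (a - 2^-1))
  * cofR (Num.sqrt (2 * pi) / Gamma a) * xi * cpow (xi - 1) (cofR (a - 1)).

Lemma prefBE b xi : xi - 1 != 0 ->
  prefB b xi = (weightB a b xi)^-1 * (1 + (xi - 1)^-1) * cofR (kapB b).
Proof.
move=> x1; rewrite /prefB /weightB cexpN cpowN invfM !invrK /kapB cofRM.
have -> : ca = cofR (a - 1) + 1 by rewrite cofRB cofR1 subrK.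
rewrite cpowD cpow1 //; move: (cexp _) (cpow _ _) => u v; move: (cofR _) (cofR _) => w z.
by field.
Qed.

Lemma partB_identity b (xi S : C) : 0 < b -> xi != 0 -> xi - 1 != 0 ->
  let e := cofR b^-1 in let s := (xi - 1)^-1 in
  sk0 a b xi - prefB b xi * S = prefB b xi *
    (cofR (b^-1 / kapB b) * (ratB a b xi / (1 + s) + mu_u ca e s * errB a b xi)
     + (cofR (stirK b) * (mu_u ca e s * (1 + e * pi_t ca s)) - S)).
Proof.
move=> b0 x0 x1 e s; have k0 := kapB_gt0 b0.
have s1 : 1 + s != 0.
  have -> : 1 + s = xi * s by rewrite /s; field.
  by rewrite mulf_neq0 // invr_eq0.
have w0 : weightB a b xi != 0 by rewrite mulf_neq0 ?cexp_neq0 ?cpow_neq0.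
have b0' : cofR b != 0 :> C by rewrite cofR_eq0 gt_eqF.
have k0' : cofR (kapB b) != 0 :> C by rewrite cofR_eq0 gt_eqF.
rewrite prefBE // /errB /ratB /leadB conKE // (cofRM b) (cofRM (kapB b)) (cofRM b^-1) cofRV -/s -/e /mu_t.
have eE : e = (cofR b)^-1 by rewrite /e cofRV.
rewrite eE; move: (sk0 _ _ _) (sk1 _ _ _) (cofR (stirK b)) => f0 f1 t; move: (mu_u _ _ _) (pi_t _ _) => m p.
move: (weightB _ _ _) w0 => w w0.
move: (cofR (kapB b)) k0' s s1 => k k0' z z1 {eE e}.
by field; rewrite z1 k0' b0' w0.
Qed.


Lemma cmod_closeB b T xi : 0 <= T -> 0 < b -> closeB a b T xi ->
  cmod (errB a b xi) <= Num.sqrt T * (b^-1 ^+ 2 * conK a b) /\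
  cmod (ratB a b xi) <= Num.sqrt T * (b^-1 ^+ 2 * conK a b).
Proof.
move=> T0 b0 [h1 h2]; have p0 : 0 <= b^-1 ^+ 2 * conK a b.
  by apply: mulr_ge0 (sqr_ge0 _) _; exact: ltW (conK_gt0 a0 b0).
have e : (Num.sqrt T * (b^-1 ^+ 2 * conK a b)) ^+ 2 = T * (b^-1 ^+ 2 * conK a b) ^+ 2.
  by rewrite exprMn sqr_sqrtr.
have q0 : 0 <= Num.sqrt T * (b^-1 ^+ 2 * conK a b) by apply: mulr_ge0 p0; exact: sqrtr_ge0.
by split; rewrite -(@ler_pXn2r _ 2) ?nnegrE ?cmod_ge0 // cmod_sqr e.
Qed.

Let pq (z : C) : C := z * mu_k ca z + pi_t ca z.
Let qq (z : C) : C := z * mu_k ca z * pi_t ca z.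

Lemma partB_series (h s : C) : let e := 12 * h in forall t : C,
  t * (mu_u ca e s * (1 + e * pi_t ca s)) -
    (1 + h * (1 + cofR (12 * a * (a - 1)) * s + cofR (6 * (a - 1) * (a - 2)) * s ^+ 2)) =
  (t - (1 + h)) * (1 + e * pq s + e ^+ 2 * qq s) + e ^+ 2 * (qq s * (1 + h)) + e * h * pq s.
Proof.
move=> e t; have c (n : nat) : cofR n%:R = n%:R :> C by exact: cofR_nat.
rewrite (cofRM (12 * a)) (cofRM 12) (cofRM (6 * (a - 1))) (cofRM 6) !cofRB cofR1 !c.
by rewrite /e /pq /qq /mu_u /pi_t /mu_k; field.
Qed.

Lemma partB_bound (eta Rr : R) : 0 < eta <= 1 -> 1 <= Rr ->
  exists M b1 : R, 4 <= b1 /\ forall (b : R) (xi : C), b1 <= b ->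
  1 + eta <= cre xi -> 1 + eta <= phase xi -> cmod xi <= Rr ->
  cmod (sk0 a b xi - prefB b xi * (1 + cofR ((12 * b)^-1) *
     (1 + cofR (12 * a * (a - 1)) * (xi - 1)^-1 + cofR (6 * (a - 1) * (a - 2)) * (xi - 1)^-1 ^+ 2)))
  <= M * b^-1 ^+ 2 * cmod (prefB b xi).
Proof.
move=> he R1; have [T [b1 [T0 b11 H]]] := partB_close a0 he R1.
have eta0 : 0 < eta by case/andP: he.
have lk : lbdd (fun z : C => z * mu_k ca z) by rewrite /mu_k; lbdd_auto.
have lp : lbdd pq by rewrite /pq /pi_t /mu_k; lbdd_auto.
have lq : lbdd qq by rewrite /qq /pi_t /mu_k; lbdd_auto.
have [Ms Ms0 Hs] := lbdd_ge0 eta^-1 lk.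
have [P0 P00 Hp] := lbdd_ge0 eta^-1 lp.
have [Q0 Q00 Hq] := lbdd_ge0 eta^-1 lq.
exists (4 * ((3 + Ms) * Num.sqrt T) + (2 * (1 + P0 + Q0) + Q0 * 2 + P0)), (b1 + 4); split.
  by rewrite lerDr (le_trans _ b11).
move=> b xi hb hx hphi hR.
have b4 : 4 <= b by apply: le_trans hb; rewrite lerDr (le_trans _ b11).
have bb1 : b1 <= b by apply: le_trans hb; rewrite lerDl.
have b0 : 0 < b by apply: lt_le_trans b4; rewrite ltr0n.
have b1' : 1 <= b by apply: le_trans b4; rewrite ler1n.
have [err rat] := cmod_closeB T0 b0 (H b xi bb1 hx hphi hR).
have x0 : xi != 0 by apply: cre_lower_neq0; apply: lt_le_trans hx; rewrite addr_gt0.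
have hm : eta <= cmod (xi - 1).
  apply: le_trans (cre_le_cmod _); apply: le_trans (ler_norm _).
  by rewrite creB cre1 lerBrDl.
have x1 : xi - 1 != 0 by rewrite -cmod_gt0 (lt_le_trans eta0).
have hs : cmod (xi - 1)^-1 <= eta^-1 by rewrite cmodV lef_pV2 ?posrE // (lt_le_trans eta0).
have k0 := kapB_gt0 b0; have cK := conKE b0; have st := stirK_near b4.
have := @partB_identity b xi (1 + cofR ((12 * b)^-1) *
     (1 + cofR (12 * a * (a - 1)) * (xi - 1)^-1 + cofR (6 * (a - 1) * (a - 2)) * (xi - 1)^-1 ^+ 2)) b0 x0 x1.
cbv zeta => ->; rewrite cmodM mulrC; apply: ler_wpM2r; first exact: cmod_ge0.
have eb0 : 0 < b^-1 by rewrite invr_gt0.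
have eb1 : b^-1 <= 1 by rewrite invf_le1.
have eE : cofR b^-1 = 12 * cofR ((12 * b)^-1) :> C.
  by rewrite invfM (cofRM 12^-1) (cofRV 12) (cofR_nat _ 12) mulrA mulfV ?mul1r // pnatr_eq0.
have me : cmod (cofR b^-1 : C) = b^-1 by rewrite cmod_ofR ger0_norm // ltW.
set s := (xi - 1)^-1 in hs *; set e := cofR b^-1 in eE me *.
have [h hE] : exists h : C, h = cofR ((12 * b)^-1) by eexists.
rewrite -hE in eE *.
have mh : cmod h <= b^-1.
  rewrite hE cmod_ofR ger0_norm ?invr_ge0 ?mulr_ge0 ?ler0n ?(ltW b0) //.
  by rewrite lef_pV2 ?posrE ?mulr_gt0 ?ltr0n // ler_peMl ?(ltW b0) // ler1n.
have hst : cmod (cofR (stirK b) - (1 + h)) <= 2 * b^-1 ^+ 2.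
  by rewrite hE -cofR1 -cofRD -cofRB cmod_ofR.
have st0 : 0 <= stirK b <= 4.
  have b12 : 0 <= (12 * b)^-1 <= 1.
    rewrite invr_ge0 mulr_ge0 ?ler0n ?(ltW b0) //= invf_le1 ?mulr_gt0 ?ltr0n //.
    by rewrite mulr_ege1 // ler1n.
  have e2 : b^-1 ^+ 2 <= 4^-1.
    apply: le_trans (_ : b^-1 <= _); first by rewrite expr2 ler_piMl // ltW.
    by rewrite lef_pV2 ?posrE // ltr0n.
  move: st b12; rewrite ler_distl; move: (12 * b)^-1 (stirK b) => z t /andP[t1 t2] /andP[z0 z1].
  by apply/andP; split; move: e2; lra.
have /andP[st1 st4] := st0.
apply: le_trans (cmodD _ _) _; rewrite [X in _ <= X]mulrDl; apply: lerD.
  have ms1 : cmod (1 + s)^-1 <= 2.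
    have -> : (1 + s)^-1 = 1 - xi^-1.
      have -> : 1 + s = xi * s by rewrite /s; field.
      by rewrite invfM /s invrK mulrBr mulVf // mulr1.
    apply: le_trans (cmodB _ _) _; rewrite cmod1.
    have : cmod xi^-1 <= 1.
      rewrite cmodV invf_le1 ?cmod_gt0 //; apply: le_trans (cre_le_cmod _); apply: le_trans (ler_norm _).
      by apply: le_trans hx; rewrite lerDl ltW.
    by move: (cmod xi^-1) => z hz; lra.
  have mu : cmod (mu_u ca e s) <= 1 + Ms.
    rewrite /mu_u -mulrA; apply: le_trans (cmodD _ _) _; rewrite cmod1 lerD2l cmodM me -[Ms]mul1r.
    by apply: ler_pM; rewrite ?cmod_ge0 ?(ltW eb0) ?Hs.
  have kk : 0 <= b^-1 / kapB b by apply: divr_ge0; exact: ltW.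
  rewrite cmodM cmod_ofR ger0_norm //.
  have p0 : 0 <= Num.sqrt T * (b^-1 ^+ 2 * conK a b).
    by apply: mulr_ge0; [exact: sqrtr_ge0|apply: mulr_ge0 (sqr_ge0 _) _; exact: ltW (conK_gt0 a0 b0)].
  apply: (@le_trans _ _ (b^-1 / kapB b * ((3 + Ms) * (Num.sqrt T * (b^-1 ^+ 2 * conK a b))))).
    apply: ler_wpM2l => //; apply: le_trans (cmodD _ _) _.
    have -> : (3 + Ms) * (Num.sqrt T * (b^-1 ^+ 2 * conK a b)) =
       Num.sqrt T * (b^-1 ^+ 2 * conK a b) * 2 + (1 + Ms) * (Num.sqrt T * (b^-1 ^+ 2 * conK a b)).
      by move: (Num.sqrt T * _) => z; ring.
    by apply: lerD; rewrite cmodM; apply: ler_pM; rewrite ?cmod_ge0.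
  rewrite cK.
  have -> : b^-1 / kapB b * ((3 + Ms) * (Num.sqrt T * (b^-1 ^+ 2 * (b * (kapB b * stirK b))))) =
    stirK b * ((3 + Ms) * Num.sqrt T) * b^-1 ^+ 2.
    by move: (kapB b) k0 (stirK b) (Num.sqrt T) => k k0 t z; field; rewrite !gt_eqF.
  apply: ler_wpM2r; first exact: sqr_ge0.
  by apply: ler_wpM2r st4; apply: mulr_ge0 (sqrtr_ge0 _); exact: addr_ge0.
have := partB_series h s; rewrite -eE => /(_ (cofR (stirK b))) ->.
have me2 : cmod (e ^+ 2) = b^-1 ^+ 2 by rewrite cmodX me.
have hp := Hp s hs; have hq := Hq s hs.
have n1 : cmod (1 + e * pq s + e ^+ 2 * qq s) <= 1 + P0 + Q0.
  apply: le_trans (cmodD _ _) _; apply: lerD.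
    apply: le_trans (cmodD _ _) _; rewrite cmod1 lerD2l cmodM me -[P0]mul1r.
    by apply: ler_pM; rewrite ?cmod_ge0 ?(ltW eb0).
  rewrite cmodM me2 -[Q0]mul1r; apply: ler_pM; rewrite ?cmod_ge0 ?sqr_ge0 //.
  by rewrite exprn_ile1 // ltW.
rewrite [X in _ <= X]mulrDl [in X in _ <= X]mulrDl; apply: le_trans (cmodD _ _) _; apply: lerD.
  apply: le_trans (cmodD _ _) _; apply: lerD.
    by rewrite [X in _ <= X]mulrAC cmodM; apply: ler_pM; rewrite ?cmod_ge0.
  rewrite cmodM me2 mulrC; apply: ler_wpM2r; first exact: sqr_ge0.
  rewrite cmodM; apply: ler_pM; rewrite ?cmod_ge0 //.
  apply: le_trans (cmodD _ _) _; rewrite cmod1; move: (le_trans mh eb1); lra.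
rewrite cmodM cmodM me mulrC; apply: ler_pM; rewrite ?cmod_ge0 ?mulr_ge0 ?cmod_ge0 ?(ltW eb0) //.
by rewrite expr2 ler_pM2l.
Qed.

Lemma partB (K : set C) : compact K -> K `<=` @regB R ->
   exists (M b0 : R), forall b : R, b0 <= b -> forall xi : Cplx R, K xi ->
     let E := cexp (cofR b * (xi - 1 - clog xi)) * cofR (b `^ (a - 2^-1))
              * cofR (Num.sqrt (2 * pi) / Gamma a)
              * xi * cpow (xi - 1) (cofR (a - 1)) in
     let S := 1 + cofR ((12 * b)^-1)
                  * (1 + cofR (12 * a * (a - 1)) / (xi - 1)
                       + cofR (6 * (a - 1) * (a - 2)) / (xi - 1) ^+ 2) in
     `|F11 a b (cofR b * xi) - E * S| <= cofR (M * b ^- 2) * `|E|.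
Proof.
move=> cK KB.
pose P (e : R) (z : C) := [/\ cmod z <= e^-1, 1 + e <= cre z & 1 + e <= phase z].
have [e0 e00 hP] : exists2 e : R, 0 < e & forall w, K w -> P e w.
  apply: (compact_uniform cK).
    move=> e e' w /andP[e0 ee] [h1 h2 h3]; split; [|lra|lra].
    by apply: le_trans h1 _; rewrite lef_pV2 ?posrE // (lt_le_trans e0).
  move=> z /KB [hz1 hz2]; pose m := (cmod z + 1)^-1.
  have m0 : 0 < m by rewrite invr_gt0 ltr_wpDl ?cmod_ge0.
  have z0 : z != 0 by apply: cre_lower_neq0; exact: lt_trans hz1.
  have hz3 : 1 < phase z by move: hz2; rewrite /phase /csq; lra.
  pose e1 := (cre z - 1) / 2; pose e2 := (phase z - 1) / 2.
  have e10 : 0 < e1 by rewrite divr_gt0 // subr_gt0.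
  have e20 : 0 < e2 by rewrite divr_gt0 // subr_gt0.
  have [d d0 hd] := phase_near z0 e20.
  exists (Num.min m (Num.min e1 e2)), (Num.min d (Num.min e1 1)); split.
  - by rewrite !lt_min m0 e10.
  - by rewrite !lt_min d0 e10 ltr01.
  move=> w; rewrite !lt_min => /andP[hw1 /andP[hw2 hw3]].
  have le1 : Num.min m (Num.min e1 e2) <= e1 by rewrite !ge_min lexx ?orbT.
  have le2 : Num.min m (Num.min e1 e2) <= e2 by rewrite !ge_min lexx ?orbT.
  split.
  - apply: (@le_trans _ _ m^-1); last by rewrite lef_pV2 ?posrE ?lt_min ?m0 ?e10 // ge_min lexx.
    rewrite invrK; apply: le_trans (_ : cmod (w - z + z) <= _); first by rewrite subrK.
    by apply: le_trans (cmodD _ _) _; rewrite addrC lerD2l ltW.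
  - by have := cre_near hw2; rewrite ltr_norml => /andP[h _]; move: le1 h; rewrite /e1; lra.
  - by have := hd w hw1; rewrite ltr_norml => /andP[h _]; move: le2 h; rewrite /e2; lra.
pose e := Num.min e0 1.
have e1 : 0 < e <= 1 by rewrite lt_min e00 ltr01 /= ge_min lexx orbT.
have ee0 : e <= e0 by rewrite ge_min lexx.
have Rr1 : 1 <= e^-1 by rewrite invf_ge1; case/andP: e1.
have [M [b1 [b14 H]]] := partB_bound e1 Rr1.
exists M, b1 => b hb xi Kxi; cbv zeta; have [h1 h2 h3] := hP xi Kxi.
have hR : cmod xi <= e^-1.
  by apply: le_trans h1 _; rewrite lef_pV2 ?posrE //; case/andP: e1.
have hx : 1 + e <= cre xi by lra.
have hphi : 1 + e <= phase xi by lra.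
have := H b xi hb hx hphi hR; rewrite !exprVn => h.
by rewrite !normE -cofRM cofR_le; exact: h.
Qed.

End PartBFinal.

Theorem theoremB1 (R : realType) (a : R) (ha : 0 < a) :
  (* (a) uniformly on compact subsets of A *)
  (forall K : set (Cplx R), compact K -> K `<=` @regA R ->
   exists (M b0 : R), forall b : R, b0 <= b -> forall xi : Cplx R, K xi ->
     let w := xi / (1 - xi) in
     let P := cpow (1 - xi) (cofR (- a)) in
     let S := 1 - cofR (a * (a + 1) / 2) * w ^+ 2 * cofR (b^-1)
              + (cofR (a * (a + 1) * (a + 2) * (a + 3) / 8) * w ^+ 4
                 + cofR (2 * a * (a + 1) * (a + 2) / 3) * w ^+ 3
                 + cofR (a * (a + 1) / 2) * w ^+ 2) * cofR (b ^- 2) in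
     `|F11 a b (cofR b * xi) - P * S| <= cofR (M * b ^- 3) * `|P|) /\
  (* (b) uniformly on compact subsets of B *)
  (forall K : set (Cplx R), compact K -> K `<=` @regB R ->
   exists (M b0 : R), forall b : R, b0 <= b -> forall xi : Cplx R, K xi ->
     let E := cexp (cofR b * (xi - 1 - clog xi)) * cofR (b `^ (a - 2^-1))
              * cofR (Num.sqrt (2 * pi) / Gamma a)
              * xi * cpow (xi - 1) (cofR (a - 1)) in
     let S := 1 + cofR ((12 * b)^-1)
                  * (1 + cofR (12 * a * (a - 1)) / (xi - 1)
                       + cofR (6 * (a - 1) * (a - 2)) / (xi - 1) ^+ 2) in
     `|F11 a b (cofR b * xi) - E * S| <= cofR (M * b ^- 2) * `|E|).
Proof. by split; [exact: partA|exact: partB]. Qed.
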